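(* The odd Schur functions are related to the odd elementary and odd forgotten functions as follows: for every partition $\mu$ of $n$, $$(-1)^{\binom{\mu}{2}+|\mu|}e_\mu=\sum_{\lambda\vdash n}(-1)^{\ell(w_\lambda)+|\lambda|}K_{\lambda^T\mu}s_\lambda,$$ and for every partition $\lambda$ of $n$, $$(-1)^{\ell(w_\lambda)+\binom{\lambda^T}{2}+|\lambda|}s_\lambda=\sum_{\mu\vdash n}(-1)^{\binom{\mu}{2}+|\mu|}K_{\lambda^T\mu}f_\mu.$$
   Context: The algebra of odd symmetric functions: let $\Bbbk$ be a commutative ring and $\Lambda'$ the free associative $\mathbb{Z}$-graded $\Bbbk$-algebra on $h_1,h_2,\dots$ with $\deg h_n=n$; $h_0=1$. For a composition $\alpha=(a_1,\dots,a_k)$ (finite sequence of positive integers) put $h_\alpha=h_{a_1}\cdots h_{a_k}$, $|\alpha|=a_1+\dots+a_k$, $S_\alpha=S_{a_1}\times\dots\times S_{a_k}\subset S_{|\alpha|}$. The symmetric bilinear form on $\Lambda'$ is $(h_\beta,h_\alpha)=\sum_{c\in S_\beta\backslash S_n/S_\alpha}(-1)^{\ell(c)}$ if $|\alpha|=|\beta|=n$, and $0$ if $|\alpha|\ne|\beta|$, where $\ell(c)$ is the Coxeter length of the minimal length element of $c$. Let $\mathcal I$ be the radical of the form and $\Lambda=\Lambda'/\mathcal I$ with the induced grading $\Lambda=\bigoplus_n\Lambda_n$, multiplication and form. Elements $e_n\in\Lambda$ are defined by $e_0=1$ and $\sum_{k=0}^n(-1)^{\binom{k+1}{2}}e_kh_{n-k}=0$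 for $n\ge1$; $e_\alpha=e_{a_1}\cdots e_{a_k}$. Both $\{h_\lambda\}_{\lambda\vdash n}$ and $\{e_\lambda\}_{\lambda\vdash n}$ are bases of $\Lambda_n$. The odd forgotten functions $\{f_\lambda\}_{\lambda\vdash n}$ are the dual basis to $\{e_\lambda\}$: $(e_\lambda,f_\mu)=\delta_{\lambda\mu}$. Odd Kostka numbers: for a semistandard Young tableau $T$ (entries positive integers, non-decreasing along rows, strictly increasing down columns), its row word $w_r(T)$ is obtained by reading the rows from left to right, from the bottom row to the top row; $\mathrm{sign}(T)$ is the sign of the minimal length permutation sorting $w_r(T)$ into non-decreasing order, i.e. $(-1)$ to the number of pairs of positions $i<j$ whose letters satisfy $w_i>w_j$. The content of $T$ is $(a_1,a_2,\dots)$, $a_i$ the number of entries equal to $i$. $T_\lambda$ is the unique semistandard tableau with shape and content both $\lambda$. For $\lambda,\mu\vdash n$, $K_{\lambda\mu}=\mathrm{sign}(T_\lambda)\sum_T\mathrm{sign}(T)$, sum over semistandard $T$ of shape $\lambda$ and content $\mu$. The odd Schur functions $s_\lambda\in\Lambda_n$, $\lambda\vdash n$, are defined by $h_\mu=\sum_{\lambda\vdash n}K_{\lambda\mu}s_\lambda$ for all $\mu\vdash n$. $\lambda^T$ is the transpose partition; $\binom{\nu}{2}=\sum_i\binom{\nu_i}{2}$ for a partition $\nu$. $\ell(w_\lambda)$ is the number of pairs of boxes of the Young diagram of $\lambda$ in which one box is strictly below and strictly to the left of the other (rows numbered downwards). *)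

(* Defs.v *)
From HB Require Import structures.
From mathcomp Require Import all_boot all_order all_algebra all_fingroup.
From mathcomp Require Import finmap.
From mathcomp.multinomials Require Import monalg.

Set Implicit Arguments.
Unset Strict Implicit.
Unset Printing Implicit Defensive.

Import GRing.Theory.

Definition simple_refl n : {set 'S_n} :=
  [set tperm p.1 p.2 | p : 'I_n * 'I_n & p.2 == p.1.+1 :> nat].

Lemma simple_refl_gen n : <<simple_refl n>>%g = [set: 'S_n].
Proof.
apply/eqP; rewrite -subTset; apply/subsetP => w _.
have tpG d (i j : 'I_n) : j = i + d :> nat -> tperm i j \in <<simple_refl n>>%g.
  elim: d j => [|d IHd] j Eij.
    suff -> : j = i by rewrite tperm1 group1.
    by apply: val_inj; rewrite /= Eij addn0.
  have lt_m : i + d < n by rewrite (leq_trans _ (ltn_ord j)) // Eij addnS.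
  pose m := Ordinal lt_m.
  have mjG : tperm m j \in <<simple_refl n>>%g.
    by apply/mem_gen/imsetP; exists (m, j); rewrite ?inE //= Eij addnS.
  have [<-|Nim] := eqVneq m i; first exact: mjG.
  have -> : tperm i j = (tperm i m ^ tperm m j)%g.
    rewrite tpermJ tpermL tpermD // 1?eq_sym //.
    by apply/eqP => /(congr1 val) /= /eqP; rewrite Eij -[X in X == _]addn0 eqn_add2l.
  by rewrite groupJ ?IHd.
case: n w tpG => [|n] w tpG.
  suff -> : w = 1%g by exact: group1.
  by apply/permP => -[].
have: w \in <<[set tperm ord0 y | y in 'I_n.+1]>>%g by rewrite gen_tperm inE.
by apply/subsetP; rewrite gen_subG; apply/subsetP => _ /imsetP[y _ ->]; apply: (tpG y).
Qed.

Definition is_refl_word n (w : 'S_n) k (c : {ffun 'I_k -> 'S_n}) : bool :=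
  [forall i, c i \in simple_refl n] && (w == \prod_i c i)%g.

Lemma refl_word_ex n (w : 'S_n) : exists k, [exists c, @is_refl_word n w k c].
Proof.
have: w \in <<simple_refl n>>%g by rewrite simple_refl_gen inE.
case/gen_prodgP => k [c cS ->]; exists k; apply/existsP; exists [ffun i => c i].
apply/andP; split; first by apply/forallP => i; rewrite ffunE.
by apply/eqP/eq_bigr => i _; rewrite ffunE.
Qed.

Definition coxlen n (w : 'S_n) : nat := ex_minn (refl_word_ex w).

(* S_alpha: permutations preserving each of the consecutive blocks of lengths
   a_1, ..., a_k; [reshape_index al i] is the block containing [i]. *)
Definition young_subgroup n (al : seq nat) : {set 'S_n} :=
  [set w : 'S_n | [forall i, reshape_index al (w i) == reshape_index al i]].

Definition double_cosets n (be al : seq nat) : {set {set 'S_n}} :=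
  [set (young_subgroup n be * [set w] * young_subgroup n al)%g | w : 'S_n].

Definition coset_len n (c : {set 'S_n}) : nat :=
  coxlen [arg min_(w < repr c in c) coxlen w].

Local Open Scope ring_scope.

Definition posnat := {a : nat | (0 < a)%N}.

Definition composition := {fmonom posnat}.

Definition comp_seq (al : composition) : seq nat :=
  [seq val a | a <- fmonom_val al].

Definition freeAlg (k : comNzRingType) := {malg k[composition]}.

Definition free_h (k : comNzRingType) (n : nat) : freeAlg k :=
  if insub n is Some a then mkmalgU (fmu (a : posnat)) 1 else 1.

Definition comp_form (k : comNzRingType) (be al : seq nat) : k :=
  if sumn be == sumn al then
    \sum_(c in double_cosets (sumn al) be al) (-1) ^+ coset_len c
  else 0.

Definition free_form (k : comNzRingType) (x y : freeAlg k) : k :=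
  \sum_(be <- msupp x) \sum_(al <- msupp y)
    x@_be * y@_al * comp_form k (comp_seq be) (comp_seq al).

Definition in_radical (k : comNzRingType) (x : freeAlg k) : Prop :=
  forall y, free_form x y = 0.

Definition free_homog (k : comNzRingType) (n : nat) (x : freeAlg k) : Prop :=
  forall al, al \in msupp x -> sumn (comp_seq al) = n.

(* The quotient of [freeAlg k] by the radical, as an algebra and with the
   induced form; these data are unique up to unique isomorphism.  It is given
   by its projection since ring quotients are only available in the
   commutative case. *)
Record oddSym (k : comNzRingType) := OddSym {
  osAlg :> algType k;
  osPi : {lrmorphism freeAlg k -> osAlg};
  osForm : osAlg -> osAlg -> k;
  osPi_surj : forall y, exists x, osPi x = y;
  osPi_ker : forall x, osPi x = 0 <-> in_radical x;
  osFormE : forall x y, osForm (osPi x) (osPi y) = free_form x y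
}.

Section OddSym.
Variables (k : comNzRingType) (L : oddSym k).

Definition odd_h (n : nat) : L := osPi L (free_h k n).

Definition os_homog (n : nat) (y : L) : Prop :=
  exists2 x, free_homog n x & y = osPi L x.

Definition seq_prod (g : nat -> L) (al : seq nat) : L := \prod_(a <- al) g a.

End OddSym.

Definition is_intpart (n : nat) (la : seq nat) : bool :=
  [&& sorted geq la, 0%N \notin la & sumn la == n].

Record intpart (n : nat) := Partn { parts :> seq nat; intpartP : is_intpart n parts }.

HB.instance Definition _ n := [isSub for @parts n].
HB.instance Definition _ n := [Countable of intpart n by <:].

Definition intpart_tuple n (la : intpart n) : {ffun 'I_n -> 'I_n.+1} :=
  [ffun i : 'I_n => inord (nth 0%N la i)].
Definition intpart_untuple n (t : {ffun 'I_n -> 'I_n.+1}) : option (intpart n) :=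
  insub [seq x <- [seq val (t i) | i <- enum 'I_n] | x != 0%N].

Lemma intpart_tupleK n : pcancel (@intpart_tuple n) (@intpart_untuple n).
Proof.
case=> la laP; rewrite /intpart_untuple; set s := filter _ _.
suff -> : s = la by rewrite (insubT (is_intpart n)).
have [_ la0 /eqP sum_la] := and3P laP.
have le_sum m : (m \in la -> m <= n)%N.
  by rewrite -sum_la sumnE => mla; rewrite (big_rem m) //= leq_addr.
have size_la : (size la <= n)%N.
  rewrite -sum_la; elim: (la) (la0) => //= a l IHl.
  by rewrite inE negb_or => /andP[a0 /IHl]; case: a a0 => // a _; rewrite addSn ltnS => /leq_trans->//; rewrite leq_addl.
have Es : [seq val (intpart_tuple (Partn laP) i) | i <- enum 'I_n] =
    la ++ nseq (n - size la) 0%N.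
  apply: (@eq_from_nth _ 0%N); first by rewrite size_cat size_nseq size_map size_enum_ord subnKC.
  rewrite size_map size_enum_ord => i lt_in.
  rewrite (nth_map (Ordinal lt_in)) ?size_enum_ord // nth_cat nth_nseq if_same.
  rewrite ffunE /= inordK ?nth_enum_ord ?ltnS //.
    by case: ltnP => // /(nth_default 0%N).
  by case: (ltnP i (size la)) => [/(mem_nth 0%N)/le_sum //|/(nth_default 0%N)->].
rewrite /s Es filter_cat.
rewrite (_ : filter _ (nseq _ _) = [::]) ?cats0; last by elim: (n - size la)%N.
by apply/all_filterP/allP => x xla; apply: contraNneq la0 => <-.
Qed.

HB.instance Definition _ n :=
  isFinite.Build (intpart n) (pcan_enumP (@intpart_tupleK n)).

Definition conj_part (la : seq nat) : seq nat :=
  [seq count (fun a => (j < a)%N) la | j <- iota 0 (head 0%N la)].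

Definition binom2 (la : seq nat) : nat := (\sum_(a <- la) 'C(a, 2))%N.

(* Rows and columns are numbered from 0, rows downwards. *)
Definition box (la : seq nat) := {i : 'I_(size la) & 'I_(nth 0%N la i)}.
Definition row_of la (b : box la) : nat := tag b.
Definition col_of la (b : box la) : nat := tagged b.

(* l(w_la): the box [p.1] of the pair is the lower left one. *)
Definition len_w (la : seq nat) : nat :=
  #|[set p : box la * box la |
      (row_of p.2 < row_of p.1)%N && (col_of p.1 < col_of p.2)%N]|.

Definition semistandard la (T : box la -> nat) : bool :=
  [&& [forall b, 0 < T b]%N,
      [forall b, forall b', (row_of b == row_of b') && (col_of b < col_of b')%N
         ==> (T b <= T b')%N] &
      [forall b, forall b', (col_of b == col_of b') && (row_of b < row_of b')%N
         ==> (T b < T b')%N]].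

Definition row_word la (T : box la -> nat) : seq nat :=
  [seq T (Tagged (fun i : 'I_(size la) => 'I_(nth 0%N la i)) j)
     | i : 'I_(size la) <- rev (enum 'I_(size la)),
       j : 'I_(nth 0%N la i) <- enum 'I_(nth 0%N la i)].

Definition word_inv (w : seq nat) : nat :=
  (\sum_(i < size w) \sum_(j < size w | i < j) (nth 0 w j < nth 0 w i))%N.

Definition tab_sign la (T : box la -> nat) : int := (-1) ^+ word_inv (row_word T).

(* T_la, the only semistandard tableau of shape and content [la]: row [i] is
   filled with [i.+1]. *)
Definition superstandard la (b : box la) : nat := (row_of b).+1.

(* Entries of a tableau of content [mu] lie between 1 and [size mu]. *)
Definition ssyt (la mu : seq nat) : {set {ffun box la -> 'I_(size mu).+1}} :=
  [set T : {ffun box la -> 'I_(size mu).+1} | semistandard (fun b => T b : nat) &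
    [forall i : 'I_(size mu), #|[set b | T b == i.+1 :> nat]| == nth 0%N mu i]].

Definition odd_kostka (la mu : seq nat) : int :=
  tab_sign (@superstandard la) *
  \sum_(T in ssyt la mu) tab_sign (fun b => T b : nat).

Section Families.
Variables (k : comNzRingType) (L : oddSym k).

Definition is_odd_elementary (e : nat -> L) : Prop :=
  e 0%N = 1 /\
  forall n, (0 < n)%N ->
    \sum_(i < n.+1) (-1) ^+ 'C(i.+1, 2) * e i * odd_h L (n - i) = 0.

Definition is_odd_schur (s : forall n, intpart n -> L) : Prop :=
  forall n,
    (forall la : intpart n, os_homog n (s n la)) /\
    (forall mu : intpart n,
       seq_prod (odd_h L) mu = \sum_(la : intpart n) (odd_kostka la mu)%:~R *: s n la).

Definition is_odd_forgotten (e : nat -> L) (f : forall n, intpart n -> L) : Prop :=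
  forall n,
    (forall mu : intpart n, os_homog n (f n mu)) /\
    (forall la mu : intpart n, osForm (seq_prod e la) (f n mu) = (la == mu)%:R).

End Families.

(* Main.v *)
(** Removing the strip of largest entries turns a signed sum over semistandard
    tableaux into a signed sum over chains of horizontal strips.  The sign of a
    chain is so nearly linear that adding a strip and then removing one can be
    exchanged with removing and then adding up to an explicit sign: for fixed
    lower partitions [la] and [mu] each row of the partition in the middle
    ranges over an interval, and the reflection of these intervals matches the
    two sides.  Iterating the exchange gives a signed Cauchy identity
      sum_la eps_la K_{la,be} K_{la,al} = signed number of matrices with row
      sums be and column sums al,
    whose right-hand side is the form [(h_be, h_al)], since double cosets of
    Young subgroups are such matrices and the length of a minimal representative
    counts inversions.  As [K] is unitriangular and the form is nondegenerate on
    the quotient, the odd Schur functions are orthogonal with norms [eps_la] and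
    multiplication by [h_a] adds signed horizontal strips.  Multiplication by
    [e_a] then adds signed vertical strips: the recursion defining [e_a] reduces
    to the vanishing of a signed sum over all ways of going from [la] to [rho]
    by a vertical strip followed by a horizontal one, which is cancelled by
    toggling a box in the last row where [la] and [rho] differ. *)
Require Import Defs.
From mathcomp Require Import all_boot all_order all_algebra all_fingroup.
From mathcomp Require Import finmap.
From mathcomp Require Import zify ring.
From Stdlib Require Import Btauto.
From mathcomp.multinomials Require Import monalg.

Set Implicit Arguments.
Unset Strict Implicit.
Unset Printing Implicit Defensive.

Import GRing.Theory.
Local Open Scope ring_scope.

(** The [h_n] do not commute, so nondegeneracy has to be tested on [h_nu] for all compositions [nu],
    whereas the odd Schur functions are defined through partitions only. This is why the Cauchy
    identity is proved for contents in any order, and why the Schur expansion is carried over from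
    partitions to compositions before products are computed. The ring [k] is arbitrary, so nothing
    may be divided. Unitriangularity therefore enters as a separation principle: a family vanishes
    as soon as all its combinations with the integer coefficients [strip_chains (rev mu)] do. The
    second identity is dual to the first. The difference of its two sides pairs to zero with every
    [e_mu], the norm [eps la] supplying the exponent binom2 of the conjugate. The [e_mu] are, up to
    signs, unitriangular in the odd Schur functions indexed by conjugates, so the difference pairs
    to zero with these as well and vanishes. *)

(** * Reindexing and cancelling sums *)

Lemma big_seq_bij (R : nmodType) (I J : eqType) (r : seq I) (s : seq J)
    (P : pred I) (Q : pred J) (F : I -> R) (G : J -> R) (f : I -> J) (g : J -> I) :
    uniq r -> uniq s ->
    (forall x, x \in r -> P x -> [/\ f x \in s, Q (f x), g (f x) = x & F x = G (f x)]) ->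
    (forall y, y \in s -> Q y -> [/\ g y \in r, P (g y) & f (g y) = y]) ->
  \sum_(x <- r | P x) F x = \sum_(y <- s | Q y) G y.
Proof.
move=> Ur Us fP gP; rewrite -[LHS]big_filter -[RHS]big_filter.
have fP' x : x \in filter P r ->
    [/\ f x \in s, Q (f x), g (f x) = x & F x = G (f x)].
  by rewrite mem_filter => /andP[Px xr]; apply: fP.
rewrite (_ : \sum_(y <- filter Q s) G y = \sum_(y <- map f (filter P r)) G y).
  rewrite big_map [LHS]big_seq [RHS]big_seq; apply: eq_bigr => x /fP'.
  by case.
apply: perm_big; apply: uniq_perm; first exact: filter_uniq.
  rewrite map_inj_in_uniq ?filter_uniq // => x y /fP'[_ _ Ex _] /fP'[_ _ Ey _] E.
  by rewrite -Ex E.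
move=> y; rewrite mem_filter; apply/andP/mapP => [[Qy ys]|[x /fP'[]]]; last first.
  by move=> ? ? _ _ ->.
by have [gr Pg fg] := gP y ys Qy; exists (g y); rewrite ?fg // mem_filter Pg.
Qed.

(** The values are integers because [S = - S] has to force [S = 0]. *)
Lemma big_seq_cancel (I : eqType) (r : seq I) (P : pred I) (F : I -> int) (g : I -> I) :
    uniq r ->
    (forall x, x \in r -> P x -> [/\ g x \in r, P (g x), g (g x) = x & F (g x) = - F x]) ->
  \sum_(x <- r | P x) F x = 0.
Proof.
move=> Ur gP; set S := LHS; suff : S = - S by lia.
rewrite /S -sumrN; apply: (big_seq_bij (f := g) (g := g)) => // x xr Px.
  by have [? ? -> ->] := gP x xr Px; rewrite opprK.
by have [] := gP x xr Px.
Qed.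

Lemma signr_eq (R : pzRingType) m n : odd m = odd n -> (-1) ^+ m = (-1) ^+ n :> R.
Proof. by move=> E; rewrite -[LHS]signr_odd E signr_odd. Qed.

(** * Partitions *)

Definition is_part (la : seq nat) := sorted geq la && (0%N \notin la).

Lemma is_intpartE n la : is_intpart n la = is_part la && (sumn la == n).
Proof. by rewrite /is_intpart /is_part andbA. Qed.

Lemma sumn_nth R la : (size la <= R)%N -> sumn la = (\sum_(i < R) nth 0 la i)%N.
Proof.
elim: R la => [|R IH] [|a la] //= lt_la; rewrite ?big_ord0 //.
  by rewrite big1 // => i _; rewrite nth_nil.
by rewrite big_ord_recl /= -IH.
Qed.

Lemma part_noninc la i j : is_part la -> (i <= j)%N -> (nth 0 la j <= nth 0 la i)%N.
Proof.
case/andP=> srt _ le_ij; case: (ltnP j (size la)) => [ltj|/(nth_default 0%N)->//].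
apply: (sorted_leq_nth _ _ 0%N srt) => //; rewrite ?inE //; first last.
- exact: leq_ltn_trans ltj.
- by move=> x /=.
- by move=> y x z /= h1 h2; apply: leq_trans h2 h1.
Qed.

Lemma part_nth_gt0 la i : is_part la -> (0 < nth 0 la i)%N = (i < size la)%N.
Proof.
case/andP=> _ la0; case: (ltnP i (size la)) => [lti|/(nth_default 0%N)->//].
by rewrite lt0n; apply: contraNneq la0 => <-; rewrite mem_nth.
Qed.

Lemma part_ext la mu : is_part la -> is_part mu -> nth 0%N la =1 nth 0%N mu -> la = mu.
Proof.
move=> laP muP E; have Es : size la = size mu.
  have lt_eq i : (i < size la)%N = (i < size mu)%N by rewrite -!part_nth_gt0 ?E.
  by have := lt_eq (size la); have := lt_eq (size mu); rewrite !ltnn; lia.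
by apply: (eq_from_nth Es).
Qed.

Lemma part_size_le la : is_part la -> (size la <= sumn la)%N.
Proof.
case/andP=> _; elim: la => //= a l IHl; rewrite inE negb_or [0%N == a]eq_sym -lt0n.
by case/andP=> a0 /IHl h; have := leq_add a0 h; rewrite add1n.
Qed.

(** Cutting at the first zero keeps zero parts out of the list, so that a partition can be given by
    a weakly decreasing function of the row. *)
Fixpoint mkpart (R : nat) (p : nat -> nat) : seq nat :=
  if R is R'.+1 then if p 0%N == 0%N then [::] else p 0%N :: mkpart R' (p \o succn)
  else [::].

Section MkPart.
Variables (R : nat) (p : nat -> nat).
Hypotheses (p_noninc : forall i, (p i.+1 <= p i)%N) (pR : p R = 0%N).

Lemma nth_mkpart i : nth 0%N (mkpart R p) i = p i.
Proof.
elim: R p p_noninc pR i => [|r IH] q qn qr i /=.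
  rewrite nth_nil; apply/esym/eqP; rewrite -leqn0 -qr.
  by elim: i => //= i; apply: leq_trans (qn _).
have qle j : (q j <= q 0)%N by elim: j => //= j; apply: leq_trans (qn _).
case: eqP => [q0|_]; first by rewrite nth_nil; have := qle i; rewrite q0; lia.
by case: i => //= i; rewrite IH //= => j; apply: qn.
Qed.

Lemma mkpart_part : is_part (mkpart R p).
Proof.
rewrite /is_part; apply/andP; split; last first.
  by elim: R (p) => //= r IH q; case: eqP => //= /eqP q0; rewrite inE negb_or eq_sym q0 IH.
apply/(sortedP 0%N) => i _; rewrite !nth_mkpart; exact: p_noninc.
Qed.

Lemma size_mkpart : (size (mkpart R p) <= R)%N.
Proof. by elim: R (p) => //= r IH q; case: eqP => //= _; rewrite ltnS IH. Qed.

Lemma sumn_mkpart : sumn (mkpart R p) = (\sum_(i < R) p i)%N.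
Proof. by rewrite (sumn_nth size_mkpart); apply: eq_bigr => i _; rewrite nth_mkpart. Qed.

End MkPart.

(** Plain lists replace [intpart n] because chains of strips pass through partitions of many
    sizes. *)
Definition partns n : seq (seq nat) := [seq val la | la <- enum {: intpart n}].

Lemma mem_partns n la : (la \in partns n) = is_part la && (sumn la == n).
Proof.
rewrite -is_intpartE; apply/mapP/idP => [[x _ ->]|laP]; first exact: intpartP.
by exists (Partn laP); rewrite ?mem_enum.
Qed.

Lemma partnsP n la : la \in partns n -> is_part la /\ sumn la = n.
Proof. by rewrite mem_partns => /andP[-> /eqP]. Qed.

Lemma partns_uniq n : uniq (partns n).
Proof. by rewrite map_inj_uniq ?enum_uniq //; apply: val_inj. Qed.

Lemma sum_partns (R : nmodType) n (F : seq nat -> R) :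
  \sum_(la : intpart n) F la = \sum_(la <- partns n) F la.
Proof. by rewrite big_map big_enum. Qed.

Lemma partns0 : partns 0 = [:: [::]].
Proof.
apply: perm_small_eq => //; apply: uniq_perm; rewrite ?partns_uniq // => la.
rewrite mem_partns inE; apply/andP/eqP => [[laP]|->//].
by have := part_size_le laP; case: la laP => //= a l _ h /eqP E; rewrite E in h.
Qed.

(** * Horizontal strips *)

Definition hstrip (ka la : seq nat) :=
  all (fun i => (nth 0 la i.+1 <= nth 0 ka i <= nth 0 la i)%N)
      (iota 0 (maxn (size ka) (size la))).

Lemma hstripP ka la :
  reflect (forall i, (nth 0 la i.+1 <= nth 0 ka i <= nth 0 la i)%N) (hstrip ka la).
Proof.
apply: (iffP allP) => [H i|H i _]; last exact: H.
case: (ltnP i (maxn (size ka) (size la))) => [lti|]; first by apply: H; rewrite mem_iota.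
rewrite geq_max => /andP[h1 h2].
by rewrite !nth_default // (leq_trans h2).
Qed.

Definition psum (la : seq nat) i := (\sum_(j < i) nth 0 la j)%N.

Lemma psumS la i : psum la i.+1 = (psum la i + nth 0 la i)%N.
Proof. by rewrite /psum big_ord_recr. Qed.

Lemma psum0 la : psum la 0 = 0%N.
Proof. by rewrite /psum big_ord0. Qed.

Lemma psum_size la R : (size la <= R)%N -> psum la R = sumn la.
Proof. by move=> /sumn_nth->. Qed.

(* Reading rows from the bottom up, the largest entries, filling [la / ka], are
   inverted with the smaller entries of the rows above them. *)
Definition hexp (ka la : seq nat) :=
  (\sum_(i < size la) (nth 0 la i - nth 0 ka i) * psum ka i)%N.

Lemma hexpE R ka la : (size la <= R)%N ->
  hexp ka la = (\sum_(i < R) (nth 0 la i - nth 0 ka i) * psum ka i)%N.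
Proof.
move=> leR; rewrite /hexp (big_ord_widen R (fun i => (nth 0 la i - nth 0 ka i) * psum ka i)%N leR).
rewrite big_mkcond /=; apply: eq_bigr => i _; case: ltnP => // h.
by rewrite (nth_default _ h).
Qed.

Definition strip_wt (ka la : seq nat) : int :=
  if hstrip ka la then (-1) ^+ hexp ka la else 0.

Lemma hstrip_sumn ka la : hstrip ka la -> (sumn ka <= sumn la)%N.
Proof.
move/hstripP => H; pose R := maxn (size ka) (size la).
rewrite (@sumn_nth R ka) ?leq_maxl // (@sumn_nth R la) ?leq_maxr //.
by apply: leq_sum => i _; have /andP[] := H i.
Qed.

Lemma strip_wt_sumn ka la : (sumn la < sumn ka)%N -> strip_wt ka la = 0.
Proof. by rewrite /strip_wt; case: ifP => // /hstrip_sumn; lia. Qed.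

(** The norm of the odd Schur function of [la] ([sigma_orth]); for a partition the exponent counts
    the pairs of boxes in a common column ([binom2_conj]). *)
Definition eps (la : seq nat) : int := (-1) ^+ (\sum_(i < size la) i * nth 0 la i)%N.

Lemma eps_expE R la : (size la <= R)%N ->
  (\sum_(i < size la) i * nth 0 la i = \sum_(i < R) i * nth 0 la i)%N.
Proof.
move=> leR; rewrite (big_ord_widen R (fun i => i * nth 0 la i)%N leR).
rewrite big_mkcond /=; apply: eq_bigr => i _; case: ltnP => // h.
by rewrite (nth_default _ h) muln0.
Qed.

(* [q] is a content read backwards: its head counts the largest entries. *)
Fixpoint strip_chains (q la : seq nat) : int :=
  if q is _ :: q' then \sum_(ka <- partns (sumn q')) strip_wt ka la * strip_chains q' ka
  else (la == [::])%:R.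

Definition partns_upto N : seq (seq nat) := flatten [seq partns d | d <- iota 0 N.+1].

Lemma mem_partns_upto N la : (la \in partns_upto N) = is_part la && (sumn la <= N)%N.
Proof.
apply/flatten_mapP/andP => [[d]|[laP leN]].
  by rewrite mem_iota ltnS => /andP[_ led] /partnsP[-> ->].
by exists (sumn la); rewrite ?mem_iota ?ltnS ?leN // mem_partns laP eqxx.
Qed.

Lemma partns_upto_uniq N : uniq (partns_upto N).
Proof.
rewrite /partns_upto; elim: N.+1 0%N => //= n IH i; rewrite cat_uniq partns_uniq IH andbT /=.
apply/hasPn => la /flatten_mapP[d]; rewrite mem_iota => /andP[lid _] /partnsP[_ sd].
by rewrite mem_partns sd gtn_eqF ?andbF.
Qed.

Lemma sum_partns_upto (R : nmodType) N (P : pred (seq nat)) (F : seq nat -> R) :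
  \sum_(la <- partns_upto N | P la) F la = \sum_(d < N.+1) \sum_(la <- partns d | P la) F la.
Proof.
by rewrite big_mkcond big_flatten big_map -[iota _ _]/(index_iota 0 N.+1) big_mkord;
   apply: eq_bigr => d _; rewrite [RHS]big_mkcond.
Qed.

(** * Exchanging the addition and the removal of horizontal strips *)

Lemma addb_xorb a b : a (+) b = xorb a b.
Proof. by case: a; case: b. Qed.

(* Truncating all sums at [T] leaves a boundary term, which makes the identity
   provable by induction; it vanishes once [T] exceeds the number of parts. *)
Lemma strip_swap_parity (l m k r : nat -> nat) T :
    (forall i, k i <= minn (l i) (m i))%N ->
    (forall i, maxn (l i.+1) (m i.+1) <= r i)%N ->
    (forall i, r i + k i = minn (l i) (m i) + maxn (l i.+1) (m i.+1))%N ->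
  let S (f : nat -> nat) (t : nat) := (\sum_(i < t) f i)%N in
  odd (\sum_(i < T) (i.+1 * r i + (r i - l i.+1) * S l i.+1 + (r i - m i.+1) * S m i.+1)) =
  odd ((S l T - S k T) * (S m T - S k T)
    + \sum_(i < T) (i * l i + i * m i + i * k i + (l i - k i) * S k i + (m i - k i) * S k i)
    + maxn (l T) (m T) * (T + S l T + S m T) + l T * S l T + m T * S m T).
Proof.
move=> kle rge rk S.
have kl i : (k i <= l i)%N by have := kle i; rewrite leq_min => /andP[].
have km i : (k i <= m i)%N by have := kle i; rewrite leq_min => /andP[].
have rl i : (l i.+1 <= r i)%N by have := rge i; rewrite geq_max => /andP[].
have rm i : (m i.+1 <= r i)%N by have := rge i; rewrite geq_max => /andP[].
have SS f i : S f i.+1 = (S f i + f i)%N by rewrite /S big_ord_recr.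
have Sk f i : (forall i, k i <= f i)%N -> (S k i <= S f i)%N.
  by move=> h; apply: leq_sum => j _; apply: h.
elim: T => [|T IH]; first by rewrite /S !big_ord0 /= !muln0.
rewrite 2!big_ord_recr /= !SS.
have -> : (S l T + l T - (S k T + k T) = (S l T - S k T) + (l T - k T))%N.
  by have := Sk l T kl; have := kl T; lia.
have -> : (S m T + m T - (S k T + k T) = (S m T - S k T) + (m T - k T))%N.
  by have := Sk m T km; have := km T; lia.
move: IH; rewrite !oddD !oddM !oddD !oddB ?Sk // /= => ->.
have Er : odd (r T) = odd (k T) (+) (odd (minn (l T) (m T)) (+) odd (maxn (l T.+1) (m T.+1))).
  by have := congr1 odd (rk T); rewrite !oddD => <-; case: (odd _); case: (odd _).
have En : odd (minn (l T) (m T)) = odd (l T) (+) odd (m T) (+) odd (maxn (l T) (m T)).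
  by case: (leqP (l T) (m T)) => h; do 2 case: (odd _).
rewrite Er En.
(* A maximum has the parity of one of its arguments; after this case distinction the claim is a
   Boolean tautology. *)
have Em a b : odd (maxn a b) = odd a \/ odd (maxn a b) = odd b.
  by case: (leqP a b) => _; [right|left].
by case: (Em (l T) (m T)) => ->; case: (Em (l T.+1) (m T.+1)) => ->;
  rewrite !addb_xorb; btauto.
Qed.

Section StripSwap.
Variables (la mu : seq nat) (N : nat).
Hypotheses (laP : is_part la) (muP : is_part mu).

Let R := maxn (size la) (size mu).
Let lo i := maxn (nth 0%N la i) (nth 0%N mu i).
Let hi i := minn (nth 0%N la i) (nth 0%N mu i).
(** Row [i] of the lower partition and row [i.+1] of the upper one range over the same interval,
    from [lo i.+1] to [hi i], and [up] and [dn] reflect it. Row 0 of the upper partition has no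
    upper bound; the total size [N] fixes it. *)
Let up ka := mkpart R.+1 (fun i => if i is j.+1 then (hi j + lo j.+1 - nth 0 ka j)%N
  else (N - \sum_(j < R) (hi j + lo j.+1 - nth 0 ka j))%N).
Let dn rho := mkpart R (fun i => (hi i + lo i.+1 - nth 0 rho i.+1)%N).

Let laR : (size la <= R)%N. Proof. exact: leq_maxl. Qed.
Let muR : (size mu <= R)%N. Proof. exact: leq_maxr. Qed.

Let lo0 i : (R <= i)%N -> lo i = 0%N.
Proof. by move=> h; rewrite /lo !nth_default // (leq_trans _ h). Qed.

Let hi_lo i : (hi i <= lo i)%N.
Proof. by rewrite /hi /lo geq_min leq_max leqnn. Qed.

Let sum_b : (\sum_(j < R) (hi j + lo j.+1) + lo 0 = sumn la + sumn mu)%N.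
Proof.
rewrite (sumn_nth laR) (sumn_nth muR) -big_split /= big_split /= -addnA.
rewrite [(_ + lo 0)%N]addnC -(big_ord_recl R lo) big_ord_recr /= lo0 // addn0 -big_split /=.
by apply: eq_bigr => j _; rewrite /hi /lo addn_min_max.
Qed.

Let strips_up rho i : hstrip la rho -> hstrip mu rho -> 
  (lo i <= nth 0 rho i)%N && (nth 0 rho i.+1 <= hi i)%N.
Proof.
move=> /hstripP/(_ i)/andP[h1 h2] /hstripP/(_ i)/andP[h3 h4].
by rewrite /lo /hi geq_max leq_min h1 h2 h3 h4.
Qed.

Let strips_dn ka i : hstrip ka la -> hstrip ka mu -> 
  (lo i.+1 <= nth 0 ka i)%N && (nth 0 ka i <= hi i)%N.
Proof.
move=> /hstripP/(_ i)/andP[h1 h2] /hstripP/(_ i)/andP[h3 h4].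
by rewrite /lo /hi geq_max leq_min h1 h2 h3 h4.
Qed.

Let nth_dn rho : hstrip la rho -> hstrip mu rho ->
  (forall i, nth 0 (dn rho) i = hi i + lo i.+1 - nth 0 rho i.+1)%N /\ is_part (dn rho).
Proof.
move=> h1 h2.
have noninc i : (hi i.+1 + lo i.+2 - nth 0 rho i.+2 <= hi i + lo i.+1 - nth 0 rho i.+1)%N.
  have /andP[_ a1] := strips_up i h1 h2; have /andP[a2 a3] := strips_up i.+1 h1 h2.
  by have /andP[a4 _] := strips_up i.+2 h1 h2; have := hi_lo i.+1; lia.
have R0 : (hi R + lo R.+1 - nth 0 rho R.+1)%N = 0%N.
  by have := hi_lo R; rewrite lo0 // (lo0 (leqnSn R)); lia.
by split; [move=> i; apply: nth_mkpart | apply: mkpart_part].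
Qed.

Let size_rho rho : is_part rho -> hstrip la rho -> hstrip mu rho -> (size rho <= R.+1)%N.
Proof.
move=> rhoP h1 h2; have /andP[_] := strips_up R h1 h2; have := hi_lo R; rewrite lo0 //.
by case: (leqP (size rho) R.+1) => //; rewrite -part_nth_gt0 //; lia.
Qed.

Let nth_up ka : is_part ka -> (sumn la + sumn mu <= N + sumn ka)%N ->
    hstrip ka la -> hstrip ka mu ->
  [/\ forall i, nth 0 (up ka) i.+1 = (hi i + lo i.+1 - nth 0 ka i)%N,
     is_part (up ka), (lo 0 <= nth 0 (up ka) 0)%N & sumn (up ka) = N].
Proof.
move=> kaP leN h1 h2; pose p := fun i => if i is j.+1 then (hi j + lo j.+1 - nth 0 ka j)%N
  else (N - \sum_(j < R) (hi j + lo j.+1 - nth 0 ka j))%N.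
have Es : (\sum_(j < R) (hi j + lo j.+1 - nth 0 ka j) + sumn ka + lo 0 = sumn la + sumn mu)%N.
  rewrite -sum_b (@sumn_nth R) -?big_split /=; last first.
    case: (leqP (size ka) R) => //; rewrite -part_nth_gt0 //.
    by have /andP[_] := strips_dn R h1 h2; have := hi_lo R; rewrite lo0 //; lia.
  by congr (_ + _)%N; apply: eq_bigr => i _; have /andP[] := strips_dn i h1 h2; lia.
have le0 : (lo 0 <= p 0)%N.
  by rewrite /p; move: Es; set s := (\sum_(j < R) _)%N; move: leN; lia.
have noninc i : (p i.+1 <= p i)%N.
  case: i => [|i] /=; last first.
    have /andP[a1 a2] := strips_dn i h1 h2; have /andP[a3 a4] := strips_dn i.+1 h1 h2.
    by have := hi_lo i.+1; lia.
  apply: leq_trans le0; have /andP[a1 a2] := strips_dn 0 h1 h2; have := hi_lo 0; lia.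
have pR : p R.+1 = 0%N.
  by rewrite /=; have := hi_lo R; rewrite lo0 // (lo0 (leqnSn R)); lia.
split.
- by move=> i; rewrite nth_mkpart.
- exact: mkpart_part.
- by rewrite nth_mkpart.
- rewrite sumn_mkpart // big_ord_recl /=.
  by move: Es leN; set s := (\sum_(j < R) _)%N; have := laP; lia.
Qed.

(** The condition on [ka] says that row 0 of its partner, which is determined by the size [N], is at
    least [lo 0], as both strips require. *)
Lemma strip_swap :
  \sum_(rho <- partns N) eps rho * strip_wt la rho * strip_wt mu rho =
  \sum_(ka <- partns_upto N | (sumn la + sumn mu <= N + sumn ka)%N)
    (-1) ^+ ((sumn la - sumn ka) * (sumn mu - sumn ka)) * eps la * eps mu * eps ka
      * strip_wt ka la * strip_wt ka mu.
Proof.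
transitivity (\sum_(rho <- partns N | hstrip la rho && hstrip mu rho) eps rho *
  strip_wt la rho * strip_wt mu rho).
  rewrite [RHS]big_mkcond /=; apply: eq_bigr => rho _; rewrite /strip_wt.
  by case: ifP => [_|]; case: ifP => // _; rewrite ?mulr0 ?mul0r.
symmetry; transitivity (\sum_(ka <- partns_upto N | (sumn la + sumn mu <= N + sumn ka)%N &&
    (hstrip ka la && hstrip ka mu))
    (-1) ^+ ((sumn la - sumn ka) * (sumn mu - sumn ka)) * eps la * eps mu * eps ka
      * strip_wt ka la * strip_wt ka mu).
  rewrite [RHS]big_mkcondr /=; apply: eq_bigr => rho _; rewrite /strip_wt.
  by case: ifP => [_|]; case: ifP => // _; rewrite ?mulr0 ?mul0r.
symmetry; apply: (big_seq_bij (f := dn) (g := up)); rewrite ?partns_uniq ?partns_upto_uniq //.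
  move=> rho /partnsP[rhoP rhoN] /andP[h1 h2]; have [nd dP] := nth_dn h1 h2.
  have sR := size_rho rhoP h1 h2.
  have dle i : (nth 0 (dn rho) i <= hi i)%N.
    by rewrite nd; have /andP[] := strips_up i.+1 h1 h2; lia.
  have dge i : (lo i.+1 <= nth 0 (dn rho) i)%N.
    by rewrite nd; have /andP[] := strips_up i h1 h2; lia.
  have s1 : hstrip (dn rho) la.
    by apply/hstripP => i; have := dle i; have := dge i; rewrite /lo /hi; lia.
  have s2 : hstrip (dn rho) mu.
    by apply/hstripP => i; have := dle i; have := dge i; rewrite /lo /hi; lia.
  have sd : (size (dn rho) <= R)%N by apply: size_mkpart.
  have Er i : (nth 0 rho i.+1 + nth 0 (dn rho) i = hi i + lo i.+1)%N.
    by rewrite nd; have /andP[] := strips_up i h1 h2; lia.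
  have EN : (N + sumn (dn rho) + lo 0 = nth 0 rho 0 + sumn la + sumn mu)%N.
    rewrite -[N]rhoN (sumn_nth sR) big_ord_recl /= (sumn_nth sd) -[(_ + sumn mu)%N]addnA -sum_b.
    rewrite -!addnA; congr (_ + _)%N; rewrite addnA -big_split /=; congr (_ + _)%N.
    by apply: eq_bigr => i _; rewrite Er.
  have r0 : (lo 0 <= nth 0 rho 0)%N by have /andP[] := strips_up 0 h1 h2.
  have leN : (sumn la + sumn mu <= N + sumn (dn rho))%N by lia.
  split.
  - by rewrite mem_partns_upto dP (leq_trans (hstrip_sumn s1)) // -rhoN hstrip_sumn.
  - by rewrite leN s1 s2.
  - have [nu uP _ uN] := nth_up dP leN s1 s2.
    have E i : nth 0 (up (dn rho)) i.+1 = nth 0%N rho i.+1 by rewrite nu -Er addnK.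
    (* Row 0 agrees because both partitions have size [N] and agree in all other rows. *)
    apply: part_ext => // -[|i]; last exact: E.
    have su : (size (up (dn rho)) <= R.+1)%N by apply: size_mkpart.
    move: (etrans uN (esym rhoN)); rewrite (sumn_nth sR) (sumn_nth su) !big_ord_recl /=.
    by rewrite (eq_bigr (fun i : 'I_R => nth 0%N rho i.+1)) => [/addIn|i _] //; apply: E.
  rewrite /strip_wt h1 h2 s1 s2 /eps -!exprD; apply: signr_eq.
  rewrite (eps_expE sR) (eps_expE laR) (eps_expE muR) (eps_expE sd).
  rewrite (hexpE _ sR) (hexpE _ sR) (hexpE _ laR) (hexpE _ muR).
  have hlo i : (lo i.+1 <= nth 0 rho i.+1)%N by have /andP[] := strips_up i.+1 h1 h2.
  (* Row 0 of [rho] contributes to no exponent, hence the shift by one; at [R] both [la] and [mu]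
     have run out, so the boundary terms vanish. *)
  have := @strip_swap_parity (nth 0%N la) (nth 0%N mu) (nth 0%N (dn rho))
    (fun i => nth 0%N rho i.+1) R dle hlo Er; cbv zeta.
  rewrite -/(lo R) lo0 // mul0n addn0 ![nth _ _ R]nth_default // !mul0n !addn0.
  rewrite -!(psum_size laR) -!(psum_size muR) -!(psum_size sd).
  move=> E; apply: etrans (etrans _ E) _; apply: congr1.
    by rewrite 3!big_ord_recl /= !psum0 !muln0 mul0n !add0n -!big_split.
  by rewrite !big_split /= !addnA.
move=> ka; rewrite mem_partns_upto => /andP[kaP _] /andP[leN /andP[h1 h2]].
have [nu uP u0 uN] := nth_up kaP leN h1 h2.
have s1 : hstrip la (up ka).
  apply/hstripP => -[|i]; rewrite !nu; have /andP[] := strips_dn 0 h1 h2.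
    by move: u0; rewrite /lo /hi; lia.
  have /andP[] := strips_dn i h1 h2; have /andP[] := strips_dn i.+1 h1 h2.
  by rewrite /lo /hi; lia.
have s2 : hstrip mu (up ka).
  apply/hstripP => -[|i]; rewrite !nu; have /andP[] := strips_dn 0 h1 h2.
    by move: u0; rewrite /lo /hi; lia.
  have /andP[] := strips_dn i h1 h2; have /andP[] := strips_dn i.+1 h1 h2.
  by rewrite /lo /hi; lia.
rewrite mem_partns uP uN s1 s2 eqxx; split=> //.
have [nd dP] := nth_dn s1 s2.
by apply: part_ext => // i; rewrite nd nu; have /andP[] := strips_dn i h1 h2; lia.
Qed.

End StripSwap.

(** * Signed Cauchy identity *)

Fixpoint bounded_rows (b : nat) (q : seq nat) : seq (seq nat) :=
  if q is a :: q' then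
    [seq k :: c | k <- iota 0 (minn a b).+1, c <- bounded_rows (b - k) q']
  else if b == 0%N then [:: [::]] else [::].

Lemma bounded_rows_cons b a q :
  bounded_rows b (a :: q) = [seq k :: c | k <- iota 0 (minn a b).+1, c <- bounded_rows (b - k) q].
Proof. by []. Qed.

(** This is the sum of r_i c_j over positions i < j. When [r] holds the column sums of the rows
    following [c], it counts the inversions between [c] and these rows. *)
Fixpoint cross (c r : seq nat) : nat :=
  match c, r with
  | k :: c', a :: r' => (a * sumn c' + cross c' r')%N
  | _, _ => 0%N
  end.

Definition dif (q c : seq nat) : seq nat := [seq (x.1 - x.2)%N | x <- zip q c].

Fixpoint matrix_sum (p q : seq nat) : int :=
  if p is b :: p' then
    \sum_(c <- bounded_rows b q) (-1) ^+ cross c (dif q c) * matrix_sum p' (dif q c)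
  else (sumn q == 0%N)%:R.

Lemma mem_bounded_rows b q c : (c \in bounded_rows b q) = 
  [&& size c == size q, sumn c == b & all2 leq c q].
Proof.
elim: q b c => [|a q IH] b c.
  by case: b c => [|b] [].
rewrite bounded_rows_cons; case: c => [|k c].
  by rewrite [RHS]/=; apply/negbTE/negP => /allpairsPdep[? [? []]].
apply/allpairsPdep/idP => [[k' [c' [h1 h2 [-> ->]]]]|].
  rewrite mem_iota ltnS leq_min in h1; case/and3P: h1 => _ ka kb.
  move: h2; rewrite IH => /and3P[/eqP sc /eqP Ec cq].
  by rewrite /= sc Ec subnKC // ka !eqxx.
case/and3P=> /eqP[Es] /eqP <- /andP[ka cq]; exists k, c.
rewrite -[sumn _]/(k + sumn c)%N.
by rewrite mem_iota add0n ltnS leq_min ka leq_addr IH Es addKn !eqxx.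
Qed.

Lemma size_dif q c : size c = size q -> size (dif q c) = size q.
Proof. by move=> E; rewrite size_map size1_zip ?E. Qed.

Lemma sumn_dif q c : size c = size q -> all2 leq c q -> (sumn (dif q c) + sumn c = sumn q)%N.
Proof.
elim: q c => [|a q IH] [|k c] //= [Es] /andP[ka cq].
by rewrite -(IH c) // -/(dif q c) addnACA subnK.
Qed.

Lemma bounded_rowsP b q c : c \in bounded_rows b q ->
  [/\ size c = size q, sumn c = b & (sumn (dif q c) + b = sumn q)%N].
Proof. by rewrite mem_bounded_rows => /and3P[/eqP Es /eqP <- cq]; split=> //; apply: sumn_dif. Qed.

Lemma bounded_rows_uniq b q : uniq (bounded_rows b q).
Proof.
elim: q b => [|a q IH] b; first by case: b.
rewrite bounded_rows_cons; apply: allpairs_uniq_dep; rewrite ?iota_uniq //.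
by move=> [k c] [k' c'] _ _ [-> ->].
Qed.

Lemma strip_wt_nil : strip_wt [::] [::] = 1.
Proof. by rewrite /strip_wt /hexp big_ord0. Qed.

Lemma eps_nil : eps [::] = 1.
Proof. by rewrite /eps big_ord0. Qed.

Lemma strip_chains_zero q : sumn q = 0%N -> strip_chains q [::] = 1.
Proof.
elim: q => //= a q IH /eqP; rewrite addn_eq0 => /andP[_ /eqP q0].
by rewrite q0 partns0 big_seq1 IH // strip_wt_nil.
Qed.

(** The strip from [mu] to [la] is moved down past every strip of the chain, and [c] records how
    many boxes each of them loses. [strip_swap] treats the top strip and the induction hypothesis
    the others; the sign of the exchange is the leading term of [cross]. *)
Lemma strip_removal q mu : is_part mu -> (sumn mu <= sumn q)%N ->
  \sum_(la <- partns (sumn q)) eps la * strip_wt mu la * strip_chains q la =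
  eps mu * \sum_(c <- bounded_rows (sumn q - sumn mu) q) (-1) ^+ cross c (dif q c) *
    strip_chains (dif q c) mu.
Proof.
elim: q mu => [|a q IH] mu muP le_mu.
  have mu0 : mu = [::] by have := part_size_le muP; case: mu le_mu {muP} => //= ? ? ; lia.
  by rewrite mu0 /= partns0 !big_seq1 strip_wt_nil eps_nil.
rewrite [sumn (a :: q)]/=; set l := sumn q; set m := sumn mu; set b := (a + l - m)%N.
rewrite /= in le_mu.
pose H ka := eps ka * \sum_(la <- partns l) eps la * strip_wt ka la * strip_chains q la.
pose G d := (-1) ^+ ((l - d) * (m - d)) * \sum_(ka <- partns d) strip_wt ka mu * H ka.
transitivity (eps mu * \sum_(d <- iota 0 (a + l).+1 | [&& m <= a + d, d <= m & d <= l]%N) G d).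
  transitivity (\sum_(la <- partns l) strip_chains q la *
    \sum_(rho <- partns (a + l)) eps rho * strip_wt la rho * strip_wt mu rho).
    rewrite [in LHS](eq_bigr (fun rho => \sum_(la <- partns l) strip_chains q la * (eps rho *
      strip_wt la rho * strip_wt mu rho))).
      by rewrite exchange_big /=; apply: eq_bigr => la _; rewrite mulr_sumr.
    move=> rho _; rewrite mulr_sumr; apply: eq_bigr => la _; ring.
  transitivity (\sum_(d < (a + l).+1) \sum_(ka <- partns d | (m <= a + d)%N)
     eps mu * (-1) ^+ ((l - d) * (m - d)) * strip_wt ka mu * H ka).
    transitivity (\sum_(la <- partns l) \sum_(ka <- partns_upto (a + l) | (l + m <= a + l +
      sumn ka)%N)
        eps mu * (-1) ^+ ((l - sumn ka) * (m - sumn ka)) * strip_wt ka mu * (eps ka * (eps la *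
          strip_wt ka la * strip_chains q la))).
      apply: eq_big_seq => la /partnsP[laP laN]; rewrite strip_swap // -/m laN mulr_sumr.
      by apply: eq_bigr => ka _; ring.
    rewrite exchange_big /= sum_partns_upto; apply: eq_bigr => d _.
    rewrite big_mkcond [RHS]big_mkcond /=; apply: eq_big_seq => ka /partnsP[kaP ->].
    rewrite (_ : (l + m <= _)%N = (m <= a + d)%N); last by lia.
    by case: ifP => // _; rewrite /H !mulr_sumr.
  rewrite -(big_mkord xpredT (fun d => \sum_(ka <- partns d | (m <= a + d)%N)
     eps mu * (-1) ^+ ((l - d) * (m - d)) * strip_wt ka mu * H ka)) /index_iota subn0.
  rewrite mulr_sumr [RHS]big_mkcond /=; apply: eq_bigr => d _.
  case: (leqP m (a + d)) => _ /=; last by rewrite big_pred0_eq.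
  case: (leqP d m) => [_|ltm] /=; last first.
    by rewrite big_seq big1 // => ka /partnsP[_ sk]; rewrite strip_wt_sumn ?sk // mulr0 mul0r.
  case: (leqP d l) => [_|ltl].
    by rewrite /G !mulr_sumr; apply: eq_bigr => ka _; rewrite !mulrA.
  rewrite big_seq big1 // => ka /partnsP[_ sk]; rewrite /H big_seq big1 ?mulr0 //.
  by move=> la /partnsP[_ sl]; rewrite strip_wt_sumn ?sk ?sl // mulr0 mul0r.
congr (_ * _); rewrite bounded_rows_cons big_allpairs_dep.
(* [k] is the loss of the top strip: it keeps [m - d = a - k] boxes, and the remaining [b - k] are
   lost further down, so [d = l - (b - k)]. *)
transitivity (\sum_(k <- iota 0 (minn a b).+1 | (b - k <= l)%N) G (l - (b - k))%N).
  apply: (big_seq_bij (f := fun d => (a + d - m)%N) (g := fun k => (l - (b - k))%N));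
    rewrite ?iota_uniq //.
    move=> d; rewrite mem_iota => _ /and3P[h1 h2 h3]; rewrite mem_iota /b.
    by split; [| | |congr G]; lia.
  by move=> k; rewrite !mem_iota /b => h1 h2; split; lia.
rewrite [LHS]big_mkcond; apply: eq_big_seq => k.
rewrite mem_iota add0n ltnS leq_min => /andP[ka kb].
case: leqP => [le_l|lt_l]; last first.
  by rewrite big_seq big1 // => c /bounded_rowsP[_ _]; rewrite -/l; lia.
rewrite /G; have -> : (l - (l - (b - k)) = b - k)%N by lia.
have -> : (m - (l - (b - k)) = a - k)%N by rewrite /b; lia.
transitivity (\sum_(c <- bounded_rows (b - k) q) \sum_(ka <- partns (l - (b - k)))
   (-1) ^+ ((b - k) * (a - k)) * (strip_wt ka mu * ((-1) ^+ cross c (dif q c) *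
     strip_chains (dif q c) ka))).
  rewrite exchange_big /= mulr_sumr; apply: eq_big_seq => ka' /partnsP[kaP kaN].
  rewrite -!mulr_sumr; congr (_ * (_ * _)).
  have epsK : eps ka' * eps ka' = 1 by rewrite -expr2 sqrr_sign.
  rewrite /H IH // -/l ?kaN ?leq_subr //.
  by rewrite mulrA epsK mul1r; have -> : (l - (l - (b - k)) = b - k)%N by lia.
apply: eq_big_seq => c /bounded_rowsP[sc Ec Ed].
have -> : (l - (b - k))%N = sumn (dif q c) by lia.
rewrite /= Ec -/(dif q c) mulr_sumr; apply: eq_bigr => ka' _.
rewrite exprD mulnC; ring.
Qed.

Lemma cauchy p q : sumn p = sumn q ->
  \sum_(la <- partns (sumn q)) eps la * strip_chains p la * strip_chains q la = matrix_sum p q.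
Proof.
elim: p q => [|b p IH] q /= Epq.
  by rewrite -Epq partns0 big_seq1 eps_nil strip_chains_zero.
transitivity (\sum_(mu <- partns (sumn p)) strip_chains p mu *
  \sum_(la <- partns (sumn q)) eps la * strip_wt mu la * strip_chains q la).
  rewrite [in LHS](eq_bigr (fun la => \sum_(mu <- partns (sumn p)) strip_chains p mu *
    (eps la * strip_wt mu la * strip_chains q la))).
    by rewrite exchange_big /=; apply: eq_bigr => mu _; rewrite mulr_sumr.
  by move=> la _; rewrite mulr_sumr mulr_suml; apply: eq_bigr => mu _; ring.
transitivity (\sum_(mu <- partns (sumn p)) \sum_(c <- bounded_rows b q)
    (-1) ^+ cross c (dif q c) * (eps mu * strip_chains p mu * strip_chains (dif q c) mu)).
  apply: eq_big_seq => mu /partnsP[muP muN]; rewrite strip_removal ?muN -?Epq ?leq_addl //.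
  by rewrite addnK !mulr_sumr; apply: eq_bigr => c _; ring.
rewrite exchange_big /=; apply: eq_big_seq => c /bounded_rowsP[_ _ Ed].
have E : sumn p = sumn (dif q c) by lia.
by rewrite -mulr_sumr -IH // E.
Qed.

(** * Conjugation and vertical strips *)

Lemma is_part_cons a la : is_part (a :: la) ->
  [/\ is_part la, (0 < a)%N & forall b, b \in la -> (b <= a)%N].
Proof.
rewrite /is_part /= inE negb_or => /andP[srt /andP[a0 la0]]; split.
- by rewrite (path_sorted srt).
- by rewrite lt0n eq_sym.
- move=> b bla; have /allP/(_ b bla) := order_path_min (rev_trans leq_trans) srt.
  by [].
Qed.

(** Both sides say that the box in row [i] and column [j] lies in the diagram. *)
Lemma lt_count_part la i j : is_part la -> 
  (i < count (fun a => j < a) la)%N = (j < nth 0 la i)%N.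
Proof.
elim: la i => [|a la IH] i laP; first by rewrite nth_nil.
have [laP' a0 leq_a] := is_part_cons laP; rewrite [count _ _]/=.
case: (ltnP j a) => [lt_ja|le_aj]; last first.
  have -> : count (fun a => j < a)%N la = 0%N.
    apply/eqP; rewrite -leqn0 leqNgt -has_count -all_predC.
    by apply/allP => b /leq_a h /=; rewrite -leqNgt (leq_trans h).
  rewrite ltn0; case: i => [|i] /=; rewrite ltnNge ?le_aj //=.
  case: (ltnP i (size la)) => [lt|/(nth_default 0%N)->//].
  by rewrite (leq_trans _ le_aj) // leq_a // mem_nth.
by case: i => //= i; rewrite add1n ltnS IH.
Qed.

Lemma eq_lt m n : (forall i, (i < m)%N = (i < n)%N) -> m = n.
Proof. by move=> h; have := h m; have := h n; rewrite !ltnn; lia. Qed.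

Section Conj.
Variable la : seq nat.
Hypothesis laP : is_part la.

Lemma nth_conj j : nth 0%N (conj_part la) j = count (fun a => (j < a)%N) la.
Proof.
rewrite /conj_part; case: (ltnP j (head 0%N la)) => [lt_j|le_j].
  by rewrite (nth_map 0%N) ?size_iota // nth_iota.
rewrite nth_default ?size_map ?size_iota //; apply: eq_lt => i.
rewrite lt_count_part // ltn0; apply/esym/negbTE; rewrite -leqNgt (leq_trans _ le_j) //.
by rewrite -nth0 part_noninc.
Qed.

Lemma lt_conj i j : (i < nth 0 (conj_part la) j)%N = (j < nth 0 la i)%N.
Proof. by rewrite nth_conj lt_count_part. Qed.

Lemma conj_is_part : is_part (conj_part la).
Proof.
apply/andP; split.
  apply/(sortedP 0%N) => j _; rewrite /= !nth_conj; apply: sub_count => a /=.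
  exact: ltnW.
apply/negP => /mapP[j]; rewrite mem_iota -nth0 => /andP[_ lt_j].
by have := lt_count_part 0 j laP; rewrite lt_j => h1 h2; rewrite -h2 in h1.
Qed.

Lemma sumn_conj : sumn (conj_part la) = sumn la.
Proof.
rewrite /conj_part sumnE big_map -{1}[head 0%N la]subn0 -/(index_iota 0 _).
under eq_bigr do rewrite -sum1_count big_mkcond.
rewrite exchange_big /= [RHS]sumnE; apply: eq_big_seq => a ala.
rewrite -big_mkcond sum1_count.
have le_a : (a <= head 0 la)%N.
  by rewrite -(nth_index 0%N ala) -nth0 part_noninc.
rewrite -size_filter (_ : filter _ _ = index_iota 0 a) ?size_iota ?subn0 //.
apply: (irr_sorted_eq ltn_trans ltnn); rewrite ?iota_ltn_sorted //.
  by rewrite sorted_filter ?iota_ltn_sorted //; apply: ltn_trans.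
by move=> j; rewrite mem_filter !mem_index_iota /=; case: ltnP => //= h; rewrite (leq_trans h).
Qed.

End Conj.

Lemma conj_partK la : is_part la -> conj_part (conj_part la) = la.
Proof.
move=> laP; apply: part_ext => // [|i]; first exact/conj_is_part/conj_is_part.
by apply: eq_lt => j; rewrite !lt_conj //; apply: conj_is_part.
Qed.

Lemma conj_partns n la : la \in partns n -> conj_part la \in partns n.
Proof. by case/partnsP => laP <-; rewrite mem_partns conj_is_part // sumn_conj ?eqxx. Qed.

Lemma sum_conj (R : nmodType) n (F : seq nat -> R) :
  \sum_(la <- partns n) F (conj_part la) = \sum_(la <- partns n) F la.
Proof.
apply: (big_seq_bij (f := conj_part) (g := conj_part)); rewrite ?partns_uniq // => la h _.
  by rewrite conj_partns // conj_partK //; case: (partnsP h).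
by rewrite conj_partns // conj_partK //; case: (partnsP h).
Qed.

Lemma count_part R la j : (size la <= R)%N ->
  count (fun a => j < a)%N la = (\sum_(i < R) (j < nth 0 la i))%N.
Proof.
elim: R la => [|R IH] [|a la] //= lt_R; rewrite ?big_ord0 //.
  by rewrite big1 // => i _; rewrite nth_nil ltn0.
by rewrite big_ord_recl /= -IH.
Qed.

Lemma psum_conj R la j : is_part la -> (size la <= R)%N ->
  psum (conj_part la) j = (\sum_(r < R) minn (nth 0 la r) j)%N.
Proof.
move=> laP leR; elim: j => [|j IH].
  by rewrite psum0 big1 // => i _; rewrite minn0.
rewrite psumS IH nth_conj // (count_part _ leR) -big_split /=; apply: eq_bigr => i _.
by case: (ltnP j (nth 0%N la i)); lia.
Qed.

Section VStrip.
Variables la tau : seq nat.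
Hypotheses (laP : is_part la) (tauP : is_part tau).

Lemma vstripP : reflect (forall i, (nth 0 la i <= nth 0 tau i <= (nth 0 la i).+1)%N)
  (hstrip (conj_part la) (conj_part tau)).
Proof.
apply: (iffP (hstripP _ _)) => H.
  move=> i; apply/andP; split; rewrite leqNgt; apply/negP => h.
    have /andP[_ le1] := H (nth 0%N tau i).
    have := leq_trans (_ : i < nth 0 (conj_part la) (nth 0%N tau i))%N le1.
    by rewrite !lt_conj // h ltnn => /(_ isT).
  have /andP[le1 _] := H (nth 0%N la i).
  have := leq_trans (_ : i < nth 0 (conj_part tau) (nth 0 la i).+1)%N le1.
  by rewrite !lt_conj // h ltnn => /(_ isT).
move=> j; apply/andP; split; rewrite leqNgt; apply/negP => h; have := h; rewrite lt_conj // => h1.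
  have /andP[_ h2] := H (nth 0%N (conj_part la) j).
  by have := leq_trans h1 h2; rewrite ltnS -lt_conj // ltnn.
have /andP[h2 _] := H (nth 0%N (conj_part tau) j).
by have := leq_trans h1 h2; rewrite -lt_conj // ltnn.
Qed.

(** A row [i] that grows does so by one box, in column [la_i]; the columns to the left of it contain
    min(la_r, la_i) boxes of each row [r] of [la]. *)
Lemma hexp_conj R : (size la <= R)%N -> (size tau <= R)%N ->
    (forall i, nth 0 la i <= nth 0 tau i <= (nth 0 la i).+1)%N ->
  hexp (conj_part la) (conj_part tau) =
  (\sum_(i < R) (nth 0 tau i - nth 0 la i) * \sum_(r < R) minn (nth 0 la r) (nth 0 la i))%N.
Proof.
move=> laR tauR H; rewrite /hexp; set J := size _.
transitivity (\sum_(j < J) \sum_(i < R) ((nth 0 la i <= j < nth 0 tau i) *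
  psum (conj_part la) j))%N.
  apply: eq_bigr => j _; rewrite -big_distrl /=; congr (_ * _)%N.
  rewrite !nth_conj // (count_part _ laR) (count_part _ tauR).
  rewrite (_ : (\sum_(i < R) (j < nth 0 tau i) =
    \sum_(i < R) ((nth 0 la i <= j < nth 0 tau i) + (j < nth 0 la i)))%N).
    by rewrite big_split /= addnK.
  apply: eq_bigr => i _; have /andP[h _] := H i.
  case: (ltnP j (nth 0%N la i)) => h'; last by rewrite addn0.
  by rewrite (leq_trans h' h).
rewrite exchange_big /=; apply: eq_bigr => i _; rewrite -(psum_conj _ laP laR).
have /andP[h1 h2] := H i; have [E|ne] := eqVneq (nth 0%N la i) (nth 0%N tau i).
  by rewrite E subnn mul0n big1 // => j _; rewrite [X in (nat_of_bool X)](_ : _ = false) //;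
    apply/negbTE; lia.
have ltJ : (nth 0 la i < J)%N.
  rewrite -part_nth_gt0 ?conj_is_part //; apply: leq_ltn_trans (leq0n i) _.
  by rewrite lt_conj //; lia.
rewrite (bigD1 (Ordinal ltJ)) //= big1 ?addn0 => [|j /eqP ne_j].
  by congr (_ * _)%N; lia.
have {}ne_j : nat_of_ord j <> nth 0%N la i by move=> h; apply: ne_j; apply: val_inj.
by rewrite [X in (nat_of_bool X)](_ : _ = false) //; apply/negbTE; lia.
Qed.

End VStrip.

(** * Cancellation between vertical and horizontal strips *)

Lemma binD2 a b : ('C(a + b, 2) = 'C(a, 2) + 'C(b, 2) + a * b)%N.
Proof.
elim: b => [|b IH]; first by rewrite addn0 muln0 bin0n !addn0.
rewrite addnS !binS !bin1 IH mulnS; lia.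
Qed.

(** Modulo 2 the exponent is affine in the indicator [s] of the vertical strip. Toggling [s i]
    changes it by 1 plus the sum of [l + r] over the later rows, which is odd as soon as [l] and [r]
    agree there. *)
Lemma vstrip_parity (l s r : nat -> nat) T :
    (forall i, l i.+1 <= l i)%N -> (forall i, s i <= 1)%N ->
    (forall i, l i + s i <= r i)%N ->
  let S (f : nat -> nat) (t : nat) := (\sum_(i < t) f i)%N in
  odd ('C((S l T + S s T).+1, 2) + \sum_(i < T) i * 'C(l i + s i, 2)
    + \sum_(i < T) s i * \sum_(j < T) minn (l j) (l i)
    + \sum_(i < T) (r i - (l i + s i)) * (S l i + S s i)) =
  odd ('C((S l T).+1, 2) + \sum_(i < T) i * 'C(l i, 2) + \sum_(i < T) (r i - l i) * S l i
    + S s T + \sum_(i < T) (l i + r i) * S s i).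
Proof.
move=> l_noninc s1 lsr S.
have SS f i : S f i.+1 = (S f i + f i)%N by rewrite /S big_ord_recr.
have lle i j : (i <= j)%N -> (l j <= l i)%N.
  by move/subnK <-; elim: (j - i)%N => //= k; apply: leq_trans (l_noninc _).
elim: T => [|T IH]; first by rewrite !big_ord0 /S !big_ord0.
(* As [l] decreases, the minimum of any earlier row with the new row [T] is [l T]. *)
have -> : (\sum_(i < T.+1) s i * \sum_(j < T.+1) minn (l j) (l i) =
   \sum_(i < T) s i * \sum_(j < T) minn (l j) (l i) + l T * S s T + s T * l T * T.+1)%N.
  rewrite big_ord_recr /=; congr (_ + _)%N.
    rewrite /S [X in (_ = _ + X)%N]mulnC big_distrl -big_split /=; apply: eq_bigr => i _.
    rewrite big_ord_recr /= mulnDr; congr (_ + _ * _)%N.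
    by apply/minn_idPl/lle; rewrite ltnW.
  rewrite -mulnA; congr (_ * _)%N;
    rewrite (eq_bigr (fun=> l T)) ?sum_nat_const ?card_ord 1?mulnC //.
  by move=> i _; apply/minn_idPr/lle; rewrite -ltnS.
have Cs : 'C(s T, 2) = 0%N by case: (s T) (s1 T) => [|[|]].
have C1 : ('C((S l T.+1 + S s T.+1).+1, 2) = 'C((S l T + S s T).+1, 2)
    + ('C(l T, 2) + l T * s T) + (S l T + S s T).+1 * (l T + s T))%N.
  have -> : ((S l T.+1 + S s T.+1).+1 = (S l T + S s T).+1 + (l T + s T))%N by rewrite !SS; lia.
  by rewrite binD2 (binD2 (l T)) Cs addn0.
have C2 : ('C((S l T.+1).+1, 2) = 'C((S l T).+1, 2) + 'C(l T, 2) + (S l T).+1 * l T)%N.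
  by rewrite SS -addSn binD2.
have C3 : ('C(l T + s T, 2) = 'C(l T, 2) + l T * s T)%N.
  by rewrite binD2 Cs addn0.
have lT : (l T <= r T)%N by apply: leq_trans (lsr T); rewrite leq_addr.
clearbody S; rewrite C1 C2 {C1 C2} !big_ord_recr C3 {C3} !SS.
move: IH; move: 'C((S l T + S s T).+1, 2) 'C((S l T).+1, 2) 'C(l T, 2) => c1 c2 c3 /=.
rewrite !oddD !(oddM, oddD) !oddB ?lsr // !(oddM, oddD) => IH.
rewrite (canRL (addKb _) IH) !oddS !addb_xorb; btauto.
Qed.

(* The exponent relating [e_mu] to chains of vertical strips; by [eta_parity] it
   has the parity of l(w_la) + |la| plus the exponents of the signs of [T_la] and
   of [T] for the conjugate of [la]. *)
Definition etaexp (la : seq nat) : nat :=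
  ('C((sumn la).+1, 2) + \sum_(i < size la) i * 'C(nth 0 la i, 2))%N.

Lemma etaexpE R la : (size la <= R)%N ->
  etaexp la = ('C((sumn la).+1, 2) + \sum_(i < R) i * 'C(nth 0 la i, 2))%N.
Proof.
move=> leR; congr (_ + _)%N.
rewrite (big_ord_widen R (fun i => i * 'C(nth 0 la i, 2))%N leR).
rewrite big_mkcond /=; apply: eq_bigr => i _; case: ltnP => // h.
by rewrite (nth_default _ h) muln0.
Qed.

Lemma signr_opp (R : pzRingType) m n : odd m = ~~ odd n -> (-1) ^+ m = - (-1) ^+ n :> R.
Proof. by move=> E; rewrite -[LHS]signr_odd E -[in RHS]signr_odd signrN. Qed.

Lemma big_odd0 (I : finType) (P : pred I) (F : I -> nat) :
  (forall i, P i -> odd (F i) = false) -> odd (\sum_(i | P i) F i) = false.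
Proof.
by move=> h; apply: (big_ind (fun x => odd x = false)) => // x y; rewrite oddD => -> ->.
Qed.

Section Cancel.
Variables la rho : seq nat.
Hypotheses (laP : is_part la) (rhoP : is_part rho) (neq : la != rho).

Let R := maxn (size la) (size rho).

Let vh tau := hstrip (conj_part la) (conj_part tau) && hstrip tau rho.

Let vhP tau : is_part tau -> reflect (forall i,
   [/\ nth 0 la i <= nth 0 tau i, nth 0 tau i <= (nth 0 la i).+1,
       nth 0 rho i.+1 <= nth 0 tau i & nth 0 tau i <= nth 0 rho i]%N) (vh tau).
Proof.
move=> tauP; apply: (iffP andP) => [[/(vstripP laP tauP) h1 /hstripP h2] i|h].
  by have /andP[] := h1 i; have /andP[] := h2 i.
split; first by apply/vstripP => // i; have [-> -> _ _] := h i.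
by apply/hstripP => i; have [_ _ -> ->] := h i.
Qed.

Let base := ('C((sumn la).+1, 2) + \sum_(i < R) i * 'C(nth 0 la i, 2)
  + \sum_(i < R) (nth 0 rho i - nth 0 la i) * psum la i)%N.

Let exp_vh tau : is_part tau -> vh tau -> 
  odd (etaexp tau + hexp (conj_part la) (conj_part tau) + hexp tau rho) =
  odd base (+) odd (\sum_(i < R) (nth 0 tau i - nth 0 la i)
    + \sum_(i < R) (nth 0 la i + nth 0 rho i) * \sum_(j < i) (nth 0 tau j - nth 0 la j)).
Proof.
move=> tauP vht; have H := vhP tauP vht; have /andP[_ hs] := vht.
have rhoR : (size rho <= R)%N by rewrite leq_maxr.
have laR : (size la <= R)%N by rewrite leq_maxl.
have tauR : (size tau <= R)%N.
  apply: leq_trans rhoR; rewrite leqNgt -part_nth_gt0 // -leqNgt.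
  by have [_ _ _] := H (size rho); rewrite [nth 0%N rho _]nth_default.
have Es i : (nth 0 la i + (nth 0 tau i - nth 0 la i) = nth 0 tau i)%N.
  by have [h _ _ _] := H i; rewrite subnKC.
have s1 i : (nth 0 tau i - nth 0 la i <= 1)%N.
  by have [_ h _ _] := H i; rewrite leq_subLR addn1.
have tr i : (nth 0 la i + (nth 0 tau i - nth 0 la i) <= nth 0 rho i)%N.
  by rewrite Es; have [] := H i.
have E := vstrip_parity R (fun i => part_noninc laP (leqnSn i)) s1 tr; cbv zeta in E.
have Esum t : (\sum_(i < t) nth 0 la i + \sum_(i < t) (nth 0 tau i - nth 0 la i) = psum tau t)%N.
  by rewrite -big_split /=; apply: eq_bigr => i _; rewrite Es.
rewrite (etaexpE tauR) (hexpE _ rhoR) (hexp_conj laP tauP laR tauR); last first.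
  by move=> i; have [-> ->] := H i.
rewrite -oddD addnA /base -(psum_size tauR) -(psum_size laR); apply: etrans (etrans _ E) _;
  apply: congr1 => //.
rewrite Esum; congr (_ + _ + _ + _)%N; first by apply: eq_bigr => i _; rewrite Es.
by apply: eq_bigr => i _; rewrite Es Esum.
Qed.

Let last_diff : exists i, [/\ nth 0 la i != nth 0 rho i, (i < R)%N &
  forall j, (i < j)%N -> nth 0 la j = nth 0 rho j]%N.
Proof.
pose P i := nth 0%N la i != nth 0%N rho i.
have PR i : P i -> (i <= R)%N.
  rewrite leqNgt; apply: contra => h; rewrite !nth_default //.
    by rewrite ltnW // (leq_ltn_trans _ h) // leq_maxr.
  by rewrite ltnW // (leq_ltn_trans _ h) // leq_maxl.
have exP : exists i, P i.
  have [/hasP[i _ Pi]|/hasPn h] := boolP (has P (iota 0 R.+1)); first by exists i.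
  case/eqP: neq; apply: part_ext => // i; apply/eqP/negPn/negP => Pi.
  by have := h i; rewrite mem_iota ltnS PR //= => /(_ isT)/negP[].
case: (ex_maxnP exP PR) => i Pi maxi; exists i; split=> //.
  rewrite ltnNge; apply: contra Pi => h; rewrite !nth_default //.
    by rewrite (leq_trans _ h) // leq_maxr.
  by rewrite (leq_trans _ h) // leq_maxl.
by move=> j; rewrite ltnNge => h; apply/eqP/negPn/(contra (maxi j)).
Qed.

Lemma strip_cancel N : (sumn rho <= N)%N ->
  \sum_(tau <- partns_upto N) (-1) ^+ etaexp tau * strip_wt (conj_part la) (conj_part tau) *
    strip_wt tau rho = 0
    :> int.
Proof.
move=> leN.
transitivity (\sum_(tau <- partns_upto N | vh tau)
    (-1) ^+ (etaexp tau + hexp (conj_part la) (conj_part tau) + hexp tau rho) : int).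
  rewrite [RHS]big_mkcond; apply: eq_bigr => tau _; rewrite /strip_wt /vh.
  by case: ifP => _; case: ifP => _; rewrite ?mulr0 ?mul0r // !exprD.
have [i0 [ne ltR eq_gt]] := last_diff.
(* In row [i0] a vertical strip allows only the length in [la] and its successor; the reflection
   exchanges these two. *)
pose p (tau : seq nat) i := if i == i0 then (nth 0 la i0 + (nth 0 la i0).+1 - nth 0 tau i0)%N
  else nth 0%N tau i.
pose g tau := mkpart R (p tau).
have gP tau : is_part tau -> vh tau ->
    [/\ is_part (g tau), nth 0%N (g tau) =1 p tau & vh (g tau)].
  move=> tauP vht; have H := vhP tauP vht.
  (* There is room for the box because [la] and [rho] differ in row [i0], and it can be removed
     because row [i0.+1] of [rho] is also a row of [la]. *)
  have lt0 : (nth 0 la i0 < nth 0 rho i0)%N.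
    by rewrite ltn_neqAle ne; have [h1 _ _ h2] := H i0; apply: leq_trans h1 h2.
  have [a1 a2 a3 a4] := H i0.
  have b1 : (nth 0 rho i0.+1 <= nth 0 la i0)%N by rewrite -eq_gt ?part_noninc.
  have noninc i : (p tau i.+1 <= p tau i)%N.
    rewrite /p; have [Ei|ni] := eqVneq i.+1 i0.
      rewrite ltn_eqF; last by rewrite -Ei.
      by have [_ _ h _] := H i; rewrite Ei in h; lia.
    have [->|ni'] := eqVneq i i0; last exact: part_noninc.
    by have [_ _ _ h] := H i0.+1; lia.
  have pR : p tau R = 0%N.
    rewrite /p gtn_eqF //; have [_ _ _] := H R; rewrite [nth _ rho R]nth_default ?leq_maxr //.
    by rewrite leqn0 => /eqP.
  have gE : nth 0%N (g tau) =1 p tau by move=> i; apply: nth_mkpart.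
  have gpart : is_part (g tau) by apply: mkpart_part.
  split=> //; apply/vhP => // i; rewrite gE /p; have [->|ni] := eqVneq i i0; last exact: H.
  by split; lia.
have gg tau : is_part tau -> vh tau -> g (g tau) = tau.
  move=> tauP vht; have [P1 E1 V1] := gP _ tauP vht; have [P2 E2 _] := gP _ P1 V1.
  apply: part_ext => // i; rewrite E2 /p !E1 /p eqxx; have [->|//] := eqVneq i i0.
  by have [? ? _ _] := vhP tauP vht i0; lia.
apply: (big_seq_cancel (g := g)) => [|tau]; first exact: partns_upto_uniq.
rewrite mem_partns_upto => /andP[tauP _] vht; have [P1 E1 V1] := gP _ tauP vht.
split=> //; [|exact: gg|].
  by rewrite mem_partns_upto P1 (leq_trans _ leN) //; case/andP: V1 => _ /hstrip_sumn.
apply: signr_opp; rewrite exp_vh // exp_vh //.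
rewrite -addbN; congr (_ (+) _).
have H := vhP tauP vht.
have Es i : i != i0 -> (nth 0 (g tau) i - nth 0 la i = nth 0 tau i - nth 0 la i)%N.
  by rewrite E1 /p => /negbTE->.
have E0 : (nth 0 (g tau) i0 - nth 0 la i0 + (nth 0 tau i0 - nth 0 la i0) = 1)%N.
  by rewrite E1 /p eqxx; have [] := H i0; lia.
have addT a b : a (+) b -> a = ~~ b by case: a; case: b.
(* In the sum of the two exponents row [i0] contributes 1; every other term is doubled or carries an
   even factor la_i + rho_i. *)
apply: addT; rewrite -oddD addnACA oddD -!big_split /=.
rewrite (bigD1 (Ordinal ltR)) //= E0 oddD big_odd0 ?addbF => [|i ni]; last first.
  by rewrite Es // addnn odd_double.
rewrite big_odd0 // => i _; rewrite -mulnDr oddM.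
case: (leqP i i0) => [le_i|lt_i]; last by rewrite eq_gt // addnn odd_double.
rewrite -big_split big_odd0 ?andbF // => j _; rewrite /= Es ?addnn ?odd_double //.
by rewrite neq_ltn (leq_trans (ltn_ord j)).
Qed.

End Cancel.

(** * Unitriangularity *)

Lemma sum_eq_pointwise n (F G : 'I_n -> nat) : (forall i, F i <= G i)%N ->
  (\sum_(i < n) G i <= \sum_(i < n) F i)%N -> F =1 G.
Proof.
move=> leFG leS i; apply/eqP; rewrite eqn_leq leFG leqNgt; apply/negP => lt_i.
move: leS; rewrite leqNgt => /negP; apply.
rewrite (bigD1 i) //= [in X in (_ < X)%N](bigD1 i) //= -addSn leq_add //.
exact: leq_sum.
Qed.

(** A horizontal strip adds at most one row, so the boxes of the first [i] strips all lie in the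
    first [i] rows. *)
Lemma strip_chains_dominance q la : is_part la -> sumn la = sumn q -> strip_chains q la != 0 ->
  (size la <= size q)%N /\
  (forall i, i <= size q -> sumn (drop (size q - i) q) <= psum la i)%N.
Proof.
elim: q la => [|b q IH] la laP Es Vn0.
  split; first by rewrite (leq_trans (part_size_le laP)) // Es.
  by [].
have [/hasP[ka /partnsP[kaP kaN] hn0]|/hasPn h] :=
    boolP (has (fun ka => strip_wt ka la * strip_chains q ka != 0) (partns (sumn q))); last first.
  case/eqP: Vn0; rewrite /= big_seq big1 // => ka /h; by rewrite negbK => /eqP.
have Vk : strip_chains q ka != 0 by apply: contraNneq hn0 => ->; rewrite mulr0.
have /hstripP hs : hstrip ka la.
  by apply: contraNT hn0 => /negbTE h; rewrite /strip_wt h mul0r.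
have [sz IHq] := IH ka kaP kaN Vk.
have szl : (size la <= (size q).+1)%N.
  rewrite leqNgt -part_nth_gt0 // -leqNgt; have /andP[h _] := hs (size q).
  by apply: leq_trans h _; rewrite nth_default.
split=> // i; rewrite leq_eqVlt => /predU1P[->|lt_i].
  by rewrite subnn drop0 psum_size // Es.
rewrite [size _]/= subSn //= (leq_trans (IHq _ _)) //.
by apply: leq_sum => j _; have /andP[] := hs j.
Qed.

(** The number of inversions in the row word of T_la ([sign_superstandard]): each letter is inverted
    with all letters of the rows above it. *)
Definition texp (la : seq nat) := (\sum_(i < size la) nth 0 la i * psum la i)%N.

Lemma psum_rcons la b i : (i <= size la)%N -> psum (rcons la b) i = psum la i.
Proof.
move=> le_i; apply: eq_bigr => j _; rewrite nth_rcons.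
by rewrite (leq_trans (ltn_ord j)).
Qed.

Lemma texp_rcons la b : texp (rcons la b) = (texp la + b * sumn la)%N.
Proof.
rewrite /texp size_rcons big_ord_recr /= nth_rcons ltnn eqxx; congr (_ + _ * _)%N; last first.
  by rewrite psum_rcons // psum_size.
by apply: eq_bigr => i _; rewrite nth_rcons ltn_ord psum_rcons // ltnW.
Qed.

Lemma is_part_rcons la b : is_part (rcons la b) -> is_part la.
Proof.
case/andP=> srt; rewrite mem_rcons inE negb_or => /andP[_ la0]; apply/andP; split=> //.
apply: subseq_sorted srt; last exact: subseq_rcons.
exact: rev_trans leq_trans.
Qed.

Lemma strip_wt_rcons la b : is_part (rcons la b) ->
  strip_wt la (rcons la b) = (-1) ^+ (b * sumn la).
Proof.
move=> laP; have nthl i : (i < size la)%N -> nth 0%N (rcons la b) i = nth 0%N la i.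
  by move=> h; rewrite nth_rcons h.
rewrite /strip_wt (_ : hstrip _ _); last first.
  apply/hstripP => i; case: (ltnP i (size la)) => [lt_i|le_i].
    by rewrite -nthl // part_noninc //= leqnn.
  by rewrite [nth 0%N (rcons la b) i.+1]nth_default ?size_rcons // nth_default.
rewrite /hexp size_rcons big_ord_recr /= big1 => [|i _]; last first.
  by rewrite nthl ?subnn.
by rewrite nth_rcons ltnn eqxx nth_default // subn0 psum_size.
Qed.

Lemma strip_chains_diag mu : is_part mu -> strip_chains (rev mu) mu = (-1) ^+ texp mu.
Proof.
elim/last_ind: mu => [|mu b IH] muP; first by rewrite /texp big_ord0.
have muP' := is_part_rcons muP.
rewrite rev_rcons /= sumn_rev (bigD1_seq mu) ?partns_uniq ?mem_partns ?muP' ?eqxx //=.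
rewrite big_seq_cond big1 ?addr0 => [|ka /andP[/partnsP[kaP kaN] /eqP ne]].
  by rewrite IH // strip_wt_rcons // texp_rcons exprD mulrC.
rewrite /strip_wt; case: ifP => [/hstripP hs|_]; last by rewrite mul0r.
case: (eqVneq (strip_chains (rev mu) ka) 0) => [->|Vn0]; first by rewrite mulr0.
(* Dominance confines [ka] to [size mu] rows; there it is bounded by [mu], and equality of the sizes
   forces [ka = mu]. *)
have [|szk _] := strip_chains_dominance kaP _ Vn0; first by rewrite sumn_rev.
rewrite size_rev in szk; case: ne; apply: part_ext => // i.
case: (ltnP i (size mu)) => [lt_i|le_i]; last first.
  by rewrite !nth_default // (leq_trans szk).
apply: (@sum_eq_pointwise (size mu) (fun j => nth 0%N ka j) (fun j => nth 0%N mu j) _ _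
  (Ordinal lt_i)).
  by move=> j; have /andP[_] := hs j; rewrite nth_rcons ltn_ord.
by rewrite -!sumn_nth // kaN.
Qed.

Lemma sumn_take la i : sumn (take i la) = psum la i.
Proof.
elim: la i => [|a la IH] [|i]; rewrite ?psum0 //=.
  by rewrite /psum big1 // => j _; rewrite nth_nil.
by rewrite IH /psum big_ord_recl.
Qed.

Lemma psum_le la i : (psum la i <= sumn la)%N.
Proof. by rewrite -sumn_take -[X in (_ <= sumn X)%N](cat_take_drop i la) sumn_cat leq_addr. Qed.

Lemma strip_chains_rev_dominance n la mu : la \in partns n -> mu \in partns n ->
  strip_chains (rev mu) la != 0 ->
  forall i, (psum mu i <= psum la i)%N.
Proof.
move=> /partnsP[laP laN] /partnsP[muP muN] Vn0 i.
have [|sz] := strip_chains_dominance laP _ Vn0; first by rewrite sumn_rev laN.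
rewrite size_rev => dom; case: (leqP i (size mu)) => [le_i|lt_i].
  have := dom i le_i; rewrite drop_rev sumn_rev subKn //.
  by rewrite sumn_take.
rewrite size_rev in sz.
by rewrite !psum_size ?muN ?laN // ?(leq_trans sz) // ltnW.
Qed.

(* Induction along the dominance order, measured by the sum of partial sums. *)
Lemma strip_chains_separate (W : zmodType) n (x : seq nat -> W) :
    (forall mu, mu \in partns n -> \sum_(la <- partns n) x la *~ strip_chains (rev mu) la = 0) ->
  forall la, la \in partns n -> x la = 0.
Proof.
move=> h; pose psi la := (\sum_(i < n) psum la i)%N.
have psi_le la : la \in partns n -> (psi la <= n * n)%N.
  case/partnsP=> laP laN; rewrite -[X in (_ <= X * _)%N]card_ord -sum_nat_const.
  by apply: leq_sum => i _; rewrite (leq_trans (psum_le _ _)) ?laN.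
have main k mu : mu \in partns n -> (n * n - psi mu < k)%N -> x mu = 0.
  elim: k mu => // k IH mu mun lt_k; have [muP muN] := partnsP mun.
  have := h mu mun; rewrite (bigD1_seq mu) ?partns_uniq //= big_seq_cond big1 ?addr0.
    (* The diagonal coefficient is a sign, so [x mu] can be isolated in any abelian group. *)
    rewrite strip_chains_diag // -signr_odd; case: (odd _); rewrite ?expr0 ?mulr1z // expr1.
    by rewrite mulrN1z => /eqP; rewrite oppr_eq0 => /eqP.
  move=> la /andP[lan ne]; have [laP laN] := partnsP lan.
  case: (eqVneq (strip_chains (rev mu) la) 0) => [->|Vn0]; first by rewrite mulr0z.
  have dom := strip_chains_rev_dominance lan mun Vn0.
  rewrite IH ?mul0rz //; have := psi_le la lan; have := psi_le mu mun.
  (* Each partial sum of [la] is at least that of [mu]; equal totals would make them all agree and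
     give [la = mu]. *)
  suff : (psi mu < psi la)%N by lia.
  rewrite ltnNge; apply: contra ne => le_psi; apply/eqP.
  have E : (fun i : 'I_n => psum mu i) =1 (fun i : 'I_n => psum la i).
    by apply: sum_eq_pointwise.
  have En i : (i <= n)%N -> psum mu i = psum la i.
    rewrite leq_eqVlt => /predU1P[->|lt_i]; last exact: (E (Ordinal lt_i)).
    by rewrite !psum_size ?laN // -?laN -?muN ?part_size_le // laN -muN part_size_le.
  apply: part_ext => // i; case: (ltnP i n) => [lt_i|le_i].
    by have := En i.+1 lt_i; rewrite !psumS En ?(ltnW lt_i) // => /addnI.
  by rewrite !nth_default // (leq_trans _ le_i) // -?laN ?part_size_le // laN -muN part_size_le.
by move=> la lan; apply: (main (n * n - psi la).+1%N).
Qed.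

(** * Pairs of boxes and the parities of the sign exponents *)

Lemma sum_box la (F : nat -> nat -> nat) :
  (\sum_(b : box la) F (row_of b) (col_of b) =
   \sum_(i < size la) \sum_(j < nth 0 la i) F i j)%N.
Proof. by rewrite sig_big_dep. Qed.

Lemma sum_lt_cond m n (F : nat -> nat) : (n <= m)%N ->
  (\sum_(i < m) (i < n) * F i = \sum_(i < n) F i)%N.
Proof.
move=> le_nm; rewrite (big_ord_widen m F le_nm) [RHS]big_mkcond /=.
by apply: eq_bigr => i _; case: ltnP; rewrite ?mul1n ?mul0n.
Qed.

Lemma sum_succ a : (\sum_(i < a) i.+1 = 'C(a.+1, 2))%N.
Proof. by rewrite -bin2_sum big_mkord big_ord_recl add0n. Qed.

(** [texp la] counts all pairs of boxes in different rows. For a lower box in row [r] and column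
    [c], exactly [c.+1] boxes of each higher row are not strictly to the right of it; over all [c]
    this gives C(la_r + 1, 2) for each higher row. *)
Lemma len_wE la : is_part la ->
  (len_w la + \sum_(i < size la) i * 'C((nth 0 la i).+1, 2) = texp la)%N.
Proof.
move=> laP; rewrite /len_w cardsE -sum1_card big_mkcond /=.
rewrite -(pair_bigA _ (fun b b' : box la => if (row_of b' < row_of b)%N && (col_of b < col_of
  b')%N then 1%N else 0%N)) /=.
rewrite (eq_bigr (fun b : box la => \sum_(i < size la) (i < row_of b) *
  \sum_(j < nth 0 la i) (col_of b < j)))%N; last first.
  move=> b _; rewrite (@sum_box la (fun i j => if (i < row_of b)%N && (col_of b < j)%N then 1%N
    else 0%N)).
  apply: eq_bigr => i _; case: (i < row_of b)%N; last by rewrite big1 ?mul0n.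
  by rewrite mul1n; apply: eq_bigr => j _ /=; case: ifP.
rewrite (@sum_box la (fun r c => \sum_(i < size la) (i < r) * \sum_(j < nth 0 la i) (c < j)))%N.
rewrite -big_split /=; apply: eq_bigr => r _; rewrite -/(psum la r).
under eq_bigr => c _ do
  rewrite (@sum_lt_cond _ _ (fun i => \sum_(j < nth 0 la i) (c < j))%N (ltnW (ltn_ord r))).
rewrite exchange_big /= -[X in (_ + X * _)%N](card_ord r) -sum_nat_const -big_split /=.
rewrite /psum big_distrr /=; apply: eq_bigr => i _; rewrite -sum_succ -big_split /=.
rewrite (eq_bigr (fun=> nth 0 la i))%N ?sum_nat_const ?card_ord // => c _.
have lt_c : (c < nth 0 la i)%N.
  by apply: leq_trans (ltn_ord c) _; apply: part_noninc => //; apply: ltnW.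
rewrite -[RHS](subnK lt_c); congr (_ + _)%N.
rewrite -(big_mkord xpredT (fun j => nat_of_bool (c < j)%N)) (big_cat_nat (leq0n c.+1) lt_c) /=.
rewrite big_nat big1 ?add0n => [|j /andP[_]]; last by rewrite ltnS leqNgt => /negbTE->.
rewrite big_nat (eq_bigr (fun=> 1%N)) -?big_nat ?sum_nat_const_nat ?muln1 //.
by move=> j /andP[-> _].
Qed.

(** All pairs of boxes are counted, according to whether they share a row. *)
Lemma texp_binom la : (texp la + binom2 la = 'C(sumn la, 2))%N.
Proof.
elim/last_ind: la => [|la b IH]; first by rewrite /texp /binom2 big_ord0 big_nil.
rewrite texp_rcons /binom2 -cats1 big_cat big_seq1 sumn_cat /= addn0 binD2 -IH /binom2 /=; lia.
Qed.

(** Both sides count the pairs of boxes in a common column. *)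
Lemma binom2_conj la : is_part la ->
  binom2 (conj_part la) = (\sum_(i < size la) i * nth 0 la i)%N.
Proof.
move=> laP; rewrite /binom2 (big_nth 0%N) big_mkord; set J := size _.
transitivity (\sum_(j < J) \sum_(i < size la) (j < nth 0 la i) * i)%N.
  apply: eq_bigr => j _; rewrite -bin2_sum big_mkord -(@sum_lt_cond (size la) _ id).
    by apply: eq_bigr => i _; rewrite lt_conj.
  by rewrite nth_conj // count_size.
rewrite exchange_big /=; apply: eq_bigr => i _; rewrite -big_distrl mulnC /=; congr (_ * _)%N.
rewrite (eq_bigr (fun j : 'I_J => (j < nth 0 la i) * 1))%N; last by move=> j _; rewrite muln1.
rewrite (@sum_lt_cond J _ (fun=> 1%N)) ?sum_nat_const ?card_ord ?muln1 //.
by rewrite /J size_map size_iota -nth0 part_noninc.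
Qed.

(** Modulo 2, [len_w la + texp la] is the sum of i C(la_i + 1, 2) and [texp (conj_part la)] is C(n,
    2) plus the sum of i la_i. Now use C(la_i + 1, 2) = C(la_i, 2) + la_i and C(n, 2) + n = C(n + 1,
    2). *)
Lemma eta_parity la : is_part la ->
  odd (len_w la + texp la + texp (conj_part la) + sumn la) = odd (etaexp la).
Proof.
move=> laP; have := len_wE laP; have := texp_binom (conj_part la).
rewrite binom2_conj // sumn_conj // /etaexp.
have -> : (\sum_(i < size la) i * 'C((nth 0 la i).+1, 2) =
  \sum_(i < size la) i * 'C(nth 0 la i, 2) + \sum_(i < size la) i * nth 0 la i)%N.
  by rewrite -big_split; apply: eq_bigr => i _; rewrite binS bin1 mulnDr.
rewrite binS bin1; move: (len_w la) (texp la) (texp _) (sumn la) => a b c d; lia.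
Qed.

(** * Tableaux *)

Fixpoint winv (w : seq nat) : nat :=
  if w is x :: w' then (count (fun y => y < x) w' + winv w')%N else 0%N.

Lemma count_nth (T : Type) (x0 : T) (p : pred T) s n : size s = n ->
  count p s = (\sum_(x < n) p (nth x0 s x))%N.
Proof. by move=> <-; elim: s => [|x s IH] /=; rewrite ?big_ord0 // big_ord_recl IH. Qed.

Lemma word_invE w : word_inv w = winv w.
Proof.
elim: w => [|x w IH]; rewrite /word_inv ?big_ord0 //= big_ord_recl -IH; congr (_ + _)%N.
  by rewrite big_mkcond big_ord_recl /= add0n (count_nth 0%N _ erefl).
by apply: eq_bigr => i _; rewrite big_mkcond big_ord_recl [RHS]big_mkcond.
Qed.

Definition inv_between (u v : seq nat) := (\sum_(x <- u) count (fun y => y < x) v)%N.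

Lemma inv_between_catl u u' v : inv_between (u ++ u') v = (inv_between u v + inv_between u' v)%N.
Proof. by rewrite /inv_between big_cat. Qed.

Lemma inv_between_catr u v v' : inv_between u (v ++ v') = (inv_between u v + inv_between u v')%N.
Proof. by rewrite /inv_between -big_split; apply: eq_bigr => x _; rewrite count_cat. Qed.

Lemma winv_cat u v : winv (u ++ v) = (winv u + winv v + inv_between u v)%N.
Proof.
elim: u => [|x u IH] /=; first by rewrite /inv_between big_nil addn0.
by rewrite IH /inv_between big_cons count_cat; lia.
Qed.

Lemma winv_flatten_rev R (t : seq (seq nat)) : (size t <= R)%N ->
  winv (flatten (rev t)) = (\sum_(i < R) (winv (nth [::] t i)
     + \sum_(j < i) inv_between (nth [::] t i) (nth [::] t j)))%N.
Proof.
pose F (t : seq (seq nat)) i := (winv (nth [::] t i)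
     + \sum_(j < i) inv_between (nth [::] t i) (nth [::] t j))%N.
move=> leR; transitivity (\sum_(i < size t) F t i)%N; last first.
  rewrite (big_ord_widen R (F t) leR) big_mkcond; apply: eq_bigr => i _.
  case: ltnP => // h; rewrite nth_default // big1 // => j _; by rewrite /inv_between big_nil.
elim/last_ind: t {leR} => [|t r IH]; first by rewrite big_ord0.
rewrite rev_rcons /= winv_cat size_rcons big_ord_recr /= IH [RHS]addnC -addnA [(_ + inv_between
  _ _)%N]addnC addnA.
congr (_ + _)%N; last first.
  by apply: eq_bigr => i _; rewrite /F nth_rcons ltn_ord; congr (_ + _)%N;
     apply: eq_bigr => j _; rewrite nth_rcons (ltn_trans (ltn_ord j)).
rewrite /F nth_rcons ltnn eqxx; congr (_ + _)%N.
transitivity (\sum_(j < size t) inv_between r (nth [::] t j))%N; last first.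
  by apply: eq_bigr => j _; rewrite nth_rcons ltn_ord.
elim/last_ind: t {IH} => [|t s IH]; first by rewrite big_ord0 /inv_between big1.
rewrite rev_rcons /= inv_between_catr IH size_rcons big_ord_recr /= addnC nth_rcons ltnn eqxx.
by congr (_ + _)%N; apply: eq_bigr => j _; rewrite nth_rcons ltn_ord.
Qed.

Lemma count_flatten_nth R (p : pred nat) (t : seq (seq nat)) : (size t <= R)%N ->
  count p (flatten t) = (\sum_(i < R) count p (nth [::] t i))%N.
Proof.
elim: R t => [|R IH] [|r t] //= leR; rewrite ?big_ord0 //.
  by rewrite big1 // => i _; rewrite nth_nil.
by rewrite count_cat big_ord_recl /= IH.
Qed.

Lemma winv_sorted r : sorted leq r -> winv r = 0%N.
Proof.
elim: r => //= x r IH srt; rewrite IH ?(path_sorted srt) // addn0.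
apply/eqP; rewrite -leqn0 leqNgt -has_count -all_predC.
by apply: sub_all (order_path_min leq_trans srt) => y /=; rewrite -leqNgt.
Qed.

(* A tableau given by its list of rows, from the top. *)
Definition istab (la mu : seq nat) (t : seq (seq nat)) : Prop :=
  [/\ map size t = la,
      forall i, sorted leq (nth [::] t i),
      forall i j, (j < size (nth [::] t i.+1) ->
        nth 0 (nth [::] t i) j < nth 0 (nth [::] t i.+1) j)%N,
      forall x, x \in flatten t -> (0 < x <= size mu)%N &
      forall i, (i < size mu)%N -> count_mem i.+1 (flatten t) = nth 0%N mu i].

Section RowsT.
Variables (la mu : seq nat).
Implicit Type T : {ffun box la -> 'I_(size mu).+1}.

Definition mkbox (i : 'I_(size la)) (j : 'I_(nth 0%N la i)) : box la :=
  Tagged (fun i : 'I_(size la) => 'I_(nth 0%N la i)) j.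

Definition tab_rows (F : box la -> nat) : seq (seq nat) :=
  [seq [seq F (mkbox j) | j : 'I_(nth 0%N la i) <- enum 'I_(nth 0%N la i)] | i : 'I_(size la)
    <- enum 'I_(size la)].

Lemma row_wordE (F : box la -> nat) : row_word F = flatten (rev (tab_rows F)).
Proof. by rewrite /row_word /tab_rows -map_rev. Qed.

Lemma size_tab_rows F : map size (tab_rows F) = la.
Proof.
rewrite /tab_rows -map_comp; apply: (@eq_from_nth _ 0%N);
  rewrite size_map size_enum_ord // => i lti.
rewrite (nth_map (Ordinal lti)) ?size_enum_ord //=.
by rewrite size_map size_enum_ord; congr (nth _ _ _); rewrite nth_enum_ord.
Qed.

Lemma nth_tab_rows F (b : box la) : nth 0%N (nth [::] (tab_rows F) (row_of b)) (col_of b) = F b.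
Proof.
case: b => i j; rewrite /row_of /col_of /=.
rewrite (nth_map i) ?size_enum_ord // nth_ord_enum (nth_map j) ?size_enum_ord //.
by rewrite nth_ord_enum.
Qed.

Lemma boxP i j : (j < nth 0 la i)%N -> exists b : box la, row_of b = i /\ col_of b = j.
Proof.
move=> ltj; have lti : (i < size la)%N.
  by rewrite ltnNge; apply/negP => /(nth_default 0%N) E; rewrite E in ltj.
by exists (@mkbox (Ordinal lti) (Ordinal ltj)).
Qed.

Lemma mem_tab_rows F x : reflect (exists b, x = F b) (x \in flatten (tab_rows F)).
Proof.
apply: (iffP (flatten_mapP)) => [[i _ /mapP[j _ ->]]|[[i j] ->]].
  by exists (mkbox j).
by exists i; rewrite ?mem_enum //; apply/mapP; exists j; rewrite ?mem_enum.
Qed.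

Lemma count_tab_rows F x : count_mem x (flatten (tab_rows F)) = #|[set b | F b == x]|.
Proof.
rewrite cardsE -sum1_card big_mkcond count_flatten -map_comp sumnE big_map big_enum /=.
rewrite (eq_bigr (fun b : box la => (F b == x) : nat)); last by move=> b _;
  rewrite unfold_in -[eqn _ _]/(F b == x); case: (F b == x).
rewrite (eq_bigr (fun b : box la => (F (mkbox (tagged b)) == x) : nat)); last by case.
rewrite -(@sig_big_dep _ _ _ _ _ xpredT (fun _ _ => true) (fun i j => nat_of_bool (F (@mkbox i
  j) == x))) /=.
apply: eq_bigr => i _; rewrite -sum1_count big_map big_mkcond big_enum /=.
by apply: eq_bigr => j _; case: eqP.
Qed.

Lemma tab_rows_inj T T' : tab_rows (fun b => T b : nat) = tab_rows (fun b => T' b : nat) -> T = T'.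
Proof.
move=> E; apply/ffunP => b; apply: val_inj; rewrite /=.
by rewrite -(nth_tab_rows (fun b => T b : nat)) E nth_tab_rows.
Qed.

Lemma nth_size_rows (t : seq (seq nat)) i : size (nth [::] t i) = nth 0%N (map size t) i.
Proof.
by case: (ltnP i (size t)) => h; [rewrite (nth_map [::])|rewrite !nth_default ?size_map].
Qed.

Hypothesis laP : is_part la.

Lemma ssytP T : (T \in ssyt la mu) <-> istab la mu (tab_rows (fun b => T b : nat)).
Proof.
have [Es Er] := (size_tab_rows (fun b => T b : nat), nth_tab_rows (fun b => T b : nat)).
have Ec x := count_tab_rows (fun b => T b : nat) x.
have mem_t x := @mem_tab_rows (fun b => T b : nat) x.
set t := tab_rows _ in Es Er Ec mem_t *; rewrite inE.
have le_row i i' : (i <= i')%N -> (nth 0 la i' <= nth 0 la i)%N by apply: part_noninc.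
split.
  case/andP=> /and3P[/forallP pos /forallP row /forallP col] /forallP cont; split=> //.
  - move=> i; apply/(sortedP 0%N) => j; rewrite nth_size_rows Es => ltj.
    have [b [bi bj]] := boxP ltj; have [b' [bi' bj']] := boxP (ltnW ltj).
    have := row b' => /forallP/(_ b); rewrite bi bi' bj bj' eqxx ltnSn /=.
    by rewrite -(Er b) -(Er b') bi bi' bj bj'.
  - move=> i j; rewrite nth_size_rows Es => ltj; have [b [bi bj]] := boxP ltj.
    have [b' [bi' bj']] := boxP (leq_trans ltj (le_row _ _ (leqnSn i))).
    have := col b' => /forallP/(_ b); rewrite bi bi' bj bj' eqxx ltnSn /=.
    by rewrite -(Er b) -(Er b') bi bi' bj bj'.
  - by move=> x /mem_t[b ->]; rewrite (pos b) /= -ltnS ltn_ord.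
  - by move=> i lti; rewrite Ec; apply/eqP/(cont (Ordinal lti)).
case=> _ row col pos cont; apply/andP; split; last first.
  by apply/forallP => i; rewrite -(cont _ (ltn_ord i)) Ec.
(* Strictness between adjacent rows can be iterated because all rows in between reach column [j]. *)
have colS k i j : (j < nth 0 la (i + k).+1)%N ->
    (nth 0 (nth [::] t i) j < nth 0 (nth [::] t (i + k).+1) j)%N.
  elim: k => [|k IH] ltj; first by rewrite addn0 in ltj *; apply: col; rewrite nth_size_rows Es.
  rewrite addnS in ltj *; apply: ltn_trans (IH _) (col _ _ _).
    by apply: leq_trans ltj (le_row _ _ _).
  by rewrite nth_size_rows Es.
apply/and3P; split.
- by apply/forallP => b; have /andP[] := pos (T b) (introT (mem_t _) (ex_intro _ b erefl)).
- apply/forallP => b; apply/forallP => b'; apply/implyP => /andP[/eqP bi bj].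
  rewrite -(Er b) -(Er b') bi; apply: (sorted_leq_nth leq_trans leqnn 0%N (row _));
    rewrite ?inE ?nth_size_rows ?Es.
  + by rewrite -bi /row_of /col_of.
  + by rewrite /row_of /col_of.
  + exact: ltnW.
apply/forallP => b; apply/forallP => b'; apply/implyP => /andP[/eqP bi bj].
rewrite -(Er b) -(Er b') bi -(subnKC bj) addSn; apply: colS.
by rewrite -addSn subnKC // /row_of /col_of.
Qed.

Lemma tab_rows_surj t : istab la mu t ->
  exists2 T, T \in ssyt la mu & t = tab_rows (fun b => T b : nat).
Proof.
move=> tP; have [Es _ _ pos _] := tP.
pose T : {ffun box la -> 'I_(size mu).+1} :=
  [ffun b => inord (nth 0 (nth [::] t (row_of b)) (col_of b))].
have Et : t = tab_rows (fun b => T b : nat).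
  have szt : size t = size la by rewrite -Es size_map.
  apply: (@eq_from_nth _ [::]).
    by rewrite -[RHS](size_map size) size_tab_rows szt.
  move=> i lti; apply: (@eq_from_nth _ 0%N).
    by rewrite !nth_size_rows Es size_tab_rows.
  move=> j; rewrite nth_size_rows Es => ltj; have [b [bi bj]] := boxP ltj.
  rewrite -bi -bj nth_tab_rows ffunE inordK // ltnS.
  have /andP[//] : (0 < nth 0 (nth [::] t (row_of b)) (col_of b) <= size mu)%N.
  apply: pos; apply/flattenP.
  exists (nth [::] t i); first by rewrite mem_nth.
  by rewrite bi bj mem_nth // nth_size_rows Es.
by exists T => //; apply/ssytP; rewrite -Et.
Qed.

End RowsT.

Definition tableaux (la mu : seq nat) : seq (seq (seq nat)) :=
  [seq tab_rows (fun b => T b : nat) | T : {ffun box la -> 'I_(size mu).+1} <- enum (ssyt la mu)].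

Lemma tableaux_uniq la mu : uniq (tableaux la mu).
Proof. by rewrite map_inj_in_uniq ?enum_uniq // => T T' _ _; apply: tab_rows_inj. Qed.

Lemma tableauxP la mu t : is_part la -> (t \in tableaux la mu) <-> istab la mu t.
Proof.
move=> laP; split; first by case/mapP=> T; rewrite mem_enum => /(ssytP laP) h ->.
by case/tab_rows_surj => // T TP ->; apply: map_f; rewrite mem_enum.
Qed.

Lemma sum_ssyt la mu :
  \sum_(T in ssyt la mu) tab_sign (fun b => T b : nat) =
  \sum_(t <- tableaux la mu) (-1) ^+ winv (flatten (rev t)).
Proof.
rewrite big_map big_enum /=; apply: eq_bigr => T _.
by rewrite /tab_sign word_invE row_wordE.
Qed.

Lemma sorted_split m r : sorted leq r -> all (fun x => x <= m.+1)%N r ->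
  r = filter (fun x => x <= m)%N r
      ++ nseq (size r - count (fun x => x <= m)%N r) m.+1.
Proof.
elim: r => //= x r IH srt /andP[lex ler].
case: (leqP x m) => [_|lt_x]; first by rewrite add1n subSS {1}IH ?(path_sorted srt).
have Ex : x = m.+1 by apply/eqP; rewrite eqn_leq lex.
have all_r : all (pred1 m.+1) r.
  apply/allP => y yr; have /allP/(_ y yr) := order_path_min leq_trans srt.
  by rewrite /= Ex eqn_leq => ->; rewrite andbT; apply: (allP ler).
have c0 : count (fun x => x <= m)%N r = 0%N.
  apply/eqP; rewrite -leqn0 leqNgt -has_count -all_predC.
  by apply: sub_all all_r => y /= /eqP->; rewrite ltnn.
rewrite add0n c0 subn0 /= -Ex (_ : filter _ r = [::]) ?cat0s.
  by congr (_ :: _); rewrite Ex; apply/all_pred1P.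
by apply: size0nil; rewrite size_filter.
Qed.

Lemma sorted_cat_nseq r k c : sorted leq r -> all (fun x => x <= c)%N r ->
  sorted leq (r ++ nseq k c).
Proof.
move=> srt ler; have sn : sorted leq (nseq k c).
  by apply/(sortedP 0%N) => i; rewrite size_nseq => h; rewrite !nth_nseq h (ltnW h).
elim: r srt ler => //= x r IH srt /andP[lex ler].
rewrite (path_sortedE leq_trans) IH ?(path_sorted srt) // andbT all_cat.
by rewrite (order_path_min leq_trans srt) all_nseq lex orbT.
Qed.

(** Origin of [hexp]: the largest letters of the lower row exceed precisely the small letters of the
    upper row, and those of the upper row cause no inversion. *)
Lemma inv_between_step m u v a c : all (fun x => x <= m)%N u -> all (fun x => x <= m)%N v ->
  inv_between (u ++ nseq a m.+1) (v ++ nseq c m.+1) = (inv_between u v + a * size v)%N.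
Proof.
move=> um vm; rewrite !inv_between_catl !inv_between_catr; congr (_ + _)%N.
  rewrite [X in (_ + X)%N](_ : _ = 0%N) ?addn0 // /inv_between big_seq big1 // => x /(allP um) h.
  by rewrite count_nseq ltnNge (leq_trans h) ?mul0n.
rewrite [X in (_ + X)%N](_ : _ = 0%N) ?addn0; last first.
  by rewrite /inv_between big_seq big1 // => x /nseqP[-> _]; rewrite count_nseq ltnn mul0n.
have all_v : count (fun y => y < m.+1)%N v = size v by apply/eqP; rewrite -all_count.
rewrite /inv_between (eq_big_seq (fun=> size v)) => [|x /nseqP[-> _]] //.
by rewrite big_const_seq count_predT size_nseq iter_addn_0 mulnC.
Qed.

Section TabStep.
Variables (la mu : seq nat) (b : nat).
Hypotheses (laP : is_part la) (laN : sumn la = (sumn mu + b)%N).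

Let m := size mu.
Let small := fun x => (x <= m)%N.
(** [kap] is the shape filled by the letters up to [m], [res] the restriction to it and [ext] the
    way back. Rows left without small letters are dropped, so that no part of the shape is zero. *)
Let kap (t : seq (seq nat)) := mkpart (size la) (fun i => count small (nth [::] t i)).
Let res (t : seq (seq nat)) := mkseq (fun i => filter small (nth [::] t i)) (size (kap t)).
Let ext (t : seq (seq nat)) :=
  mkseq (fun i => nth [::] t i ++ nseq (nth 0 la i - size (nth [::] t i)) m.+1) (size la).

Section Res.
Variable t : seq (seq nat).
Hypothesis tP : istab la (rcons mu b) t.

Let row_size i : size (nth [::] t i) = nth 0%N la i.
Proof. by have [<- _ _ _ _] := tP; rewrite nth_size_rows. Qed.

Let row_le i : all (fun x => x <= m.+1)%N (nth [::] t i).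
Proof.
case: (ltnP i (size t)) => [lt|/(nth_default [::])->//].
apply/allP => x xr; have [_ _ _ pos _] := tP.
have /andP[_] : (0 < x <= size (rcons mu b))%N by apply: pos; apply/flattenP;
  exists (nth [::] t i); rewrite ?mem_nth.
by rewrite size_rcons.
Qed.

Let row_split i : nth [::] t i = filter small (nth [::] t i)
   ++ nseq (nth 0 la i - count small (nth [::] t i)) m.+1.
Proof. by rewrite -row_size; apply: sorted_split; [case: tP | apply: row_le]. Qed.

Let kap_le i : (count small (nth [::] t i) <= nth 0 la i)%N.
Proof. by rewrite -row_size count_size. Qed.

(** An entry below a letter [m.+1] would exceed the maximal letter, so row [i.+1] ends before the
    letters [m.+1] of row [i] begin. *)
Let kap_ge i : (nth 0 la i.+1 <= count small (nth [::] t i))%N.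
Proof.
case E: (nth 0%N la i.+1) => [//|j]; rewrite ltnNge; apply/negP => lej.
have ltj : (j < nth 0 la i)%N by rewrite -ltnS -E ltnS part_noninc.
have [_ _ col _ _] := tP; have := col i j; rewrite row_size E ltnSn => /(_ isT).
rewrite (row_split i) nth_cat size_filter [(j < _)%N]ltnNge lej /= nth_nseq ltn_sub2r
  ?(leq_ltn_trans lej) //.
have := row_le i.+1; move/(all_nthP 0%N)/(_ j); rewrite row_size E ltnSn => /(_ isT).
by lia.
Qed.

Let noninc i : (count small (nth [::] t i.+1) <= count small (nth [::] t i))%N.
Proof. exact: leq_trans (kap_le _) (kap_ge _). Qed.

Let kap0 : count small (nth [::] t (size la)) = 0%N.
Proof. by apply/eqP; rewrite -leqn0 -[X in (_ <= X)%N](@nth_default _ 0%N la (size la)). Qed.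

Let nth_kap i : nth 0%N (kap t) i = count small (nth [::] t i).
Proof. exact: nth_mkpart. Qed.

Let nth_res i : nth [::] (res t) i = filter small (nth [::] t i).
Proof.
case: (ltnP i (size (kap t))) => [lt|le]; first by rewrite nth_mkseq.
rewrite nth_default ?size_mkseq //; apply/esym/size0nil.
by rewrite size_filter -nth_kap nth_default.
Qed.

Let size_t : size t = size la.
Proof. by have [<- _ _ _ _] := tP; rewrite size_map. Qed.

Let kap_sum : sumn (kap t) = sumn mu.
Proof.
have [Es _ _ pos cont] := tP.
have := count_predC small (flatten t); rewrite size_flatten /shape Es laN.
rewrite (@eq_in_count _ (predC small) (pred1 m.+1)) => [|x xt].
  rewrite cont ?size_rcons // nth_rcons ltnn eqxx => /addIn <-.
  by rewrite sumn_mkpart // -(count_flatten_nth _ (R := size la)) ?size_t.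
have /andP[_] := pos x xt; rewrite size_rcons /= -/m /small -ltnNge eqn_leq => ->.
by [].
Qed.

Lemma tab_res : [/\ kap t \in partns (sumn mu), hstrip (kap t) la,
   istab (kap t) mu (res t), ext (res t) = t &
   winv (flatten (rev t)) = (hexp (kap t) la + winv (flatten (rev (res t))))%N].
Proof.
have kP : is_part (kap t) by apply: mkpart_part.
have [Es srt col pos cont] := tP.
have szk : (size (kap t) <= size la)%N by apply: size_mkpart.
have szr : (size (res t) <= size la)%N by rewrite size_mkseq.
split.
- by rewrite mem_partns kP kap_sum eqxx.
- by apply/hstripP => i; rewrite nth_kap kap_le kap_ge.
- split.
  + apply: (@eq_from_nth _ 0%N); rewrite size_map size_mkseq // => i lti.
    by rewrite -nth_size_rows nth_res size_filter nth_kap.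
  + by move=> i; rewrite nth_res; apply: (sorted_filter leq_trans).
  + move=> i j; rewrite !nth_res => ltj.
    have ltj' : (j < size (filter small (nth [::] t i)))%N.
      by rewrite !size_filter in ltj *; apply: leq_trans ltj (noninc _).
    have nth_small k : (j < size (filter small (nth [::] t k)))%N ->
        nth 0%N (filter small (nth [::] t k)) j = nth 0%N (nth [::] t k) j.
      by move=> h; rewrite [in RHS]row_split nth_cat h.
    rewrite !nth_small //; apply: col; rewrite row_size.
    by rewrite size_filter in ltj; apply: leq_trans ltj (kap_le _).
  + move=> x /flattenP[r] /(nthP [::])[i _ <-]; rewrite nth_res mem_filter => /andP[xm xr].
    rewrite -/m -[(x <= m)%N]/(small x) xm andbT.
    suff /pos/andP[] : x \in flatten t by [].
    case: (ltnP i (size t)) xr => [lt xr|/(nth_default [::])->//].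
    by apply/flattenP; exists (nth [::] t i); rewrite ?mem_nth.
  move=> i lti; have := cont i; rewrite size_rcons nth_rcons lti ltnW // => /(_ isT) <-.
  rewrite !(@count_flatten_nth (size la)) ?size_t //; apply: eq_bigr => j _.
  rewrite nth_res count_filter; apply: eq_count => x /=.
  by case: eqP => // ->; rewrite /small -ltnS.
- apply: (@eq_from_nth _ [::]); rewrite size_mkseq // => i lti.
  by rewrite nth_mkseq // nth_res size_filter -row_split.
rewrite (@winv_flatten_rev (size la)) ?size_t // (@winv_flatten_rev (size la) (res t)) //.
rewrite /hexp -big_split /=; apply: eq_bigr => i _.
rewrite nth_res !winv_sorted ?(sorted_filter leq_trans) //.
rewrite !add0n /psum big_distrr -big_split /=; apply: eq_bigr => j _.
rewrite !nth_res !nth_kap [in LHS](row_split i) [in LHS](row_split j).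
by rewrite inv_between_step ?filter_all // addnC size_filter.
Qed.

End Res.

Section Ext.
Variables (ka : seq nat) (t : seq (seq nat)).
Hypotheses (kaP : is_part ka) (kaN : sumn ka = sumn mu) (hs : hstrip ka la).
Hypothesis tP : istab ka mu t.

Let row_size i : size (nth [::] t i) = nth 0%N ka i.
Proof. by have [<- _ _ _ _] := tP; rewrite nth_size_rows. Qed.

Let ka_le i : (nth 0 ka i <= nth 0 la i)%N.
Proof. by have /hstripP/(_ i)/andP[] := hs. Qed.

Let ka_ge i : (nth 0 la i.+1 <= nth 0 ka i)%N.
Proof. by have /hstripP/(_ i)/andP[] := hs. Qed.

Let row_le i : all small (nth [::] t i).
Proof.
case: (ltnP i (size t)) => [lt|/(nth_default [::])->//].
apply/allP => x xr; have [_ _ _ pos _] := tP.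
by have /andP[_] : (0 < x <= size mu)%N by apply: pos; apply/flattenP; exists (nth [::] t i);
  rewrite ?mem_nth.
Qed.

Let size_ext_row i :
  size (nth [::] t i ++ nseq (nth 0 la i - size (nth [::] t i)) m.+1) = nth 0%N la i.
Proof. by rewrite size_cat size_nseq row_size subnKC. Qed.

Let nth_ext i :
  nth [::] (ext t) i = nth [::] t i ++ nseq (nth 0 la i - nth 0 ka i) m.+1.
Proof.
rewrite -row_size; case: (ltnP i (size la)) => [lt|le]; first by rewrite nth_mkseq.
rewrite nth_default ?size_mkseq //; apply/esym/size0nil.
by rewrite size_ext_row nth_default.
Qed.

Let size_t : size t = size ka.
Proof. by have [<- _ _ _ _] := tP; rewrite size_map. Qed.

Let szk : (size ka <= size la)%N.
Proof.
rewrite leqNgt; apply/negP; rewrite -part_nth_gt0 // ltnNge => /negP; apply.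
by apply: leq_trans (ka_le _) _; rewrite nth_default.
Qed.

Lemma tab_ext : [/\ istab la (rcons mu b) (ext t), kap (ext t) = ka & res (ext t) = t].
Proof.
have [Es srt col pos cont] := tP.
have le_S i : all (fun x => x <= m.+1)%N (nth [::] t i).
  by apply: sub_all (row_le i) => x; apply: leqW.
have extP : istab la (rcons mu b) (ext t).
  split.
  - apply: (@eq_from_nth _ 0%N); rewrite size_map size_mkseq // => i lti.
    by rewrite -nth_size_rows nth_ext -row_size size_ext_row.
  - by move=> i; rewrite nth_ext; apply: sorted_cat_nseq.
  - move=> i j; rewrite !nth_ext -{1}row_size size_ext_row => ltj.
    have ltj' : (j < size (nth [::] t i))%N by rewrite row_size (leq_trans ltj).
    rewrite !nth_cat ltj'; case: (ltnP j (size (nth [::] t i.+1))) => [|lej]; first exact: col.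
    have /(all_nthP 0%N)/(_ j ltj') := row_le i; rewrite nth_nseq row_size ltn_sub2r -?row_size //.
      by rewrite (leq_ltn_trans lej).
  - move=> x /flattenP[r] /(nthP [::])[i _ <-]; rewrite nth_ext mem_cat size_rcons.
    case/orP => [xr|/nseqP[-> _]]; last exact: leqnn.
    case: (ltnP i (size t)) xr => [lt xr|/(nth_default [::])->//].
    have /pos/andP[-> h] : x \in flatten t by apply/flattenP; exists (nth [::] t i);
      rewrite ?mem_nth.
    exact: leqW.
  move=> i; rewrite size_rcons ltnS leq_eqVlt nth_rcons => /predU1P[->|lti].
    rewrite ltnn eqxx (@count_flatten_nth (size la)) ?size_mkseq //.
    transitivity (\sum_(i < size la) (nth 0 la i - nth 0 ka i))%N.
      apply: eq_bigr => j _; rewrite nth_ext count_cat count_nseq /= eqxx mul1n.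
      rewrite (_ : count _ _ = 0%N) //; apply/eqP; rewrite -leqn0 leqNgt -has_count -all_predC.
      by apply: sub_all (row_le j) => x /=; apply: contraTneq => ->; rewrite /small ltnn.
    have : (\sum_(i < size la) (nth 0 la i - nth 0 ka i) + sumn ka = sumn la)%N.
      rewrite (sumn_nth szk) (sumn_nth (leqnn (size la))) -big_split /=.
      by apply: eq_bigr => j _; rewrite subnK.
    by rewrite kaN laN addnC => /addnI.
  rewrite lti -cont // !(@count_flatten_nth (size la)) ?size_mkseq ?size_t //.
  apply: eq_bigr => j _; rewrite nth_ext count_cat count_nseq /= gtn_eqF ?addn0 //.
have kapE : kap (ext t) = ka.
  have [kP _ _ _ _] := tab_res extP; have [kP' _] := partnsP kP.
  have E i : count small (nth [::] (ext t) i) = nth 0%N ka i.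
    rewrite nth_ext count_cat count_nseq /small ltnn mul0n addn0 -row_size.
    by apply/eqP; rewrite -all_count.
  apply: part_ext => // i; rewrite nth_mkpart ?E //.
    by move=> j; rewrite !E part_noninc.
  by rewrite nth_default.
split=> //; apply: (@eq_from_nth _ [::]); rewrite size_mkseq kapE ?size_t // => i lti.
rewrite nth_mkseq ?kapE // nth_ext filter_cat (all_filterP (row_le i)).
by rewrite (_ : filter _ _ = [::]) ?cats0 //; elim: (_ - _)%N => //= k ->; rewrite /small ltnn.
Qed.

End Ext.

Lemma tab_step :
  \sum_(t <- tableaux la (rcons mu b)) (-1) ^+ winv (flatten (rev t)) =
  \sum_(ka <- partns (sumn mu)) strip_wt ka la *
    \sum_(t <- tableaux ka mu) (-1) ^+ winv (flatten (rev t)) :> int.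
Proof.
pose s := [seq (ka, t) | ka <- partns (sumn mu), t <- tableaux ka mu].
transitivity (\sum_(x <- s | hstrip x.1 la) (-1) ^+ (hexp x.1 la + winv (flatten (rev x.2))) :
  int); last first.
  rewrite big_mkcond big_allpairs_dep; apply: eq_bigr => ka _ /=.
  rewrite /strip_wt; case: ifP => _; last by rewrite big1 ?mul0r.
  by rewrite mulr_sumr; apply: eq_bigr => t _; rewrite exprD.
apply: (big_seq_bij (f := fun t => (kap t, res t)) (g := fun x => ext x.2)).
- exact: tableaux_uniq.
- apply: allpairs_uniq_dep => [|ka _|[? ?] [? ?] _ _ [-> ->]] //; first exact: partns_uniq.
  exact: tableaux_uniq.
- move=> t /(tableauxP _ _ laP) tP _; have [kP hs rP Et Ew] := tab_res tP.
  rewrite hs Et Ew; split=> //; apply/allpairsPdep; exists (kap t), (res t); split=> //.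
  by apply/tableauxP => //; case: (partnsP kP).
move=> [ka t] /allpairsPdep[ka' [t' [/partnsP[kP kN] tT [-> ->]]]] /= hs.
have [eP kE rE] := tab_ext kP kN hs (proj1 (tableauxP _ _ kP) tT).
by split=> //; [apply/tableauxP | rewrite kE rE].
Qed.

End TabStep.

Lemma ssyt_sum la mu : is_part la -> sumn la = sumn mu ->
  \sum_(T in ssyt la mu) tab_sign (fun b => T b : nat) = strip_chains (rev mu) la.
Proof.
rewrite sum_ssyt; elim/last_ind: mu la => [|mu b IH] la laP laN.
  have -> : la = [::] by have := part_size_le laP; case: la laP laN => //= a l _ -> ; lia.
  rewrite (perm_big [:: [::]]) ?big_seq1 //; apply: uniq_perm; rewrite ?tableaux_uniq // => t.
  apply/idP/idP; first by move/tableauxP => /(_ isT) []; case: t.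
  by rewrite inE => /eqP->; apply/tableauxP => //; split=> // i; rewrite nth_nil.
rewrite rev_rcons /= sumn_rev tab_step //; last by rewrite -cats1 sumn_cat /= addn0 in laN.
by apply: eq_big_seq => ka /partnsP[kaP kaN]; rewrite IH.
Qed.

Lemma sign_superstandard la : tab_sign (@superstandard la) = (-1) ^+ texp la.
Proof.
rewrite /tab_sign word_invE row_wordE; congr (_ ^+ _).
have Er i : nth [::] (tab_rows (@superstandard la)) i = nseq (nth 0%N la i) i.+1.
  case: (ltnP i (size la)) => [lt|le]; last by rewrite !nth_default // size_map size_enum_ord.
  rewrite (nth_map (Ordinal lt)) ?size_enum_ord //.
  rewrite (_ : nth _ _ _ = Ordinal lt); last by apply: val_inj; rewrite /= nth_enum_ord.
  apply: (@eq_from_nth _ 0%N); rewrite size_map size_enum_ord ?size_nseq // => j ltj.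
  by rewrite (nth_map (Ordinal ltj)) ?size_enum_ord // nth_nseq ltj.
have szt : (size (tab_rows (@superstandard la)) <= size la)%N by rewrite size_map size_enum_ord.
rewrite (winv_flatten_rev szt); apply: eq_bigr => i _.
rewrite Er winv_sorted ?add0n; last by rewrite -[nseq _ _]cat0s sorted_cat_nseq.
rewrite /psum big_distrr; apply: eq_bigr => j _ /=; rewrite Er.
rewrite /inv_between (eq_big_seq (fun=> nth 0%N la j)) => [|x /nseqP[-> _]].
  by rewrite big_const_seq count_predT size_nseq iter_addn_0 mulnC.
by rewrite count_nseq ltnS ltn_ord mul1n.
Qed.

Lemma odd_kostkaE la mu : is_part la -> sumn la = sumn mu ->
  odd_kostka la mu = (-1) ^+ texp la * strip_chains (rev mu) la.
Proof. by move=> laP E; rewrite /odd_kostka sign_superstandard ssyt_sum. Qed.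

(** * Double cosets and matrices *)

Fixpoint margin_matrices (p q : seq nat) : seq (seq (seq nat)) :=
  if p is b :: p' then [seq c :: A | c <- bounded_rows b q, A <- margin_matrices p' (dif q c)]
  else if sumn q == 0 then [:: [::]] else [::].

Fixpoint matrix_inv (q : seq nat) (A : seq (seq nat)) : nat :=
  if A is c :: A' then (cross c (dif q c) + matrix_inv (dif q c) A')%N else 0%N.

Lemma matrix_sumE p q : matrix_sum p q = (\sum_(A <- margin_matrices p q) (-1) ^+ matrix_inv q A)%R.
Proof.
elim: p q => [|b p IH] q /=; first by case: eqP => _; rewrite ?big_seq1 ?big_nil.
rewrite big_allpairs_dep; apply: eq_bigr => c _.
by rewrite IH mulr_sumr; apply: eq_bigr => A _; rewrite exprD.
Qed.

Lemma margin_matrices_uniq p q : uniq (margin_matrices p q).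
Proof.
elim: p q => [|b p IH] q /=; first by case: eqP.
apply: allpairs_uniq_dep => [|c _|[? ?] [? ?] _ _ [-> ->]] //; exact: bounded_rows_uniq.
Qed.

Section DoubleCosetMatrices.
Local Open Scope group_scope.
Local Open Scope nat_scope.

(** * Coxeter length as the number of inversions *)

Section Inversions.
Variable n : nat.
Implicit Types (w : 'S_n) (x y : 'I_n).

Definition ninv w := \sum_(p : 'I_n * 'I_n | p.1 < p.2) (w p.2 < w p.1).

Lemma ninv1 : ninv 1 = 0.
Proof. by rewrite /ninv big1 // => p lt_p; rewrite !perm1 ltnNge ltnW. Qed.

Lemma tperm_lt x y (p : 'I_n * 'I_n) : y = x.+1 :> nat -> p.1 < p.2 -> p != (x, y) ->
  tperm x y p.1 < tperm x y p.2.
Proof.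
case: p => i j /= Ey lt_ij /eqP ne.
have lt_of (a b : 'I_n) : a != b -> (a < b) || (b < a) by rewrite -neq_ltn.
case: tpermP => [Ei|Ei|/eqP nix /eqP niy]; case: tpermP => [Ej|Ej|/eqP njx /eqP njy] //.
- by rewrite Ei Ej ltnn in lt_ij.
- by case: ne; rewrite Ei Ej.
- by subst i; move: (lt_of _ _ njy); rewrite Ey in lt_ij *; lia.
- by subst i j; rewrite Ey ltnNge leqnSn in lt_ij.
- by rewrite Ei Ej ltnn in lt_ij.
- by subst i; rewrite Ey in lt_ij; apply: ltnW.
- by subst j; rewrite Ey; apply: ltnW.
by subst j; move: (lt_of _ _ nix); rewrite Ey in lt_ij *; lia.
Qed.

(** Exactly one of the two comparisons holds, so one inversion is gained or lost, expressed without
    subtraction; [tperm x y] permutes all other ordered pairs of positions. *)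
Lemma ninv_tperm w x y : y = x.+1 :> nat ->
  ninv (tperm x y * w) + (w y < w x) = ninv w + (w x < w y).
Proof.
move=> Ey; have lt_xy : (x, y).1 < (x, y).2 by rewrite /= Ey.
rewrite /ninv (bigD1 (x, y)) //= [in RHS](bigD1 (x, y)) //= !permM tpermL tpermR.
rewrite [LHS]addnC addnA [RHS]addnAC; congr (_ + _).
pose h p := (tperm x y p.1, tperm x y p.2).
have hK : involutive h by case=> i j; rewrite /h /= !tpermK.
rewrite [RHS](reindex_inj (inv_inj hK)) /=; apply: eq_big => [p|p _]; last by rewrite !permM.
have imp (q : 'I_n * 'I_n) : (q.1 < q.2) && (q != (x, y)) -> 
    ((h q).1 < (h q).2) && (h q != (x, y)).
  case/andP=> lt_q ne_q; rewrite tperm_lt //=; apply: contraTneq lt_q => Eh.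
  by rewrite -[q]hK Eh /h /= tpermL tpermR Ey -leqNgt leqnSn.
by apply/idP/idP => /imp //; rewrite hK.
Qed.

Lemma ninvV w : ninv w^-1 = ninv w.
Proof.
pose h (p : 'I_n * 'I_n) := (w p.2, w p.1).
have hI : injective h by case=> i j [i' j'] [/perm_inj-> /perm_inj->].
rewrite /ninv big_mkcond (reindex_inj hI) [RHS]big_mkcond; apply: eq_bigr => -[i j] _ /=.
by rewrite !permK; case: (i < j); case: (w j < w i).
Qed.

Definition has_word w k := [exists c, @is_refl_word n w k c].

Lemma has_wordP w k : reflect (exists2 c : 'I_k -> 'S_n,
    forall i, c i \in simple_refl n & w = (\prod_i c i)%g) (has_word w k).
Proof.
apply: (iffP existsP) => [[c /andP[/forallP h /eqP->]]|[c h ->]]; first by exists c.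
exists (finfun c); apply/andP; split; first by apply/forallP => i; rewrite ffunE.
by apply/eqP/eq_bigr => i _; rewrite ffunE.
Qed.

Lemma has_word0 w : has_word w 0 = (w == 1%g).
Proof.
apply/has_wordP/eqP => [[c _ ->]|->]; first by rewrite big_ord0.
by exists (fun=> 1%g) => [[]|]; rewrite ?big_ord0.
Qed.

Lemma has_wordS w k : reflect (exists x y w', [/\ y = x.+1 :> nat, w =
  (tperm x y * w')%g & has_word w' k])
  (has_word w k.+1).
Proof.
apply: (iffP (has_wordP _ _)) => [[c h ->]|[x [y [w' [Ey -> /has_wordP[c h ->]]]]]].
  have /imsetP[[x y]] := h ord0; rewrite inE /= => /eqP Ey Ec.
  exists x, y, (\prod_(i < k) c (lift ord0 i))%g; rewrite big_ord_recl Ec; split=> //.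
  by apply/has_wordP; exists (fun i => c (lift ord0 i)).
exists (fun i => if unlift ord0 i is Some j then c j else tperm x y).
  move=> i; case: unliftP => [j _|_]; first exact: h.
  by apply/imsetP; exists (x, y); rewrite ?inE //= Ey.
rewrite big_ord_recl unlift_none; congr (_ * _)%g; apply: eq_bigr => i _.
by rewrite liftK.
Qed.

Lemma ninv_le_word w k : has_word w k -> ninv w <= k.
Proof.
elim: k w => [|k IH] w; first by rewrite has_word0 => /eqP->; rewrite ninv1.
case/has_wordS=> x [y [w' [Ey -> /IH le_k]]].
by have := ninv_tperm w' Ey; case: (_ < _); case: (_ < _); lia.
Qed.

(** A monotone [bl] with equal values at [x] and [y] is constant between them, so adjacent steps can
    be chained; a constant [bl] yields plain monotonicity. *)
Lemma block_increasing (bl : nat -> nat) (f : 'I_n -> 'I_n) :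
    {homo bl : i j / i <= j} ->
    (forall x y, y = x.+1 :> nat -> bl x = bl y -> f x < f y) ->
  forall x y, x < y -> bl x = bl y -> f x < f y.
Proof.
move=> bl_mono step x y lt_xy.
have [d Ed] : exists d, y = x + d.+1 :> nat by exists (y - x.+1); rewrite addnS -addSn subnKC.
elim: d y {lt_xy} Ed => [|d IH] y Ed Eb; first by apply: step => //; rewrite Ed addn1.
have ltz : x + d.+1 < n by apply: leq_ltn_trans (ltn_ord y); rewrite Ed leq_add2l.
have Ez : bl x = bl (Ordinal ltz).
  apply/eqP; rewrite eqn_leq bl_mono ?leq_addr //= Eb bl_mono //.
  by rewrite Ed leq_add2l.
apply: ltn_trans (IH (Ordinal ltz) erefl Ez) (step _ _ _ _); last by rewrite -Ez.
by rewrite Ed /= addnS.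
Qed.

(** An increasing map satisfies [x <= w x], and both sides have the same sum over all [x]. *)
Lemma increasing_perm w : (forall x y, x < y -> w x < w y) -> w = 1%g.
Proof.
move=> inc; have ge (x : 'I_n) : x <= w x.
  case: x => i lti; elim: i lti => // i IH lti; apply: leq_ltn_trans (IH (ltnW lti)) _.
  exact: inc.
have E : (fun x : 'I_n => x : nat) =1 (fun x => w x : nat).
  apply: sum_eq_pointwise => //.
  by rewrite [X in _ <= X](reindex_inj (@perm_inj _ w)).
by apply/permP => x; apply: val_inj; rewrite perm1 /= -E.
Qed.

(** A permutation other than the identity has an adjacent descent, and undoing it removes exactly
    one inversion. *)
Lemma word_ninv w : has_word w (ninv w).
Proof.
move Ek: (ninv w) => k; elim: k w Ek => [|k IH] w Ek.
  rewrite has_word0; apply/eqP/increasing_perm => x y lt_xy.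
  move/eqP: Ek; rewrite sum_nat_eq0 => /forallP/(_ (x, y))/implyP/(_ lt_xy) /=.
  rewrite eqb0 -leqNgt leq_eqVlt => /predU1P[/val_inj/perm_inj Exy|//].
  by rewrite Exy ltnn in lt_xy.
have [/existsP[[x y] /= /andP[/eqP Ey lt_w]]|] :=
    boolP [exists p : 'I_n * 'I_n, (p.2 == p.1.+1 :> nat) && (w p.2 < w p.1)].
  apply/has_wordS; exists x, y, (tperm x y * w)%g; split=> //.
    by rewrite mulgA tperm2 mul1g.
  by apply: IH; have := ninv_tperm w Ey; rewrite lt_w Ek ltnNge ltnW //=; lia.
rewrite negb_exists => /forallP h; suff w1 : w = 1%g by rewrite w1 ninv1 in Ek.
apply: increasing_perm => x y lt_xy.
apply: (@block_increasing (fun=> 0)) => // {lt_xy} {}x {}y Ey _.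
have := h (x, y); rewrite /= Ey eqxx /= -leqNgt leq_eqVlt => /predU1P[/val_inj/perm_inj Exy|//].
by move: Ey; rewrite Exy; lia.
Qed.

Lemma coxlenE w : coxlen w = ninv w.
Proof.
rewrite /coxlen; case: ex_minnP => k wk mink; apply/eqP.
by rewrite eqn_leq (ninv_le_word wk) (mink _ (word_ninv w)).
Qed.

End Inversions.

(** * Double cosets of Young subgroups and their matrices *)

Lemma reshape_index_cons a al i :
  reshape_index (a :: al) i = if i < a then 0 else (reshape_index al (i - a)).+1.
Proof.
rewrite /reshape_index /= subn_eq0; case: ltnP => // le_ai.
by rewrite subSn.
Qed.

Lemma reshape_index_mono al : {homo reshape_index al : i j / i <= j}.
Proof.
elim: al => [|a al IH] i j le_ij //; rewrite !reshape_index_cons.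
case: (ltnP i a) => // le_ai; rewrite [j < a]ltnNge (leq_trans le_ai) //= ltnS.
by apply: IH; apply: leq_sub2r.
Qed.

Lemma reshape_index_lt al i j : reshape_index al i < reshape_index al j -> i < j.
Proof.
by move=> h; rewrite ltnNge; apply/negP => /(reshape_index_mono al); rewrite leqNgt h.
Qed.

Lemma count_reshape al j : \sum_(x < sumn al) (reshape_index al x == j) = nth 0 al j.
Proof.
elim: al j => [|a al IH] j; first by rewrite big_ord0 nth_nil.
rewrite [sumn _]/= big_split_ord /=.
under eq_bigr => x _ do rewrite reshape_index_cons ltn_ord.
under [X in _ + X]eq_bigr => x _ do rewrite reshape_index_cons ltnNge leq_addr /= addKn.
case: j => [|j] /=; rewrite sum_nat_const card_ord /=.
  by rewrite big1 ?muln1 ?addn0.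
by rewrite muln0 add0n -IH.
Qed.

Lemma exists_perm (T : eqType) n (f g : 'I_n -> T) :
  (forall t, \sum_x (f x == t) = \sum_x (g x == t)) ->
  exists p : 'S_n, forall x, g x = f (p x).
Proof.
move=> E; have /tuple_permP[p Ep] : perm_eq [tuple g x | x < n] [tuple f x | x < n].
  apply/allP => t _ /=; rewrite !count_map -!sum1_count -!enumT !big_enum_cond /= big_mkcond [X
    in _ == X]big_mkcond.
  by apply/eqP; apply: etrans (etrans _ (esym (E t))) _; apply: eq_bigr => x _ /=; case: eqP.
exists p => x; have := congr1 (fun t => tnth t x) (val_inj Ep).
by rewrite !tnth_mktuple.
Qed.

Section DoubleCosets.
Variables (be al : seq nat) (n : nat).
Hypotheses (beN : sumn be = n) (alN : sumn al = n).
Implicit Types (w u v : 'S_n) (x y : 'I_n).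

Let bb := reshape_index be.
Let ba := reshape_index al.
Let YB := @young_subgroup n be.
Let YA := @young_subgroup n al.

Definition coset_matrix w i j := \sum_(x : 'I_n) ((bb x == i) && (ba (w x) == j)).

Let YP (ga : seq nat) u : reflect (forall x : 'I_n, reshape_index ga (u x) = reshape_index ga x)
  (u \in @young_subgroup n ga).
Proof. by rewrite inE; apply: (iffP forallP) => h x; apply/eqP. Qed.

Let mem_coset w w' : reflect (exists u v, [/\ u \in YB, v \in YA & w' = (u * w * v)%g])
  (w' \in (YB * [set w] * YA)%g).
Proof.
apply: (iffP mulsgP) => [[_ v /mulsgP[u _ uY /set1P-> ->] vY ->]|[u [v [uY vY ->]]]].
  by exists u, v.
by exists (u * w)%g v => //; apply/mulsgP; exists u w; rewrite ?set11.
Qed.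

(** Equal matrices mean that each pair of blocks, of a position and of its image, occurs equally
    often for both permutations. Hence some [p] matches these pairs; it preserves the blocks of
    [be], and the remaining factor preserves those of [al]. *)
Lemma double_cosetP w w' : (w' \in (YB * [set w] * YA)%g) <-> coset_matrix w' =2 coset_matrix w.
Proof.
split=> [/mem_coset[u [v [/YP uY /YP vY ->]]] i j|E].
  rewrite /coset_matrix [RHS](reindex_inj (@perm_inj _ u)) /=; apply: eq_bigr => x _.
  by rewrite !permM /ba vY /bb uY.
have [|p Ep] := @exists_perm _ n (fun x : 'I_n => (bb x, ba (w x))) (fun x : 'I_n => (bb x, ba
  (w' x))).
  by case=> i j; apply: esym (E i j).
apply/mem_coset; exists p, ((p * w)^-1 * w')%g; split; last by rewrite mulKVg.
  by apply/YP => x; have [Eb _] := Ep x; apply: esym Eb.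
apply/YP => x; rewrite permM; set y := ((p * w)^-1)%g x.
have -> : x = w (p y) by rewrite -permM /y permKV.
by have [_] := Ep y.
Qed.

Lemma sum_coset_matrix (ri rj : seq nat) (w : 'S_n) (G : nat -> nat -> nat) :
    uniq ri -> uniq rj -> (forall x : 'I_n, bb x \in ri) -> (forall x : 'I_n, ba x \in rj) ->
  \sum_(i <- ri) \sum_(j <- rj) coset_matrix w i j * G i j = \sum_(x : 'I_n) G (bb x) (ba (w x)).
Proof.
move=> Ui Uj mi mj; rewrite /coset_matrix.
under eq_bigr do under eq_bigr do rewrite big_distrl.
under eq_bigr do rewrite exchange_big.
rewrite exchange_big /=; apply: eq_bigr => x _.
rewrite (bigD1_seq (bb x)) //= (bigD1_seq (ba (w x))) //= !eqxx mul1n.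
rewrite big1 => [|j /negbTE ne]; last by rewrite eq_sym ne.
by rewrite big1 ?addn0 // => i /negbTE ne; rewrite big1 // => j _; rewrite eq_sym ne.
Qed.

(* The inversions of [w] forced by its double coset. *)
Definition matrix_cinv w := \sum_(y : 'I_n) \sum_(x : 'I_n) ((bb x < bb y) && (ba (w y) < ba (w
  x))).

(** Written through the matrix alone, the number is visibly constant on a double coset; any lists
    containing the blocks that occur will do. *)
Lemma matrix_cinvE (ri rj : seq nat) w :
    uniq ri -> uniq rj -> (forall x : 'I_n, bb x \in ri) -> (forall x : 'I_n, ba x \in rj) ->
  matrix_cinv w = \sum_(i <- ri) \sum_(j <- rj) coset_matrix w i j *
    \sum_(k <- ri) \sum_(l <- rj) coset_matrix w k l * ((k < i) && (j < l)).
Proof.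
move=> Ui Uj mi mj.
rewrite (@sum_coset_matrix ri rj w (fun i j => \sum_(k <- ri) \sum_(l <- rj) coset_matrix w k l
  * ((k < i) && (j < l)))) //.
apply: eq_bigr => y _.
by rewrite (@sum_coset_matrix ri rj w (fun k l => (k < bb y) && (ba (w y) < l) : nat)).
Qed.

Lemma matrix_cinv_le w : matrix_cinv w <= ninv w.
Proof.
rewrite /matrix_cinv exchange_big pair_big /= /ninv [in leqRHS]big_mkcond /=;
  apply: leq_sum => -[x y] _ /=.
case: (ltnP (bb x)) => //= lt_b; case: (ltnP (ba (w y))) => //= lt_a.
by rewrite (reshape_index_lt lt_b) (reshape_index_lt lt_a).
Qed.

Let tpermY (ga : seq nat) x y : reshape_index ga x = reshape_index ga y ->
  tperm x y \in @young_subgroup n ga.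
Proof. by move=> E; apply/YP => z; case: tpermP => [->|->|]. Qed.

Let Y1 (ga : seq nat) : 1%g \in @young_subgroup n ga.
Proof. by apply/YP => x; rewrite perm1. Qed.

(** By minimality [w] increases on the blocks of [be] and its inverse on those of [al], since
    otherwise an adjacent exchange within a block would shorten [w]. So each inversion joins
    different blocks on both sides. *)
Lemma ninv_min w : (forall w', coset_matrix w' =2 coset_matrix w -> ninv w <= ninv w') ->
  ninv w <= matrix_cinv w.
Proof.
move=> minw.
have incb : forall x y : 'I_n, x < y -> bb x = bb y -> w x < w y.
  apply: block_increasing => [|x y Ey Eb]; first exact: reshape_index_mono.
  rewrite ltnNge leq_eqVlt; apply/negP => /predU1P[/val_inj/perm_inj Exy|lt_w].
    by move: Ey; rewrite Exy; lia.
  have := minw (tperm x y * w)%g; have := ninv_tperm w Ey; rewrite lt_w ltnNge ltnW //= => E.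
  suff c : coset_matrix (tperm x y * w)%g =2 coset_matrix w by move/(_ c); lia.
  by apply/double_cosetP/mem_coset; exists (tperm x y), 1%g; rewrite mulg1 Y1 tpermY.
have inca : forall x y : 'I_n, x < y -> ba x = ba y -> (w^-1)%g x < (w^-1)%g y.
  apply: block_increasing => [|x y Ey Eb]; first exact: reshape_index_mono.
  rewrite ltnNge leq_eqVlt; apply/negP => /predU1P[/val_inj/perm_inj Exy|lt_w].
    by move: Ey; rewrite Exy; lia.
  (* Inversion turns an exchange of adjacent values into an exchange of adjacent positions, which
     [ninv_tperm] covers. *)
  have EV : ninv (w * tperm x y) = ninv (tperm x y * w^-1) by rewrite -ninvV invMg tpermV.
  have := minw (w * tperm x y)%g; rewrite EV {EV}.
  have := ninv_tperm (w^-1)%g Ey; rewrite ninvV lt_w ltnNge ltnW //= => E.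
  suff c : coset_matrix (w * tperm x y)%g =2 coset_matrix w by move/(_ c); lia.
  by apply/double_cosetP/mem_coset; exists 1%g, (tperm x y); rewrite mul1g Y1 tpermY.
rewrite /matrix_cinv exchange_big pair_big /= /ninv [in leqLHS]big_mkcond /=;
  apply: leq_sum => -[x y] _ /=.
case: (ltnP x y) => //= lt_xy; case: (ltnP (w y) (w x)) => //= lt_w.
have := reshape_index_mono be (ltnW lt_xy); rewrite leq_eqVlt => /predU1P[Eb|lt_b].
  by have := incb x y lt_xy Eb; rewrite ltnNge ltnW.
have := reshape_index_mono al (ltnW lt_w); rewrite leq_eqVlt => /predU1P[Ea|lt_a].
  by have := inca _ _ lt_w Ea; rewrite !permK ltnNge ltnW.
by rewrite /bb lt_b /ba lt_a.
Qed.

Lemma matrix_cinv_eq w w' : coset_matrix w =2 coset_matrix w' -> matrix_cinv w = matrix_cinv w'.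
Proof.
move=> E; pose ri := undup [seq bb x | x : 'I_n]; pose rj := undup [seq ba x | x : 'I_n].
have mi (x : 'I_n) : bb x \in ri by rewrite mem_undup; apply: map_f; rewrite mem_enum.
have mj (x : 'I_n) : ba x \in rj by rewrite mem_undup; apply: map_f; rewrite mem_enum.
rewrite !(matrix_cinvE _ _ _ mi mj) ?undup_uniq //.
by apply: eq_bigr => i _; apply: eq_bigr => j _; rewrite E; congr (_ * _);
   apply: eq_bigr => k _; apply: eq_bigr => l _; rewrite E.
Qed.

Lemma coset_lenE c : c \in @double_cosets n be al -> coset_len c = matrix_cinv (repr c).
Proof.
case/imsetP=> w0 _ Ec.
have mem_c w : (w \in c) <-> coset_matrix w =2 coset_matrix w0 by rewrite Ec; apply: double_cosetP.
have rc : repr c \in c by apply: (@mem_repr _ _ w0); apply/mem_c.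
rewrite /coset_len; case: arg_minnP => // w wc minw.
have E w' : w' \in c -> matrix_cinv w' = matrix_cinv (repr c).
  by move=> /mem_c h; have /mem_c h' := rc; apply: matrix_cinv_eq => i j; rewrite h h'.
rewrite coxlenE -(E _ wc); apply/eqP; rewrite eqn_leq matrix_cinv_le andbT;
  apply: ninv_min => w' Ew'.
rewrite -!coxlenE; apply: minw; apply/mem_c => i j; rewrite Ew'.
by move/mem_c: wc => ->.
Qed.

End DoubleCosets.

(** * Matrices with given margins *)

Lemma nth_dif q c j : size c = size q -> nth 0 (dif q c) j = nth 0 q j - nth 0 c j.
Proof. by elim: q c j => [|a q IH] [|k c] [|j] //= [/IH]. Qed.

Lemma all2_leq q c : size c = size q -> (forall j, nth 0 c j <= nth 0 q j) -> all2 leq c q.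
Proof.
elim: q c => [|a q IH] [|k c] //= [Es] h; rewrite (h 0) IH // => j; exact: (h j.+1).
Qed.

Lemma all2_leq_nth q c j : size c = size q -> all2 leq c q -> nth 0 c j <= nth 0 q j.
Proof. by elim: q c j => [|a q IH] [|k c] [|j] //= [Es] /andP[// _ h]; apply: IH. Qed.

Lemma sumn_eq0 q : sumn q = 0 <-> forall j, nth 0 q j = 0.
Proof.
split=> [|h]; last by rewrite (sumn_nth (leqnn _)) big1.
elim: q => [|a q IH] /=; first by move=> _ j; rewrite nth_nil.
by move/eqP; rewrite addn_eq0 => /andP[/eqP-> /eqP q0] [|j] //; apply: IH.
Qed.

Lemma mem_margin_matrices p q A : A \in margin_matrices p q <->
  [/\ map sumn A = p, forall c, c \in A -> size c = size q &
      forall j, \sum_(c <- A) nth 0 c j = nth 0 q j].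
Proof.
elim: p q A => [|b p IH] q A.
  rewrite [margin_matrices _ _]/=; case: eqP => E; split.
  - rewrite inE => /eqP->; split=> // j; rewrite big_nil.
    by move/sumn_eq0: E => ->.
  - by case; case: A.
  - by [].
  by case; case: A => //= _ _ h; case: E; apply/sumn_eq0 => j; rewrite -h big_nil.
split.
  case/allpairsPdep=> c [A' [inv_between /IH[Es szA sumA] ->]].
  move: inv_between; rewrite mem_bounded_rows => /and3P[/eqP sc /eqP Ec le_c].
  have sd := size_dif sc; split.
  - by rewrite /= Ec Es.
  - by move=> c'; rewrite inE => /predU1P[->|/szA->].
  by move=> j; rewrite big_cons sumA nth_dif // subnKC // all2_leq_nth.
case: A => [|c A] [] // [Ec Es] szA sumA.
have sc : size c = size q by apply: szA; rewrite mem_head.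
have le_c : all2 leq c q by apply: all2_leq => // j; rewrite -sumA big_cons leq_addr.
apply/allpairsPdep; exists c, A; split=> //; first by rewrite mem_bounded_rows sc Ec le_c !eqxx.
apply/IH; split=> // [c' c'A|j]; first by rewrite size_dif // szA // inE c'A orbT.
by rewrite nth_dif // -sumA big_cons addKn.
Qed.

Lemma cross_map (f g : nat -> nat) rj : sorted gtn rj ->
  cross (map f rj) (map g rj) = \sum_(j <- rj) \sum_(l <- rj) f j * g l * (j < l).
Proof.
elim: rj => [|a rj IH] srt; first by rewrite big_nil.
have lt_a b : b \in rj -> b < a.
  by move=> h; have /allP/(_ b h) := order_path_min (rev_trans ltn_trans) srt.
rewrite /= IH ?(path_sorted srt) // big_cons big_cons ltnn muln0 add0n.
rewrite [X in _ = X + _](_ : _ = 0) ?add0n; last first.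
  by rewrite big_seq big1 // => l /lt_a h; rewrite ltnNge ltnW // muln0.
rewrite sumnE big_map big_distrr -big_split /=; apply: eq_big_seq => j /lt_a h.
by rewrite big_cons h muln1 mulnC.
Qed.

(** Brings the row-by-row count into the form of [matrix_cinvE]. As the lists decrease, the row
    split off has a larger index than all the remaining ones, so its pairs with them are those
    counted by [cross]. *)
Lemma matrix_inv_map (N : nat -> nat -> nat) ri rj : sorted gtn ri -> sorted gtn rj ->
  matrix_inv [seq \sum_(i <- ri) N i j | j <- rj] [seq [seq N i j | j <- rj] | i <- ri] =
  \sum_(i <- ri) \sum_(j <- rj) N i j *
    \sum_(k <- ri) \sum_(l <- rj) N k l * ((k < i) && (j < l)).
Proof.
move=> + srj; elim: ri => [|a ri IH] sri; first by rewrite big_nil.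
have lt_a b : b \in ri -> b < a.
  by move=> h; have /allP/(_ b h) := order_path_min (rev_trans ltn_trans) sri.
rewrite /= (_ : dif _ _ = [seq \sum_(i <- ri) N i j | j <- rj]); last first.
  by rewrite /dif; elim: (rj) => //= j l ->; rewrite big_cons addKn.
rewrite IH ?(path_sorted sri) // cross_map // [RHS]big_cons; congr (_ + _).
  apply: eq_bigr => j _; rewrite big_cons [X in _ = _ * (X + _)](_ : _ = 0) ?add0n; last first.
    by rewrite big1 // => l _; rewrite ltnn muln0.
  rewrite exchange_big big_distrr; apply: eq_bigr => l _ /=.
  rewrite -mulnA big_distrl; congr (_ * _); apply: eq_big_seq => k /lt_a h.
  by rewrite h.
apply: eq_big_seq => i /lt_a h; apply: eq_bigr => j _; congr (_ * _).
rewrite big_cons [X in _ = X + _](_ : _ = 0) ?add0n // big1 // => l _.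
by rewrite ltnNge ltnW //= muln0.
Qed.

Section CosetMatrices.
Variables (be al : seq nat).
Hypothesis (Es : sumn be = sumn al).

Let n := sumn al.
Let ri := rev (iota 0 (size be)).
Let rj := rev (iota 0 (size al)).
Let N (w : 'S_n) := coset_matrix be al w.
(* Rows and columns are listed backwards to match [strip_chains]. *)
Let block_matrix (w : 'S_n) := [seq [seq N w i j | j <- rj] | i <- ri].

Let sorted_rev_iota m : sorted gtn (rev (iota 0 m)).
Proof. by rewrite rev_sorted iota_ltn_sorted. Qed.

Let Ui : uniq ri. Proof. by rewrite rev_uniq iota_uniq. Qed.
Let Uj : uniq rj. Proof. by rewrite rev_uniq iota_uniq. Qed.
Let mem_ri i : (i \in ri) = (i < size be). Proof. by rewrite mem_rev mem_iota. Qed.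
Let mem_rj j : (j \in rj) = (j < size al). Proof. by rewrite mem_rev mem_iota. Qed.

Let mi (x : 'I_n) : reshape_index be x \in ri.
Proof. by rewrite mem_ri reshape_indexP // Es. Qed.
Let mj (x : 'I_n) : reshape_index al x \in rj.
Proof. by rewrite mem_rj reshape_indexP. Qed.

Let rev_map_nth s : rev s = [seq nth 0 s i | i <- rev (iota 0 (size s))].
Proof. by rewrite map_rev -/(mkseq _ _) mkseq_nth. Qed.

Let count_be i : \sum_(x < n) (reshape_index be x == i) = nth 0 be i.
Proof. by rewrite /n -Es count_reshape. Qed.

Let sum_pred1 (r : seq nat) (b : bool) a : uniq r -> a \in r -> \sum_(i <- r) (b && (a == i)) = b.
Proof.
move=> Ur ar; rewrite (bigD1_seq a) //= eqxx andbT big1 ?addn0 // => i /negbTE ne.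
by rewrite eq_sym ne andbF.
Qed.

Let row_sum w i : \sum_(j <- rj) N w i j = nth 0 be i.
Proof.
rewrite exchange_big -count_be /=; apply: eq_bigr => x _; exact: sum_pred1.
Qed.

Let col_sum w : [seq \sum_(i <- ri) N w i j | j <- rj] = rev al.
Proof.
rewrite [RHS]rev_map_nth; apply: eq_map => j; rewrite exchange_big -count_reshape /=.
rewrite [RHS](reindex_inj (@perm_inj _ w)); apply: eq_bigr => x _ /=.
by under eq_bigr do rewrite andbC; apply: sum_pred1.
Qed.

Let amat_mats w : block_matrix w \in margin_matrices (rev be) (rev al).
Proof.
apply/mem_margin_matrices; split.
- rewrite /block_matrix -map_comp [RHS]rev_map_nth; apply: eq_map => i /=.
  by rewrite sumnE big_map row_sum.
- by move=> c /mapP[i _ ->]; rewrite size_map !size_rev size_iota.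
move=> j; rewrite -(col_sum w) big_map; case: (ltnP j (size rj)) => [lt|le].
  by rewrite (nth_map 0) //; apply: eq_bigr => i _; rewrite (nth_map 0).
by rewrite nth_default ?size_map // big1 // => i _; rewrite nth_default ?size_map.
Qed.

Let amat_inj w w' : block_matrix w = block_matrix w' -> N w =2 N w'.
Proof.
move=> /eq_in_map E i j; rewrite /N.
have [ir|/negP ir] := boolP (i \in ri).
  have /eq_in_map Ei := E i ir; have [jr|/negP jr] := boolP (j \in rj); first exact: Ei.
  by rewrite /coset_matrix !big1 // => x _; case: (_ =P j) => [Ej|]; rewrite ?andbF //;
    case: jr; rewrite -Ej.
by rewrite /coset_matrix !big1 // => x _; case: (_ =P i) => // Ei; case: ir; rewrite -Ei.
Qed.

Let amat_eq w w' : N w =2 N w' -> block_matrix w = block_matrix w'.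
Proof. by move=> E; apply: eq_map => i; apply: eq_map => j; apply: E. Qed.

Let amat_surj A : A \in margin_matrices (rev be) (rev al) -> exists w, block_matrix w = A.
Proof.
case/mem_margin_matrices=> sumA szA colA.
pose N0 i j := nth 0 (nth [::] A (index i ri)) (index j rj).
have szri : size ri = size be by rewrite size_rev size_iota.
have szrj : size rj = size al by rewrite size_rev size_iota.
have szA' : size A = size ri by rewrite szri -[LHS](size_map sumn) sumA size_rev.
have EA : A = [seq [seq N0 i j | j <- rj] | i <- ri].
  apply: (@eq_from_nth _ [::]); rewrite ?size_map // => i lti.
  have szi : size (nth [::] A i) = size rj by rewrite (szA _ (mem_nth _ lti)) size_rev szrj.
  rewrite (nth_map 0) -?szA' //; apply: (@eq_from_nth _ 0); rewrite ?size_map // szi => j ltj.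
  by rewrite (nth_map 0) // /N0 !index_uniq // -szA'.
(* The matrix is unfolded into a list of [n] pairs in which each (i, j) is repeated as often as its
   entry says. *)
pose P := flatten [seq nseq (N0 z.1 z.2) z | z <- [seq (i, j) | i <- ri, j <- rj]].
have countP (p : pred (nat * nat)) :
    count p P = \sum_(i <- ri) \sum_(j <- rj) N0 i j * p (i, j).
  rewrite count_flatten sumnE -map_comp big_map big_allpairs.
  by apply: eq_bigr => i _; apply: eq_bigr => j _; rewrite /= count_nseq mulnC.
have rowN0 i : i \in ri -> \sum_(j <- rj) N0 i j = nth 0 be i.
  move=> ir; have : nth 0 (map sumn A) (index i ri) = nth 0 (rev be) (index i ri) by rewrite sumA.
  rewrite rev_map_nth EA -map_comp !(nth_map 0) ?index_mem // !nth_index //= => <-.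
  by rewrite sumnE big_map.
have colN0 j : j \in rj -> \sum_(i <- ri) N0 i j = nth 0 al j.
  move=> jr; have := colA (index j rj).
  rewrite rev_map_nth EA big_map (nth_map 0) ?index_mem // nth_index // => <-.
  by apply: eq_bigr => i _; rewrite (nth_map 0) ?index_mem // nth_index.
have count1 i : count (fun z => z.1 == i) P = nth 0 be i.
  transitivity (\sum_(k <- ri) (\sum_(j <- rj) N0 k j) * (k == i)).
    by rewrite countP; apply: eq_bigr => k _; rewrite big_distrl.
  have [ir|ir] := boolP (i \in ri).
    rewrite (bigD1_seq i) //= eqxx muln1 rowN0 // big1 ?addn0 // => k /negbTE ->.
    by rewrite muln0.
  rewrite big_seq big1 => [|k kr /=]; last by rewrite [_ == _](_ : _ = false) ?muln0 //;
    apply: contraNF ir => /eqP <-.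
  by rewrite nth_default // leqNgt -mem_ri.
have count2 j : count (fun z => z.2 == j) P = nth 0 al j.
  transitivity (\sum_(k <- rj) (\sum_(i <- ri) N0 i k) * (k == j)).
    by rewrite countP exchange_big; apply: eq_bigr => k _; rewrite big_distrl.
  have [jr|jr] := boolP (j \in rj).
    rewrite (bigD1_seq j) //= eqxx muln1 colN0 // big1 ?addn0 // => k /negbTE ->.
    by rewrite muln0.
  rewrite big_seq big1 => [|k kr /=]; last by rewrite [_ == _](_ : _ = false) ?muln0 //;
    apply: contraNF jr => /eqP <-.
  by rewrite nth_default // leqNgt -mem_rj.
have szP : size P = n.
  rewrite -count_predT countP /n -Es -[in RHS](sumn_rev be) -sumA sumnE EA !big_map.
  by apply: eq_bigr => i _; rewrite sumnE big_map; apply: eq_bigr => j _; rewrite muln1.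
(* [p1] gives each position [x] a member of [P] whose row is the block of [x]; [w] then sends [x]
   into the block of [al] named by the column of that member. *)
have [|p1 Ep1] := @exists_perm _ n (fun x => (nth (0, 0) P x).1) (fun x => reshape_index be x).
  by move=> t; rewrite count_be -count1 (count_nth (0, 0) _ szP).
have [|w Ew] := @exists_perm _ n (fun x => reshape_index al x) (fun x => (nth (0, 0) P (p1 x)).2).
  move=> t; rewrite count_reshape -count2 (count_nth (0, 0) _ szP).
  by rewrite (reindex_inj (@perm_inj _ p1)).
exists w; rewrite EA; apply/eq_in_map => i ir; apply/eq_in_map => j jr.
transitivity (count (pred1 (i, j)) P).
  rewrite (count_nth (0, 0) _ szP) [RHS](reindex_inj (@perm_inj _ p1)).
  by apply: eq_bigr => x _ /=; rewrite -Ew Ep1; case: (nth _ _ _).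
rewrite countP (bigD1_seq i) //= (bigD1_seq j) //= eqxx muln1.
rewrite big1 => [|k /negbTE ne]; last by rewrite xpair_eqE ne andbF muln0.
rewrite big1 ?addn0 // => k /negbTE ne; rewrite big1 // => l _.
by rewrite xpair_eqE ne muln0.
Qed.

Lemma sum_double_cosets :
  (\sum_(c in double_cosets n be al) (-1) ^+ coset_len c = matrix_sum (rev be) (rev al))%R.
Proof.
rewrite matrix_sumE -big_enum /=; pose f (c : {set 'S_n}) := block_matrix (repr c).
have cosP c : c \in double_cosets n be al -> forall w, (w \in c) <-> N w =2 N (repr c).
  case/imsetP=> w0 _ Ec; have mem_c w : (w \in c) <-> N w =2 N w0 by rewrite Ec;
    exact (double_cosetP be al w0 w).
  have rc : N (repr c) =2 N w0 by apply/mem_c/(@mem_repr _ _ w0)/mem_c.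
  by move=> w; split=> [/mem_c h i j|h]; [rewrite h rc | apply/mem_c => i j; rewrite h rc].
rewrite (perm_big (map f (enum (double_cosets n be al)))) /=.
  rewrite big_map !big_enum /=; apply: eq_bigr => c cD.
  rewrite (coset_lenE Es erefl cD) -(col_sum (repr c)) matrix_inv_map ?sorted_rev_iota //.
  by rewrite -(matrix_cinvE _ Ui Uj mi mj).
apply: uniq_perm; first exact: margin_matrices_uniq.
  rewrite map_inj_in_uniq ?enum_uniq // => c c'; rewrite !mem_enum => cD cD' /amat_inj E.
  apply/setP => w; apply/idP/idP => [/(cosP _ cD) h|/(cosP _ cD') h].
    by apply/(cosP _ cD') => i j; rewrite h E.
  by apply/(cosP _ cD) => i j; rewrite h E.
move=> A; apply/idP/mapP => [/amat_surj[w Ew]|[c _ ->]]; last exact: amat_mats.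
pose c := (young_subgroup n be * [set w] * young_subgroup n al)%g.
have cD : c \in double_cosets n be al by apply/imsetP; exists w.
exists c; first by rewrite mem_enum.
rewrite -Ew; apply: amat_eq; apply/(cosP _ cD); exact/(double_cosetP be al w w).
Qed.

End CosetMatrices.

End DoubleCosetMatrices.

Lemma comp_formE (k : comNzRingType) be al : sumn be = sumn al ->
  comp_form k be al = (matrix_sum (rev be) (rev al))%:~R.
Proof.
move=> E; rewrite /comp_form E eqxx -(sum_double_cosets E) rmorph_sum /=.
by apply: eq_bigr => c _; rewrite rmorphXn rmorphN rmorph1.
Qed.

(** * The bilinear form *)

Section Form.
Variable k : comNzRingType.
Implicit Types (x y : freeAlg k) (F : composition -> k).

(** The linear extension of [F] from the basis of monomials. *)
Definition ev F x := \sum_(be <- msupp x) x@_be * F be.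

Lemma ev_wide (d : {fset composition}) F x : (msupp x `<=` d)%fset ->
  ev F x = \sum_(be <- d) x@_be * F be.
Proof.
move=> le_d; rewrite /ev (big_fset_incl _ le_d) //= => be _.
by move/mcoeff_outdom => ->; rewrite mul0r.
Qed.

Lemma ev_linear F a x y : ev F (a *: x + y) = a * ev F x + ev F y.
Proof.
pose d := (msupp (a *: x + y) `|` (msupp x `|` msupp y))%fset.
have dx : (msupp x `<=` d)%fset by apply: fsubset_trans (fsubsetUl _ _) (fsubsetUr _ _).
have dy : (msupp y `<=` d)%fset by apply: fsubset_trans (fsubsetUr _ _) (fsubsetUr _ _).
rewrite (ev_wide _ dx) (ev_wide _ dy) (@ev_wide d) ?fsubsetUl //.
rewrite mulr_sumr -big_split; apply: eq_bigr => be _.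
by rewrite mcoeffD mcoeffZ mulrDl mulrA.
Qed.

Lemma evU F be : ev F << be >> = F be.
Proof. by rewrite /ev msuppU1 big_seq_fset1 mcoeffUU mul1r. Qed.

Lemma free_formE x y :
  free_form x y = ev (fun be => ev (fun al => comp_form k (comp_seq be) (comp_seq al)) y) x.
Proof.
apply: eq_bigr => be _; rewrite mulr_sumr; apply: eq_bigr => al _.
by rewrite mulrA.
Qed.

Lemma free_formEr x y : free_form x y = ev (fun al => free_form x << al >>) y.
Proof.
rewrite /free_form exchange_big /=; apply: eq_bigr => al _.
rewrite mulr_sumr; apply: eq_bigr => be _.
by rewrite msuppU1 big_seq_fset1 mcoeffUU mulr1 mulrCA mulrA.
Qed.

Lemma comp_seq_gt0 (be : composition) : 0%N \notin comp_seq be.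
Proof. by apply/negP => /mapP[[a a0] _ /= E]; rewrite -E in a0. Qed.

(** The Schur side of the Cauchy identity is symmetric in the two contents. *)
Lemma comp_form_sym be al : comp_form k be al = comp_form k al be.
Proof.
have [E|ne] := eqVneq (sumn be) (sumn al);
  last by rewrite /comp_form (negbTE ne) eq_sym (negbTE ne).
rewrite !comp_formE //; congr (_ %:~R).
rewrite -!cauchy ?sumn_rev // E; apply: eq_bigr => la _.
by rewrite -!mulrA; congr (_ * _); rewrite mulrC.
Qed.

Lemma free_form_sym x y : free_form x y = free_form y x.
Proof.
rewrite /free_form exchange_big /=; apply: eq_bigr => al _; apply: eq_bigr => be _.
by rewrite comp_form_sym; congr (_ * _); rewrite mulrC.
Qed.

Variable L : oddSym k.

Lemma osForm_linear (a : k) (u v w : L) :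
  osForm (a *: u + v) w = a * osForm u w + osForm v w.
Proof.
have [x <-] := osPi_surj u; have [y <-] := osPi_surj v; have [z <-] := osPi_surj w.
by rewrite -linearZ -rmorphD /= !osFormE !free_formE ev_linear.
Qed.

Lemma osForm_sym (u v : L) : osForm u v = osForm v u.
Proof.
have [x <-] := osPi_surj u; have [y <-] := osPi_surj v.
by rewrite !osFormE free_form_sym.
Qed.

Lemma osForm0 (w : L) : osForm 0 w = 0.
Proof.
have := osForm_linear 1 0 0 w; rewrite scaler0 addr0 mul1r => /eqP.
by rewrite -{1}[osForm 0 w]addr0 (inj_eq (addrI _)) eq_sym => /eqP.
Qed.

Lemma osFormZ a (u w : L) : osForm (a *: u) w = a * osForm u w.
Proof. by rewrite -[a *: u]addr0 osForm_linear osForm0 addr0. Qed.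

Lemma osFormD (u v w : L) : osForm (u + v) w = osForm u w + osForm v w.
Proof. by rewrite -[u]scale1r osForm_linear mul1r scale1r. Qed.

Lemma osFormB (u v w : L) : osForm (u - v) w = osForm u w - osForm v w.
Proof. by rewrite osFormD -scaleN1r osFormZ mulN1r. Qed.

Lemma osForm_sum (I : Type) (r : seq I) (F : I -> L) (w : L) :
  osForm (\sum_(i <- r) F i) w = \sum_(i <- r) osForm (F i) w.
Proof. by rewrite (big_morph (fun u => osForm u w) (fun u v => osFormD u v w) (osForm0 w)). Qed.

Lemma osForm_mulz (u w : L) z : osForm (u *~ z) w = osForm u w *~ z.
Proof. by rewrite -scaler_int osFormZ mulrzl. Qed.

Definition hprod (nu : seq nat) : L := seq_prod (odd_h L) nu.

Lemma hprod_cons a nu : hprod (a :: nu) = odd_h L a * hprod nu.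
Proof. by rewrite /hprod /seq_prod big_cons. Qed.

Lemma hprod_rcons a nu : hprod (rcons nu a) = hprod nu * odd_h L a.
Proof. by rewrite /hprod /seq_prod -cats1 big_cat big_seq1. Qed.

Lemma hprod_mono (be : composition) : osPi L << be >> = hprod (comp_seq be).
Proof.
case: be => s; rewrite /comp_seq /=; elim: s => [|a s IH] /=.
  rewrite /hprod /seq_prod big_nil -(rmorph1 (osPi L)); congr (osPi L _).
  by congr (mkmalgU _ 1); apply: val_inj; rewrite /= fm1.
rewrite hprod_cons -IH /odd_h /free_h valK.
rewrite -rmorphM; congr (osPi L _).
rewrite malgM_def fgmulUU mulr1; congr (mkmalgU _ 1); apply: val_inj.
rewrite /= fmM /fmu fmE /=; congr (_ :: _); exact: val_inj.
Qed.

Lemma hprod_preimage nu : 0%N \notin nu -> exists2 be : composition,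
  comp_seq be = nu & hprod nu = osPi L << be >>.
Proof.
move=> nu0; suff [be E] : exists be : composition, comp_seq be = nu.
  by exists be => //; rewrite hprod_mono E.
elim: nu nu0 => [|a nu IH]; first by exists (FMonom [::]).
rewrite inE negb_or => /andP[a0 /IH[[s] E]].
have {}a0 : (0 < a)%N by rewrite lt0n eq_sym.
by exists (FMonom ((exist _ a a0 : posnat) :: s)); rewrite /comp_seq /= -E.
Qed.

Lemma form_hprod be al : 0%N \notin be -> 0%N \notin al ->
  osForm (hprod be) (hprod al) = comp_form k be al.
Proof.
move=> /hprod_preimage[b Eb ->] /hprod_preimage[a Ea ->].
by rewrite osFormE free_formE !evU Eb Ea.
Qed.

(** The products [h_nu] over compositions span, so pairing with them decides membership in the
    radical. *)
Lemma os_eq0 (u : L) : (forall nu, 0%N \notin nu -> osForm u (hprod nu) = 0) -> u = 0.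
Proof.
have [x <-] := osPi_surj u => h; apply/osPi_ker => y; rewrite free_formEr /ev big1 // => al _.
by rewrite -(osFormE L) hprod_mono h ?mulr0 // comp_seq_gt0.
Qed.

Lemma os_homog_form n (u : L) nu : os_homog n u -> 0%N \notin nu -> sumn nu <> n ->
  osForm u (hprod nu) = 0.
Proof.
case=> x hx -> /hprod_preimage[al Eal ->] ne.
rewrite osFormE free_formE {1}/ev big_seq big1 // => be bex; rewrite evU Eal.
rewrite /comp_form (hx _ bex) ifF ?mulr0 //.
by apply/negbTE/eqP => E; apply: ne.
Qed.

End Form.

(** * Schur functions *)

Lemma sgz_scale (k : comNzRingType) (W : lmodType k) m (v : W) :
  (-1) ^+ m *: v = v *~ (-1) ^+ m.
Proof. by rewrite -scaler_int rmorphXn rmorphN rmorph1. Qed.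

Lemma strip_wt_eq_size la mu : is_part la -> is_part mu -> sumn la = sumn mu ->
  strip_wt la mu = (la == mu)%:R.
Proof.
move=> laP muP E; case: eqP => [->|ne].
  rewrite /strip_wt (_ : hstrip mu mu); last first.
    by apply/hstripP => i; rewrite leqnn part_noninc.
  by rewrite /hexp big1 // => i _; rewrite subnn.
rewrite /strip_wt; case: ifP => // /hstripP hs; case: ne; apply: part_ext => // i.
pose R := maxn (size la) (size mu).
case: (ltnP i R) => [lt|le]; last first.
  by rewrite !nth_default // (leq_trans _ le) // ?leq_maxl ?leq_maxr.
apply: (@sum_eq_pointwise R (fun j => nth 0%N la j) (fun j => nth 0%N mu j) _ _ (Ordinal lt)).
  by move=> j; have /andP[] := hs j.
by rewrite -!sumn_nth ?leq_maxl ?leq_maxr ?E.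
Qed.

Lemma conj_inj la mu : is_part la -> is_part mu -> 
  (conj_part la == conj_part mu) = (la == mu).
Proof.
move=> laP muP; apply/eqP/eqP => [E|->] //.
by rewrite -(conj_partK laP) E conj_partK.
Qed.

Section Main.
Variables (k : comNzRingType) (L : oddSym k).
Variables (s : forall n : nat, intpart n -> L) (hs : is_odd_schur s).

(* The rescaling by the sign of [T_la] removes the normalisation of the Kostka
   numbers. *)
Definition sigma (la : seq nat) : L :=
  if insub la is Some p then s (p : intpart (sumn la)) *~ (-1) ^+ texp la else 0.

Lemma sigmaE n (la : intpart n) : sigma la = s la *~ (-1) ^+ texp la.
Proof.
case: la => la laP; have En : n = sumn la by case/and3P: (laP) => _ _ /eqP.
by subst n; rewrite /sigma /= insubT; congr (s _ *~ _); apply: val_inj.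
Qed.

Lemma signK m (v : L) : v *~ (-1) ^+ m *~ (-1) ^+ m = v.
Proof. by rewrite -mulrzA -expr2 sqrr_sign mulr1z. Qed.

Lemma s_sigma n (la : intpart n) : s la = sigma la *~ (-1) ^+ texp la.
Proof. by rewrite sigmaE signK. Qed.

Lemma partns_intpart n la : la \in partns n -> exists p : intpart n, la = p.
Proof. by case/mapP=> p _ ->; exists p. Qed.

Lemma part_no0 n la : la \in partns n -> 0%N \notin la.
Proof. by case/partnsP => /andP[]. Qed.

Lemma hprod_part n mu : mu \in partns n ->
  hprod L mu = \sum_(la <- partns n) sigma la *~ strip_chains (rev mu) la.
Proof.
move=> mun; have [_ muN] := partnsP mun; have [p Ep] := partns_intpart mun.
have [_ h] := hs n; rewrite /hprod Ep h -sum_partns; apply: eq_bigr => la _.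
have [laP laN] : is_part la /\ sumn la = n.
  by have := intpartP la; rewrite is_intpartE => /andP[? /eqP].
rewrite -Ep odd_kostkaE ?laN ?muN // scaler_int s_sigma -mulrzA mulrA -expr2.
by rewrite sqrr_sign mul1r.
Qed.

Lemma sigma_homog n la nu : la \in partns n -> 0%N \notin nu -> sumn nu <> n ->
  osForm (sigma la) (hprod L nu) = 0.
Proof.
case/partns_intpart=> p -> nu0 ne; rewrite sigmaE osForm_mulz.
by rewrite (@os_homog_form _ _ n) ?mul0rz //; case: (hs n) => + _; apply.
Qed.

Lemma form_hprod_sum n be al : 0%N \notin be -> 0%N \notin al -> sumn be = n -> sumn al = n ->
  osForm (hprod L be) (hprod L al) =
  (\sum_(la <- partns n) eps la * strip_chains (rev be) la * strip_chains (rev al) la)%:~R.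
Proof.
move=> be0 al0 beN alN; rewrite form_hprod // comp_formE ?beN ?alN // -cauchy ?sumn_rev ?beN //.
by rewrite alN.
Qed.

Lemma sum_mulz_sub (W : zmodType) (r : seq (seq nat)) (x y : seq nat -> W) (z : seq nat -> int) :
  \sum_(la <- r) (x la - y la) *~ z la =
  \sum_(la <- r) x la *~ z la - \sum_(la <- r) y la *~ z la.
Proof. by rewrite -sumrB; apply: eq_bigr => la _; rewrite mulrzBl. Qed.

Lemma intz_sum (r : seq (seq nat)) (F : seq nat -> int) :
  (\sum_(la <- r) F la)%:~R = \sum_(la <- r) (F la)%:~R :> k.
Proof. by rewrite rmorph_sum. Qed.

(** Summed over [la] against [strip_chains (rev mu) la], both sides give [(h_mu, h_nu)], by the
    definition of the Schur functions and by the Cauchy identity; separation then compares them for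
    each [la]. *)
Lemma sigma_hprod n nu la : la \in partns n -> 0%N \notin nu -> sumn nu = n ->
  osForm (sigma la) (hprod L nu) = (eps la * strip_chains (rev nu) la)%:~R.
Proof.
move=> lan nu0 nuN; apply/eqP; rewrite -subr_eq0; apply/eqP; move: la lan.
apply: strip_chains_separate => mu mun; rewrite sum_mulz_sub.
have [_ muN] := partnsP mun.
rewrite [X in X - _](_ : _ = osForm (hprod L mu) (hprod L nu)); last first.
  by rewrite (hprod_part mun) osForm_sum; apply: eq_bigr => la _; rewrite osForm_mulz.
rewrite (form_hprod_sum (n := n)) ?(part_no0 mun) // intz_sum -sumrB big1 // => la _.
by rewrite mulrAC !mulrzA subrr.
Qed.

(** Extends the defining expansion from partitions to compositions: both sides pair equally with
    every [h_ka]. *)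
Lemma hprod_comp n nu : 0%N \notin nu -> sumn nu = n ->
  hprod L nu = \sum_(la <- partns n) sigma la *~ strip_chains (rev nu) la.
Proof.
move=> nu0 nuN; apply/eqP; rewrite -subr_eq0; apply/eqP/os_eq0 => ka ka0.
rewrite osFormB osForm_sum; have [kaN|ne] := eqVneq (sumn ka) n.
  rewrite (form_hprod_sum (n := n)) // intz_sum -sumrB big_seq big1 // => la lan.
  by rewrite osForm_mulz (sigma_hprod lan) // mulrAC !mulrzA subrr.
rewrite form_hprod // /comp_form nuN eq_sym (negbTE ne) sub0r big_seq big1 ?oppr0 // => la lan.
by rewrite osForm_mulz (sigma_homog lan) ?mul0rz //; apply/eqP.
Qed.

Lemma sigma_orth n la ka : la \in partns n -> ka \in partns n ->
  osForm (sigma la) (sigma ka) = (eps la *+ (la == ka))%:~R.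
Proof.
move=> lan kan; apply/eqP; rewrite -subr_eq0; apply/eqP; move: ka kan.
apply: strip_chains_separate => mu mun; rewrite sum_mulz_sub; have [_ muN] := partnsP mun.
rewrite [X in X - _](_ : _ = osForm (sigma la) (hprod L mu)); last first.
  rewrite osForm_sym (hprod_part mun) osForm_sum; apply: eq_bigr => ka _.
  by rewrite osForm_mulz osForm_sym.
rewrite (sigma_hprod lan) ?(part_no0 mun) // (bigD1_seq la) ?partns_uniq //= eqxx mulr1n.
rewrite big1 ?addr0 => [|ka /negbTE]; first by rewrite !mulrzA subrr.
by rewrite eq_sym => ->; rewrite mul0rz.
Qed.

Lemma odd_h0 : odd_h L 0 = 1.
Proof. by rewrite /odd_h /free_h insubN // rmorph1. Qed.

(** Summed against [strip_chains (rev mu)], both sides give [h_mu h_a], since the content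
    [rcons mu a] has a top strip of [a] boxes; separation isolates each [la]. *)
Lemma sigma_mul_h n a la : la \in partns n ->
  sigma la * odd_h L a = \sum_(rho <- partns (n + a)) sigma rho *~ strip_wt la rho.
Proof.
(* For [a = 0] the list [rcons mu a] used below would not be a composition. *)
move=> lan; have [->|a0] := posnP a.
  have [laP laN] := partnsP lan; rewrite odd_h0 mulr1 addn0 (bigD1_seq la) ?partns_uniq //=.
  rewrite strip_wt_eq_size // eqxx mulr1z big_seq_cond big1 ?addr0 // => rho.
  case/andP=> /partnsP[rhoP rhoN] /negbTE ne.
  by rewrite strip_wt_eq_size ?rhoN // eq_sym ne mulr0z.
apply/eqP; rewrite -subr_eq0; apply/eqP; move: la lan.
apply: strip_chains_separate => mu mun; rewrite sum_mulz_sub; have [muP muN] := partnsP mun.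
rewrite [X in X - _](_ : _ = hprod L (rcons mu a)); last first.
  by rewrite hprod_rcons (hprod_part mun) mulr_suml; apply: eq_bigr => la _; rewrite mulrzAl.
rewrite (hprod_comp (n := n + a)); last first.
- by rewrite -cats1 sumn_cat /= addn0 muN.
- by rewrite mem_rcons inE negb_or [0%N == a]eq_sym -lt0n a0 (part_no0 mun).
rewrite rev_rcons /= sumn_rev muN.
under [X in _ - X]eq_bigr do rewrite mulrz_suml.
rewrite exchange_big -sumrB big1 //= => rho _.
rewrite mulrz_sumr -sumrB big1 // => la _.
by rewrite !mulrzA subrr.
Qed.

(** * Multiplication by odd elementary functions *)

(** The factors [etaexp] depend only on the ends of the strip, so along a chain from the empty shape
    they telescope to the sign of the last shape. *)
Definition vstrip_wt (la tau : seq nat) : int :=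
  (-1) ^+ etaexp la * (-1) ^+ etaexp tau * strip_wt (conj_part la) (conj_part tau).

Lemma vstrip_wt_eq_size la tau : is_part la -> is_part tau -> sumn la = sumn tau ->
  vstrip_wt la tau = (la == tau)%:R.
Proof.
move=> laP tauP E; rewrite /vstrip_wt strip_wt_eq_size ?conj_is_part ?sumn_conj // conj_inj //.
by case: eqP => [->|_]; rewrite ?mulr0 // mulr1 -expr2 sqrr_sign.
Qed.

Lemma vstrip_wt_cancel la rho : is_part la -> is_part rho -> la != rho ->
  \sum_(tau <- partns_upto (sumn rho)) vstrip_wt la tau * strip_wt tau rho = 0.
Proof.
move=> laP rhoP ne; have := strip_cancel laP rhoP ne (leqnn _).
move/(congr1 (fun x => (-1) ^+ etaexp la * x)); rewrite mulr0 mulr_sumr => E.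
by rewrite -[RHS]E; apply: eq_bigr => tau _; rewrite /vstrip_wt !mulrA.
Qed.

Variables (e : nat -> L) (he : is_odd_elementary e).

Lemma signL m (v : L) : (-1) ^+ m * v = v *~ (-1) ^+ m.
Proof. by rewrite -mulrzl rmorphXn rmorphN rmorph1. Qed.

(** In the vanishing sum over all intermediate shapes, those of size below [n] contribute nothing,
    and of those of size [n + a] only [rho] itself does; that term is moved to the right. *)
Lemma sum_strips n a la rho : (0 < a)%N -> la \in partns n -> rho \in partns (n + a) ->
  \sum_(i < a) \sum_(tau <- partns (n + i)) vstrip_wt la tau * strip_wt tau rho =
    - vstrip_wt la rho.
Proof.
move=> a0 lan rhon; have [laP laN] := partnsP lan; have [rhoP rhoN] := partnsP rhon.
have ne : la != rho by apply: contraTneq a0 => E; move: rhoN; rewrite -E laN; lia.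
have := vstrip_wt_cancel laP rhoP ne; rewrite sum_partns_upto rhoN -addnS big_split_ord /=.
rewrite big1 ?add0r => [|d _]; last first.
  rewrite big_seq big1 // => tau /partnsP[tauP tauN].
  by rewrite /vstrip_wt strip_wt_sumn ?mulr0 ?mul0r // !sumn_conj // tauN laN.
rewrite big_ord_recr /= => /eqP; rewrite addr_eq0 => /eqP->; congr (- _).
rewrite (bigD1_seq rho) ?partns_uniq //= strip_wt_eq_size // eqxx mulr1.
rewrite big_seq_cond big1 ?addr0 // => tau /andP[/partnsP[tauP tauN] /negbTE ne'].
by rewrite strip_wt_eq_size ?tauN // ne' mulr0.
Qed.

Lemma sigma_mul_e n a la : la \in partns n ->
  sigma la * e a = \sum_(tau <- partns (n + a)) sigma tau *~ ((-1) ^+ 'C(a.+1, 2) *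
    vstrip_wt la tau).
Proof.
move=> lan; have [laP laN] := partnsP lan; have [e0 erel] := he.
elim/ltn_ind: a => a IH; have [Ea|a0] := posnP a.
  rewrite Ea e0 mulr1 addn0 (bigD1_seq la) ?partns_uniq //=.
  rewrite vstrip_wt_eq_size // eqxx bin_small // mulr1 mulr1z.
  rewrite big_seq_cond big1 ?addr0 // => tau /andP[/partnsP[tauP tauN] /negbTE ne].
  by rewrite vstrip_wt_eq_size ?tauN // eq_sym ne mulr0 mulr0z.
have := congr1 (fun x => sigma la * x) (erel a a0);
  rewrite mulr0 big_ord_recr /= subnn odd_h0 mulr1.
rewrite mulrDr mulr_sumr signL mulrzAr.
(* As [h_0 = 1], the last term of the recursion isolates [e a]; the others involve [e i] with
   [i < a], for which the induction hypothesis holds. *)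
rewrite (_ : \sum_(i < a) _ = - (\sum_(rho <- partns (n + a)) sigma rho *~ vstrip_wt la rho)).
  move/eqP; rewrite addrC subr_eq0 => /eqP E.
  rewrite -[LHS](signK 'C(a.+1, 2)) E mulrz_suml; apply: eq_bigr => rho _.
  by rewrite mulrzAC -mulrzA.
transitivity (\sum_(i < a) \sum_(rho <- partns (n + a))
    sigma rho *~ (\sum_(tau <- partns (n + i)) vstrip_wt la tau * strip_wt tau rho)).
  apply: eq_bigr => i _; rewrite -mulrA signL mulrzAr mulrA IH //.
  rewrite mulr_suml mulrz_suml; under [RHS]eq_bigr do rewrite mulrz_sumr.
  rewrite [RHS]exchange_big /=; apply: eq_big_seq => tau taun.
  rewrite mulrzAl -mulrzA mulrAC -expr2 sqrr_sign mul1r (sigma_mul_h _ taun).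
  rewrite -addnA subnKC ?(ltnW (ltn_ord i)) // mulrz_suml; apply: eq_bigr => rho _.
  by rewrite mulrzAC -mulrzA.
rewrite exchange_big -sumrN; apply: eq_big_seq => rho rhon.
by rewrite -mulrz_sumr (sum_strips a0 lan rhon) mulrNz.
Qed.

Lemma e_expansion mu :
  seq_prod e mu = \sum_(la <- partns (sumn mu)) sigma la *~
    ((-1) ^+ (binom2 mu + sumn mu) * ((-1) ^+ etaexp la * strip_chains (rev mu) (conj_part la))).
Proof.
elim/last_ind: mu => [|mu a IH].
  have nil0 : [::] \in partns 0 by rewrite partns0 mem_head.
  have <- : hprod L [::] = seq_prod e [::] by rewrite /hprod /seq_prod !big_nil.
  rewrite (hprod_part nil0) /= partns0 !big_seq1; congr (_ *~ _).
  by rewrite /binom2 big_nil /etaexp big_ord0.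
rewrite /seq_prod -cats1 big_cat big_seq1 /= -/(seq_prod e mu) IH mulr_suml.
rewrite sumn_cat /= addn0.
transitivity (\sum_(la <- partns (sumn mu)) \sum_(tau <- partns (sumn mu + a)) sigma tau *~
   ((-1) ^+ (binom2 mu + sumn mu) * (-1) ^+ 'C(a.+1, 2) * (-1) ^+ etaexp tau *
     (strip_wt (conj_part la) (conj_part tau) * strip_chains (rev mu) (conj_part la)))).
  apply: eq_big_seq => la lan; rewrite mulrzAl (sigma_mul_e _ lan) mulrz_suml.
  apply: eq_bigr => tau _; rewrite -mulrzA; congr (_ *~ _); rewrite /vstrip_wt.
  have E2 (x y z : int) : x * x = 1 -> y = x * x * z -> y = z by move=> -> ->; rewrite mul1r.
  by apply: (E2 ((-1) ^+ etaexp la)); [rewrite -expr2 sqrr_sign | ring].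
rewrite exchange_big /=; apply: eq_bigr => tau _; rewrite -mulrz_sumr; congr (_ *~ _).
(* Summing over conjugates turns the vertical strips into the horizontal strips of
   [strip_chains]. *)
rewrite -mulr_sumr (@sum_conj _ (sumn mu) (fun ka => strip_wt ka (conj_part tau) *
  strip_chains (rev mu) ka)).
rewrite cats1 rev_rcons /= sumn_rev -[LHS]mulrA; congr (_ * _).
(* The identity C(a + 1, 2) = C(a, 2) + a yields the exponent [binom2 mu + sumn mu]. *)
rewrite -exprD; congr (_ ^+ _); rewrite /binom2 -cats1 big_cat big_seq1 /= binS bin1; lia.
Qed.

Lemma sign_assoc la mu : is_part la ->
  (-1) ^+ etaexp la * strip_chains (rev mu) (conj_part la) =
  (-1) ^+ (len_w la + sumn la) * ((-1) ^+ texp la * ((-1) ^+ texp (conj_part la) *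
    strip_chains (rev mu) (conj_part la))) :> int.
Proof.
move=> laP; rewrite !mulrA -!exprD; congr (_ * _); apply: signr_eq.
by rewrite -eta_parity // !oddD; do 4 case: (odd _).
Qed.

Lemma e_schur n (mu : intpart n) :
  (-1) ^+ (binom2 mu + sumn mu) *: seq_prod e mu =
  \sum_(la : intpart n)
    ((-1) ^+ (len_w la + sumn la) * (odd_kostka (conj_part la) mu)%:~R) *: s la.
Proof.
have /partnsP[muP muN] : val mu \in partns n by rewrite map_f ?mem_enum.
rewrite sgz_scale e_expansion muN -sum_partns mulrz_suml; apply: eq_bigr => la _.
have /partnsP[laP laN] : val la \in partns n by rewrite map_f ?mem_enum.
rewrite -scalerA sgz_scale scaler_int s_sigma -!mulrzA.
rewrite odd_kostkaE ?conj_is_part ?sumn_conj ?laN ?muN //; congr (_ *~ _).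
rewrite [LHS]mulrAC -expr2 sqrr_sign mul1r sign_assoc // laN mulrCA.
by congr (_ * _); rewrite mulrC.
Qed.

(** * Duality with the odd forgotten functions *)

Lemma e_sigma n mu la : mu \in partns n -> la \in partns n ->
  osForm (seq_prod e mu) (sigma la) = (eps la * ((-1) ^+ (binom2 mu + sumn mu) *
    ((-1) ^+ etaexp la * strip_chains (rev mu) (conj_part la))))%:~R.
Proof.
move=> mun lan; have [_ muN] := partnsP mun.
rewrite e_expansion muN osForm_sum (bigD1_seq la) ?partns_uniq //= big_seq_cond big1 ?addr0.
  by rewrite osForm_mulz (sigma_orth lan lan) eqxx mulr1n -mulrzA.
by move=> ka /andP[kan /negbTE ne]; rewrite osForm_mulz (sigma_orth kan lan) ne !mul0rz.
Qed.

Lemma sign_int m : (-1) ^+ m = ((-1) ^+ m : int)%:~R :> k.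
Proof. by rewrite rmorphXn rmorphN rmorph1. Qed.

(** After [sign_assoc], each of the signs from [len_w], [texp la], the size and binom2 of the
    conjugate occurs twice; the last of them occurs once in the prefactor and once as [eps la]. *)
Lemma sign_forgotten la mu : is_part la ->
  (-1) ^+ (len_w la + binom2 (conj_part la) + sumn la) * ((-1) ^+ texp la *
    (eps la * ((-1) ^+ (binom2 mu + sumn mu) * ((-1) ^+ etaexp la *
      strip_chains (rev mu) (conj_part la))))) =
  (-1) ^+ (binom2 mu + sumn mu) * ((-1) ^+ texp (conj_part la) *
    strip_chains (rev mu) (conj_part la)) :> int.
Proof.
move=> laP; rewrite sign_assoc // /eps -binom2_conj // !exprD.
have sq m : (-1) ^+ m * (-1) ^+ m = 1 :> int by rewrite -expr2 sqrr_sign.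
move: (sq (len_w la)) (sq (binom2 (conj_part la))) (sq (sumn la)) (sq (texp la)).
move: ((-1) ^+ len_w la) ((-1) ^+ binom2 (conj_part la)) ((-1) ^+ sumn la) ((-1) ^+ texp la).
move=> a b c d ha hb hc hd.
transitivity ((a * a) * (b * b) * (c * c) * (d * d) * ((-1) ^+ binom2 mu * (-1) ^+ sumn mu *
  ((-1) ^+ texp (conj_part la) * strip_chains (rev mu) (conj_part la)))); first by ring.
by rewrite ha hb hc hd !mul1r.
Qed.

Variables (f : forall n : nat, intpart n -> L) (hf : is_odd_forgotten e f).

Lemma forgotten_defect_e n (la mu : intpart n) :
  osForm ((-1) ^+ (len_w la + binom2 (conj_part la) + sumn la) *: s la -
    \sum_(nu : intpart n)
      ((-1) ^+ (binom2 nu + sumn nu) * (odd_kostka (conj_part la) nu)%:~R) *: f nu)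
    (seq_prod e mu) = 0.
Proof.
have [_ e_f] := hf n.
have lan : val la \in partns n by rewrite map_f ?mem_enum.
have mun : val mu \in partns n by rewrite map_f ?mem_enum.
have [laP laN] := partnsP lan; have [muP muN] := partnsP mun.
have Ef nu : osForm (f nu) (seq_prod e mu) = (mu == nu)%:R by rewrite osForm_sym e_f.
rewrite osFormB osForm_sum; apply/eqP; rewrite subr_eq0; apply/eqP.
rewrite [RHS](bigD1 mu) //= [X in _ = _ + X]big1 => [|nu /negbTE ne]; last first.
  by rewrite osFormZ Ef eq_sym ne mulr0.
rewrite addr0 !osFormZ Ef eqxx mulr1 s_sigma osForm_mulz osForm_sym (e_sigma mun lan).
rewrite odd_kostkaE ?conj_is_part ?sumn_conj ?laN ?muN //.
rewrite -mulrzA !sign_int -!intrM; congr (_ %:~R).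
have := sign_forgotten (val mu) laP; rewrite laN muN => <-.
by congr (_ * _); rewrite mulrC.
Qed.

Lemma schur_forgotten n (la : intpart n) :
  (-1) ^+ (len_w la + binom2 (conj_part la) + sumn la) *: s la =
  \sum_(mu : intpart n)
    ((-1) ^+ (binom2 mu + sumn mu) * (odd_kostka (conj_part la) mu)%:~R) *: f mu.
Proof.
have [f_homog _] := hf n; have [s_homog _] := hs n.
apply/eqP; rewrite -subr_eq0; apply/eqP.
set X := _ - _; have Xe mu : mu \in partns n -> osForm X (seq_prod e mu) = 0.
  by case/partns_intpart=> p ->; apply: forgotten_defect_e.
have Xsg ka : ka \in partns n -> osForm X (sigma ka) = 0.
  (* Indexing by conjugates and absorbing the sign [etaexp] turns orthogonality to all [e_mu] into
     the hypothesis of [strip_chains_separate]. *)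
  move=> kan; pose x nu := osForm X (sigma (conj_part nu)) *~ (-1) ^+ etaexp (conj_part nu).
  have xE nu : nu \in partns n -> x nu = 0.
    move: nu; apply: strip_chains_separate => mu mun; have [_ muN] := partnsP mun.
    have := Xe mu mun; rewrite osForm_sym e_expansion muN osForm_sum => E.
    have := congr1 (fun z => z *~ (-1) ^+ (binom2 mu + n)) E; rewrite mul0rz => {}E.
    rewrite -[RHS]E -(@sum_conj _ n (fun la => osForm (sigma la *~ ((-1) ^+ (binom2 mu + n) *
      ((-1) ^+ etaexp la * strip_chains (rev mu) (conj_part la)))) X)) mulrz_suml.
    apply: eq_big_seq => nu /partnsP[nuP _]; rewrite /x osForm_mulz osForm_sym -!mulrzA.
    rewrite conj_partK //; congr (_ *~ _).
    by rewrite [RHS]mulrAC -expr2 sqrr_sign mul1r.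
  have [kaP _] := partnsP kan; have := xE _ (conj_partns kan); rewrite /x conj_partK //.
  by move/(congr1 (fun z => z *~ (-1) ^+ etaexp ka));
    rewrite mul0rz -mulrzA -expr2 sqrr_sign mulr1z.
(* In degree [n] each [h_nu] is a combination of the [sigma ka]; in any other degree homogeneity
   makes both terms of [X] pair to zero. *)
apply: os_eq0 => nu nu0; have [nuN|/eqP ne] := eqVneq (sumn nu) n.
  rewrite osForm_sym (hprod_comp nu0 nuN) osForm_sum big_seq big1 // => ka kan.
  by rewrite osForm_mulz osForm_sym Xsg ?mul0rz.
rewrite /X osFormB osFormZ osForm_sum (os_homog_form (s_homog la) nu0 ne) mulr0 sub0r.
by rewrite big1 ?oppr0 // => mu _; rewrite osFormZ (os_homog_form (f_homog mu) nu0 ne) mulr0.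
Qed.

End Main.

Theorem corollary3p12 (k : comNzRingType) (L : oddSym k)
    (e : nat -> L) (s f : forall n : nat, intpart n -> L)
    (he : is_odd_elementary e) (hs : is_odd_schur s)
    (hf : is_odd_forgotten e f) (n : nat) :
  (forall mu : intpart n,
     (-1) ^+ (binom2 mu + sumn mu) *: seq_prod e mu =
     \sum_(la : intpart n)
       ((-1) ^+ (len_w la + sumn la) * (odd_kostka (conj_part la) mu)%:~R) *: s n la)
  /\
  (forall la : intpart n,
     (-1) ^+ (len_w la + binom2 (conj_part la) + sumn la) *: s n la =
     \sum_(mu : intpart n)
       ((-1) ^+ (binom2 mu + sumn mu) * (odd_kostka (conj_part la) mu)%:~R) *: f n mu).
Proof.
by split=> [mu|la]; [apply: (e_schur hs he) | apply: (schur_forgotten hs he hf)].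
Qed.
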